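(* Let $\mathcal{C}$ be a Hecke-type category over a commutative ring $\Bbbk$ (defined in the context). The following are equivalent. (1) For all $n\ge 0$ and all sequences of colors $\underline{i},\underline{j}$ of length $n$, $\operatorname{Hom}(\underline{i},\underline{j})$ is free as a left $R_{\underline{j}}$-module (dots in $R_{\underline{j}}$ acting on the left, i.e. at the top of diagrams), with basis indexed by the permissible permutations $w\in S_n$ from $\underline{i}$ to $\underline{j}$, obtained by taking, for each such $w$, the (undecorated) crossing diagram of an arbitrarily chosen reduced expression of $w$. (2) Each of the following ambiguities is resolvable. Here $\sigma$ is the crossing on two strands, $s=s_1$, $t=s_2$, $u=s_3$, and in each case the ambiguity is considered for every coloring of the strands for which the expression is permissible: (a) $\sigma\sigma\sigma$ (2 strands), with overlapping copies of $\sigma\sigma$; (b) $ssts$ (3 strands), with overlapping $ss$ and $sts$; (c) $stss$ (3 strands), with overlapping $sts$ and $ss$; (d) $ststs$ (3 strands), with the two copies of $sts$ overlapping in the middle $s$; (e) $stsuts = stusts$ (4 strands), with the two copies of $sts$ overlapping in the middle $s$; (f) $\sigma\sigma f$ (2 strands), for every $f$ in the ring of dots on the 2 strands; (g) $stsf$ (3 strands), for every $f$ in the ring of dots on the 3 strands; (h) $\sigma f g$ (2 strands), for all $f,g$ in the ring of dots on the 2 strands.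
   Context: Fix a commutative base ring $\Bbbk$. Diagrams are read bottom to top, and compositions $xy$ are read right to left, so the rightmost factor is at the bottom. Diagrams are considered up to rectilinear isotopy, i.e. up to the interchange law of strict monoidal categories. A Hecke-type category $\mathcal{C}$ is a $\Bbbk$-linear strict monoidal category presented as follows. The generating objects are a set $I$ of colors, so objects are words $\underline{i}=i_1\cdots i_n$ in $I$. The generating morphisms are: * for each $i\in I$, some commutative ring $R_i$ of maps in $\operatorname{End}(i)$ (''dots''); * for each pair $(i,j)$ in a given subset $C\subset I\times I$, a crossing $\sigma_{ij}\colon ij\to ji$. One says $\sigma_{ij}$ is permitted if $(i,j)\in C$. For $\underline{i}=i_1\cdots i_n$ set $R_{\underline{i}}=R_{i_1}\otimes_{\Bbbk}\cdots\otimes_{\Bbbk}R_{i_n}$, acting on $\underline{i}$ by dots on the $n$ strands. Write $s,t$ for the crossings of the first two, respectively last two, of three strands (independent of color), and on four strands $s,t,u$ for the crossings of strands in positions $(1,2),(2,3),(3,4)$. The relations are as follows, where $i,j,k\in I$ are pairwise distinct, each $\lambda$ is an invertible scalar, and the other coefficients are given elements of the indicated rings. * If $\sigma_{ii}$ is permitted, in $\operatorname{End}(ii)$: $\sigma_{ii}\sigma_{ii}=\alpha_i\sigma_{ii}+\beta_i\operatorname{id}_{ii}$, with $\alpha_i,\beta_i\in R_{ii}$. * If $\sigma_{ij},\sigma_{ji}$ are permitted, in $\operatorname{End}(ji)$: $\sigma_{ij}\sigma_{ji}=Q_{ji}\operatorname{id}_{ji}$, with $Q_{ji}\in R_{ji}$.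 * If $\sigma_{ii}$ is permitted, in $\operatorname{End}(iii)$: $sts=\lambda_{iii}\,tst+a_i\,st+b_i\,ts+c_i\,s+d_i\,t+e_i$, with $a_i,b_i,c_i,d_i,e_i\in R_{iii}$. * If $\sigma_{ii},\sigma_{ij}$ are permitted, in $\operatorname{Hom}(iij,jii)$: $sts=\lambda_{jii}\,tst+p_{jii}\,st$, with $p_{jii}\in R_{jii}$. * If $\sigma_{ii},\sigma_{ji}$ are permitted, in $\operatorname{Hom}(jii,iij)$: $sts=\lambda_{iij}\,tst+p_{iij}\,ts$, with $p_{iij}\in R_{iij}$. * If $\sigma_{ii},\sigma_{ij},\sigma_{ji}$ are permitted, in $\operatorname{End}(iji)$: $sts=\lambda_{iji}\,tst+q_{iji}\operatorname{id}_{iji}$, with $q_{iji}\in R_{iji}$. * If $\sigma_{ij},\sigma_{ik},\sigma_{jk}$ are permitted, in $\operatorname{Hom}(ijk,kji)$: $sts=\lambda_{kji}\,tst$. * If $\sigma_{ii}$ is permitted, for every $f\in R_{ii}$: $\sigma_{ii}f=\phi_i(f)\sigma_{ii}+\partial_i(f)\operatorname{id}_{ii}$, for some given linear maps $\phi_i,\partial_i\colon R_{ii}\to R_{ii}$. * If $\sigma_{ij}$ is permitted, for every $f\in R_{ij}$: $\sigma_{ij}f=\phi_{ij}(f)\sigma_{ij}$, for some given linear map $\phi_{ij}\colon R_{ij}\to R_{ji}$. Coefficients are placed on the left (top) of diagrams. For a crossing inside a diagram with more strands, the dot-moving relations are used with $\phi$ and $\partial$ extended by the identity on the tensor factors of the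 other strands. An expression is a word in the generators $s_1,\dots,s_{n-1}$ of $S_n$. Given a coloring of the strands at the bottom, it is permissible if every crossing occurring in it (a strand of color $i$ on the left crossing a strand of color $j$ on the right) is permitted. A permutation $w\in S_n$ is permissible from $\underline{i}$ to $\underline{j}$ if $w(\underline{i})=\underline{j}$ and the crossings in a reduced expression of $w$ are all permitted; this does not depend on the reduced expression. Resolvability: every relation is applied only in the direction left-hand side $\mapsto$ right-hand side as displayed (so $\sigma\sigma\mapsto\cdots$, $sts\mapsto \lambda tst+\cdots$, and dots are moved to the left past crossings). Dots on the same strands are multiplied in the rings $R_{\underline{i}}$, and dots at the top are treated as left scalars. An ambiguity is a diagram to which two relations can be applied in two ways. It is resolvable if the two results can be further reduced, by applying relations in these directions, to the same left linear combination (over dots at the top) of diagrams. In (a)–(e) the two ways are the applications of the relation at the two indicated overlapping subdiagrams. In (f) and (g) they are: applying the relation for $\sigma\sigma$ (resp. $sts$) first, or moving $f$ left past the crossings using the dot-moving relations first. In (h) they are: multiplying $f$ and $g$ first, or moving $f$ past the crossing first. *)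

(* Defs.v *)
From HB Require Import structures.
From mathcomp Require Import all_fingroup.
From mathcomp Require Import all_boot all_order all_algebra generic_quotient.
From mathcomp Require Import boolp.
From Stdlib Require Import Relations.Relation_Operators.

Set Implicit Arguments.
Unset Strict Implicit.
Unset Printing Implicit Defensive.

Import GRing.Theory.
Local Open Scope ring_scope.
Local Open Scope quotient_scope.

(* MathComp's comAlgType excludes the zero ring, but a tensor product of
   nonzero algebras may vanish; hence a commutative algebra is given here as a
   commutative ring with its structure morphism. *)
Record comAlg (kk : comPzRingType) := ComAlg {
  alg_ring :> comPzRingType;
  scal : {rmorphism kk -> alg_ring} }.
Arguments scal {kk} c.

Definition base_alg (kk : comPzRingType) : comAlg kk :=
  @ComAlg kk kk (idfun : {rmorphism kk -> kk}).

Definition klinear (kk : comPzRingType) (A B : comAlg kk) (f : A -> B) : Prop :=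
  {morph f : x y / x + y} /\ forall c x, f (scal A c * x) = scal B c * f x.

Section Tensor.
Variables (kk : comPzRingType) (A B : comAlg kk).

Inductive tens_eq : seq (A * B) -> seq (A * B) -> Prop :=
| tens_refl s : tens_eq s s
| tens_sym s t : tens_eq s t -> tens_eq t s
| tens_trans s t u : tens_eq s t -> tens_eq t u -> tens_eq s u
| tens_cat s s' t t' :
    tens_eq s s' -> tens_eq t t' -> tens_eq (s ++ t) (s' ++ t')
| tens_swap s t : tens_eq (s ++ t) (t ++ s)
| tens_0 b : tens_eq [:: (0, b)] [::]
| tens_addl a a' b : tens_eq [:: (a + a', b)] [:: (a, b); (a', b)]
| tens_addr a b b' : tens_eq [:: (a, b + b')] [:: (a, b); (a, b')]
| tens_scal c a b :
    tens_eq [:: (scal A c * a, b)] [:: (a, scal B c * b)].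

Definition tens_eqb (s t : seq (A * B)) : bool := `[< tens_eq s t >].

Lemma tens_eqb_refl : reflexive tens_eqb.
Proof. by move=> s; apply/asboolP; constructor. Qed.
Lemma tens_eqb_sym : symmetric tens_eqb.
Proof. by move=> s t; apply/asboolP/asboolP => h; apply: tens_sym. Qed.
Lemma tens_eqb_trans : transitive tens_eqb.
Proof.
by move=> t s u /asboolP h /asboolP h'; apply/asboolP; apply: tens_trans h'.
Qed.

Canonical tens_equiv :=
  EquivRel tens_eqb tens_eqb_refl tens_eqb_sym tens_eqb_trans.

Definition tensor := {eq_quot tens_equiv}.
HB.instance Definition _ := Choice.on tensor.
HB.instance Definition _ := EqQuotient.on tensor.

Definition tpure (a : A) (b : B) : tensor := \pi_tensor [:: (a, b)].

Lemma tensP s t : \pi_tensor s = \pi_tensor t <-> tens_eq s t.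
Proof.
split=> [/eqP|h]; first by rewrite piE => /asboolP.
by apply/eqP; rewrite piE; apply/asboolP.
Qed.

Definition tzero : tensor := \pi_tensor [::].
Definition tadd (x y : tensor) : tensor := \pi_tensor (repr x ++ repr y).
Definition topp (x : tensor) : tensor :=
  \pi_tensor [seq (- p.1, p.2) | p <- repr x].

Lemma tens_repr s : tens_eq (repr (\pi_tensor s)) s.
Proof. by apply/tensP; rewrite reprK. Qed.

Lemma taddE s t : tadd (\pi s) (\pi t) = \pi_tensor (s ++ t).
Proof. by apply/tensP; apply: tens_cat; apply: tens_repr. Qed.

Lemma taddA : associative tadd.
Proof.
move=> x y z; rewrite -[x]reprK -[y]reprK -[z]reprK !taddE.
by rewrite catA.
Qed.
Lemma taddC : commutative tadd.
Proof.
move=> x y; rewrite -[x]reprK -[y]reprK !taddE.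
by apply/tensP; apply: tens_swap.
Qed.
Lemma tadd0 : left_id tzero tadd.
Proof. by move=> x; rewrite -[x]reprK taddE. Qed.
Lemma taddN : left_inverse tzero topp tadd.
Proof.
move=> x; rewrite -{2}[x]reprK taddE; apply/tensP.
elim: (repr x) => [|[a b] s ih] /=; first exact: tens_refl.
set m := map _ _ in ih *.
have h1 : tens_eq ((- a, b) :: m ++ (a, b) :: s)
                  ([:: (- a, b); (a, b)] ++ (m ++ s)).
  rewrite -cat1s [X in _ ++ X]/= -[(a, b) :: s]cat1s !catA.
  rewrite -[X in tens_eq _ X]/((([:: (- a, b)] ++ [:: (a, b)]) ++ m) ++ s).
  apply: tens_cat; last exact: tens_refl.
  rewrite -!catA; apply: tens_cat; first exact: tens_refl.
  exact: tens_swap.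
apply: tens_trans h1 _.
rewrite -[X in tens_eq _ X]cat0s; apply: tens_cat => //.
apply: (@tens_trans _ [:: (- a + a, b)]); last by rewrite addNr; apply: tens_0.
by apply: tens_sym; apply: tens_addl.
Qed.

HB.instance Definition _ :=
  GRing.isZmodule.Build tensor taddA taddC tadd0 taddN.

(* The additive map A (x) B -> M sending a (x) b to F a b; meaningful when F
   is balanced, see tliftE. *)
Definition tlift (M : zmodType) (F : A -> B -> M) (x : tensor) : M :=
  \sum_(p <- repr x) F p.1 p.2.

Definition balanced (M : zmodType) (F : A -> B -> M) : Prop :=
  [/\ forall a a' b, F (a + a') b = F a b + F a' b,
      forall a b b', F a (b + b') = F a b + F a b' &
      forall c a b, F (scal A c * a) b = F a (scal B c * b)].

Lemma tliftE (M : zmodType) (F : A -> B -> M) (s : seq (A * B)) :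
  balanced F -> tlift F (\pi s) = \sum_(p <- s) F p.1 p.2.
Proof.
move=> [Fl Fr Fs]; rewrite /tlift.
move: (repr _) (tens_repr s) => r; elim=> //=.
- by move=> t u v _ -> _ ->.
- by move=> t t' u u' _ e _ e'; rewrite !big_cat /= e e'.
- by move=> t u; rewrite !big_cat /= addrC.
- move=> b; rewrite big_cons !big_nil addr0 /=.
  by apply: (addrI (F 0 b)); rewrite -Fl !addr0.
- by move=> a a' b; rewrite !big_cons !big_nil /= !addr0 Fl.
- by move=> a b b'; rewrite !big_cons !big_nil /= !addr0 Fr.
- by move=> c a b; rewrite !big_cons !big_nil /= Fs.
Qed.

Lemma tpureDl a a' b : tpure (a + a') b = tpure a b + tpure a' b.
Proof. by rewrite [RHS]taddE; apply/tensP; apply: tens_addl. Qed.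
Lemma tpureDr a b b' : tpure a (b + b') = tpure a b + tpure a b'.
Proof. by rewrite [RHS]taddE; apply/tensP; apply: tens_addr. Qed.
Lemma tpure_scal c a b : tpure (scal A c * a) b = tpure a (scal B c * b).
Proof. by apply/tensP; apply: tens_scal. Qed.

Lemma tensE s : \pi_tensor s = \sum_(p <- s) tpure p.1 p.2.
Proof.
elim: s => [|[a b] s ih]; first by rewrite big_nil.
by rewrite big_cons -ih [RHS]taddE.
Qed.

Lemma tens_ind (P : tensor -> Prop) :
  P 0 -> (forall x y, P x -> P y -> P (x + y)) ->
  (forall a b, P (tpure a b)) -> forall x, P x.
Proof.
move=> P0 PD Pp x; rewrite -[x]reprK tensE.
by elim: (repr x) => [|p s ih]; rewrite ?big_nil // big_cons; apply: PD.
Qed.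

Section Lift.
Variables (M : zmodType) (F : A -> B -> M).
Hypothesis hF : balanced F.

Lemma tlift_pure a b : tlift F (tpure a b) = F a b.
Proof. by rewrite tliftE // big_seq1. Qed.
Lemma tliftD x y : tlift F (x + y) = tlift F x + tlift F y.
Proof.
rewrite -[x]reprK -[y]reprK [_ + _]taddE !tliftE //.
by rewrite big_cat.
Qed.
Lemma tlift0 : tlift F 0 = 0.
Proof. by apply: (addrI (tlift F 0)); rewrite -tliftD !addr0. Qed.
End Lift.

Definition tone : tensor := tpure 1 1.
Definition tmul (x y : tensor) : tensor :=
  tlift (fun a b => tlift (fun a' b' => tpure (a * a') (b * b')) y) x.

Lemma tmul_bal2 a b : balanced (fun a' b' => tpure (a * a') (b * b')).
Proof.
split=> [a1 a2 b'|a' b1 b2|c a' b']; rewrite ?mulrDr ?tpureDl ?tpureDr //.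
by rewrite mulrCA tpure_scal mulrCA.
Qed.

Lemma tmul_bal1 y :
  balanced (fun a b => tlift (fun a' b' => tpure (a * a') (b * b')) y).
Proof.
split=> [a1 a2 b|a b1 b2|c a b]; elim/tens_ind: y => [|y1 y2 e1 e2|a' b'];
  rewrite ?tlift0 ?addr0 ?tliftD ?e1 ?e2 1?addrACA //;
  rewrite ?tlift_pure ?mulrDl ?tpureDl ?tpureDr //;
  try exact: tmul_bal2.
by rewrite -!mulrA tpure_scal.
Qed.

Lemma tmulDl : left_distributive tmul +%R.
Proof. by move=> x y z; rewrite /tmul tliftD //; apply: tmul_bal1. Qed.
Lemma tmul_pure a b a' b' :
  tmul (tpure a b) (tpure a' b') = tpure (a * a') (b * b').
Proof.
by rewrite /tmul tlift_pure ?tlift_pure //;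
  [apply: tmul_bal2|apply: tmul_bal1].
Qed.
Lemma tmul0x x : tmul 0 x = 0.
Proof. by rewrite /tmul tlift0 //; apply: tmul_bal1. Qed.
Lemma tmulDr : right_distributive tmul +%R.
Proof.
move=> x y z; elim/tens_ind: x => [|x1 x2 e1 e2|a b].
- by rewrite !tmul0x addr0.
- by rewrite !tmulDl e1 e2 addrACA.
rewrite /tmul !tlift_pure; try exact: tmul_bal1.
by rewrite tliftD //; apply: tmul_bal2.
Qed.
Lemma tmulx0 x : tmul x 0 = 0.
Proof. by apply: (addrI (tmul x 0)); rewrite -tmulDr !addr0. Qed.
Lemma tmulC : commutative tmul.
Proof.
move=> x y; elim/tens_ind: x => [|x1 x2 e1 e2|a b].
- by rewrite tmul0x tmulx0.
- by rewrite tmulDl tmulDr e1 e2.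
elim/tens_ind: y => [|y1 y2 e1 e2|a' b'].
- by rewrite tmul0x tmulx0.
- by rewrite tmulDl tmulDr e1 e2.
by rewrite !tmul_pure mulrC [b * _]mulrC.
Qed.
Lemma tmulA : associative tmul.
Proof.
move=> x y z; elim/tens_ind: x => [|x1 x2 e1 e2|a b].
- by rewrite !tmul0x.
- by rewrite !tmulDl e1 e2.
elim/tens_ind: y => [|y1 y2 e1 e2|a' b'].
- by rewrite !(tmul0x, tmulx0).
- by rewrite !(tmulDl, tmulDr) e1 e2.
elim/tens_ind: z => [|z1 z2 e1 e2|a'' b''].
- by rewrite !(tmul0x, tmulx0).
- by rewrite !(tmulDl, tmulDr) e1 e2.
by rewrite !tmul_pure !mulrA.
Qed.
Lemma tmul1 : left_id tone tmul.
Proof.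
elim/tens_ind => [|x1 x2 e1 e2|a b].
- exact: tmulx0.
- by rewrite tmulDr e1 e2.
by rewrite tmul_pure !mul1r.
Qed.

HB.instance Definition _ :=
  GRing.Zmodule_isComPzRing.Build tensor tmulA tmulC tmul1 tmulDl.

Lemma tpureM a b a' b' :
  tpure a b * tpure a' b' = tpure (a * a') (b * b').
Proof. exact: tmul_pure. Qed.

Definition tscal (c : kk) : tensor := tpure (scal A c) 1.

Fact tscal_zmod : zmod_morphism tscal.
Proof.
move=> c d; rewrite /tscal rmorphB /=; apply: (addIr (tpure (scal A d) 1)).
by rewrite -tpureDl !subrK.
Qed.
Fact tscal_monoid : monoid_morphism tscal.
Proof.
split; first by rewrite /tscal rmorph1.
by move=> c d; rewrite [RHS]tmul_pure mulr1 -rmorphM.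
Qed.
HB.instance Definition _ := GRing.isZmodMorphism.Build kk tensor tscal tscal_zmod.
HB.instance Definition _ :=
  GRing.isMonoidMorphism.Build kk tensor tscal tscal_monoid.

Definition tens_alg : comAlg kk := @ComAlg kk tensor tscal.

End Tensor.

(* R_w = R_(w_1) (x) ... (x) R_(w_n). *)
Fixpoint dots (kk : comPzRingType) (I : Type) (R : I -> comAlg kk)
    (w : seq I) : comAlg kk :=
  if w is i :: w' then tens_alg (R i) (dots R w') else base_alg kk.

Section Dots.
Variables (kk : comPzRingType) (I : Type) (R : I -> comAlg kk).
Local Notation Rw := (dots R).

(* f (x) g under R_v (x) R_w = R_(v ++ w) *)
Fixpoint tcat (v w : seq I) : Rw v -> Rw w -> Rw (v ++ w) :=
  match v return Rw v -> Rw w -> Rw (v ++ w) with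
  | [::] => fun c g => scal (Rw w) c * g
  | i :: v' => fun f g =>
      tlift (fun r f' => tpure r (tcat f' g) : Rw (i :: v' ++ w)) f
  end.

(* The additive map R_(v ++ w) -> M sending tcat f g to F f g; see tsplitE. *)
Fixpoint tsplit (M : zmodType) (v w : seq I) :
    (Rw v -> Rw w -> M) -> Rw (v ++ w) -> M :=
  match v return (Rw v -> Rw w -> M) -> Rw (v ++ w) -> M with
  | [::] => fun F g => F 1 g
  | i :: v' => fun F =>
      tlift (fun r : R i =>
        tsplit (fun (f : Rw v') g => F (tpure r f : Rw (i :: v')) g))
  end.

(* id (x) f (x) id, see textE. *)
Definition text (a b v w : seq I) (f : Rw v -> Rw w) :
    Rw (a ++ v ++ b) -> Rw (a ++ w ++ b) :=
  tsplit (fun g => tsplit (fun x h => tcat g (tcat (f x) h))).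

Lemma tpure_bal (A B : comAlg kk) : balanced (@tpure kk A B).
Proof.
by split=> *; rewrite ?tpureDl ?tpureDr ?tpure_scal.
Qed.

Lemma scal_dots i v c :
  scal (Rw (i :: v)) c = tpure (scal (R i) c) (1 : Rw v).
Proof. by []. Qed.

Lemma tpureZr i v c r (f : Rw v) :
  tpure r (scal (Rw v) c * f) = scal (Rw (i :: v)) c * tpure r f.
Proof. by rewrite scal_dots [RHS]tmul_pure mul1r tpure_scal. Qed.

Lemma tcat_bilinear v w :
  (forall f, klinear (@tcat v w f)) /\ (forall g, klinear ((@tcat v w)^~ g)).
Proof.
elim: v => [|i v [ihr ihl]].
  split=> [c|g].
    by split=> [x y|c' x] /=; rewrite ?mulrDr // mulrCA.
  by split=> [x y|c' x] /=; rewrite ?rmorphD ?mulrDl ?rmorphM ?mulrA.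
have bal g : balanced (fun (r : R i) f' => tpure r (@tcat v w f' g)).
  split=> [a a' b|a b b'|c a b]; first exact: tpureDl.
    by rewrite (ihl g).1 tpureDr.
  by rewrite (ihl g).2 tpure_scal.
have addl g x y : @tcat (i :: v) w (x + y) g = tcat x g + tcat y g.
  exact: (tliftD (bal g)).
split=> [f|g].
  split=> [x y|c x]; elim/tens_ind: f => [|f1 f2 e1 e2|r f].
  - by rewrite /= !(tlift0 (bal _)) addr0.
  - by rewrite !addl e1 e2 addrACA.
  - by rewrite /= !(tlift_pure (bal _)) (ihr f).1 tpureDr.
  - by rewrite /= !(tlift0 (bal _)) mulr0.
  - by rewrite !addl e1 e2 mulrDr.
  - by rewrite /= !(tlift_pure (bal _)) (ihr f).2 tpureZr.
split=> [x y|c x]; first exact: addl.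
elim/tens_ind: x => [|x y e1 e2|r f].
- by rewrite mulr0 /= !(tlift0 (bal _)) mulr0.
- by rewrite mulrDr !addl e1 e2 mulrDr.
rewrite scal_dots [_ * _]tmul_pure mul1r /= !(tlift_pure (bal _)).
by rewrite [RHS]tmul_pure mul1r.
Qed.

Lemma eq_tsplit (M : zmodType) v w (F G : Rw v -> Rw w -> M) x :
  (forall f g, F f g = G f g) -> tsplit F x = tsplit G x.
Proof.
elim: v F G x => [|i v ih] F G x eFG //=.
by apply: eq_bigr => p _; apply: ih.
Qed.

Lemma tsplitDF (M : zmodType) v w (F G : Rw v -> Rw w -> M) x :
  tsplit (fun f g => F f g + G f g) x = tsplit F x + tsplit G x.
Proof.
elim: v F G x => [|i v ih] F G x //=.
by rewrite /tlift -big_split; apply: eq_bigr => p _; apply: ih.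
Qed.

Lemma tsplit_facts (M : zmodType) v w (F : Rw v -> Rw w -> M) : balanced F ->
  (forall x y, tsplit F (x + y) = tsplit F x + tsplit F y) /\
  (forall c x, tsplit F (scal (Rw (v ++ w)) c * x)
               = tsplit (fun f g => F (scal (Rw v) c * f) g) x).
Proof.
elim: v F => [|i v ih] F [Fl Fr Fs].
  by split=> [x y|c x] /=; rewrite ?Fr // -Fs.
have balF r : balanced (fun (f : Rw v) g => F (tpure r f : Rw (i :: v)) g).
  split=> [a a' b|a b b'|c a b]; rewrite ?tpureDr ?Fl ?Fr //.
  by rewrite tpureZr Fs.
have bal (G : Rw (i :: v) -> Rw w -> M) : balanced G -> balanced (fun (r : R i) =>
    tsplit (fun (f : Rw v) g => G (tpure r f : Rw (i :: v)) g)).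
  move=> [Gl Gr Gs].
  have balG r : balanced (fun (f : Rw v) g => G (tpure r f : Rw (i :: v)) g).
    split=> [a a' b|a b b'|c a b]; rewrite ?tpureDr ?Gl ?Gr //.
    by rewrite tpureZr Gs.
  split=> [a a' b|a b b'|c a b].
  - by rewrite -tsplitDF; apply: eq_tsplit => f g; rewrite tpureDl Gl.
  - by rewrite (ih _ (balG a)).1.
  rewrite (ih _ (balG a)).2; apply: eq_tsplit => f g.
  by rewrite tpure_scal.
split=> [x y|c x]; first by rewrite /= (tliftD (bal F _)).
have balc : balanced (fun f g => F (scal (Rw (i :: v)) c * f) g).
  split=> [a a' b|a b b'|c' a b]; rewrite ?mulrDr ?Fl ?Fr //.
  by rewrite mulrCA [LHS]Fs.
elim/tens_ind: x => [|x y e1 e2|r f].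
- by rewrite mulr0 /= (tlift0 (bal _ _)) // (tlift0 (bal _ balc)).
- rewrite mulrDr /= (tliftD (bal _ _)) // (tliftD (bal _ balc)).
  by congr (_ + _).
rewrite [scal _ c]scal_dots [_ * _]tmul_pure mul1r /=.
rewrite (tlift_pure (bal _ _)) // (tlift_pure (bal _ balc)).
by apply: eq_tsplit => f' g; rewrite scal_dots tpureM mul1r.
Qed.

Lemma tsplitE (M : zmodType) v w (F : Rw v -> Rw w -> M) f g :
  balanced F -> tsplit F (tcat f g) = F f g.
Proof.
elim: v F f => [|i v ih] F f [Fl Fr Fs].
  by rewrite /= -Fs mulr1.
have balF r : balanced (fun (f : Rw v) g => F (tpure r f : Rw (i :: v)) g).
  split=> [a a' b|a b b'|c a b]; rewrite ?tpureDr ?Fl ?Fr //.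
  by rewrite tpureZr Fs.
have [sD _] := tsplit_facts (And3 Fl Fr Fs).
have F0 : F 0 g = 0 by apply: (addrI (F 0 g)); rewrite -Fl !addr0.
have [_ /(_ g) [catD _]] := tcat_bilinear (i :: v) w.
elim/tens_ind: f => [|x y e1 e2|r f].
- rewrite F0; apply: (addrI (tsplit F (tcat (0 : Rw (i :: v)) g))).
  by rewrite -sD -catD !addr0.
- by rewrite catD sD e1 e2 Fl.
have e : tcat (tpure r f : Rw (i :: v)) g = tpure r (tcat f g).
  rewrite /= tlift_pure //; split=> [a a' b|a b b'|c a b].
  - exact: tpureDl.
  - by rewrite ((tcat_bilinear v w).2 g).1 tpureDr.
  - by rewrite ((tcat_bilinear v w).2 g).2 tpure_scal.
rewrite e /= tlift_pure; first exact: (ih _ f (balF r)).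
split=> [a a' b|a b b'|c a b].
- by rewrite -tsplitDF; apply: eq_tsplit => f' g'; rewrite tpureDl Fl.
- by rewrite (tsplit_facts (balF a)).1.
rewrite (tsplit_facts (balF a)).2; apply: eq_tsplit => f' g'.
by rewrite tpure_scal.
Qed.

Lemma textE a b v w (f : Rw v -> Rw w) g x h : klinear f ->
  @text a b v w f (tcat g (tcat x h)) = tcat g (tcat (f x) h).
Proof.
move=> [fD fZ].
have bilC v' w' := @tcat_bilinear v' w'.
have bal1 g' : balanced (fun x h => @tcat a _ g' (@tcat w b (f x) h)).
  split=> [x1 x2 h'|x' h1 h2|c x' h'].
  - by rewrite fD ((bilC _ _).2 _).1 ((bilC _ _).1 _).1.
  - by rewrite ((bilC _ _).1 _).1 ((bilC _ _).1 _).1.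
  by rewrite fZ ((bilC _ _).2 _).2 -((bilC _ _).1 _).2.
rewrite /text tsplitE ?tsplitE //.
split=> [g1 g2 t|g' t1 t2|c g' t].
- by rewrite -tsplitDF; apply: eq_tsplit => x' h'; rewrite ((bilC _ _).2 _).1.
- exact: (tsplit_facts (bal1 g')).1.
rewrite (tsplit_facts (bal1 g')).2; apply: eq_tsplit => x' h'.
by rewrite fZ ((bilC _ _).2 _).2 ((bilC _ _).2 _).2 ((bilC _ _).1 _).2.
Qed.

End Dots.

(* The coefficients are given for all colors; only those for which the
   corresponding crossings are permitted are ever used.  [lam x y z] is the
   scalar of the braid relation whose top word is xyz; [phi i i] and [del i]
   are the maps phi_i and partial_i. *)
Record heckeData (kk : comPzRingType) := HeckeData {
  color : eqType;
  dotalg : color -> comAlg kk;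
  permitted : rel color;
  alpha : forall i, dots dotalg [:: i; i];
  beta : forall i, dots dotalg [:: i; i];
  quad : forall j i, dots dotalg [:: j; i];
  lam : color -> color -> color -> kk;
  lam_inv : forall x y z, exists m, m * lam x y z = 1;
  braid_a : forall i, dots dotalg [:: i; i; i];
  braid_b : forall i, dots dotalg [:: i; i; i];
  braid_c : forall i, dots dotalg [:: i; i; i];
  braid_d : forall i, dots dotalg [:: i; i; i];
  braid_e : forall i, dots dotalg [:: i; i; i];
  braid_pjii : forall j i, dots dotalg [:: j; i; i];
  braid_piij : forall i j, dots dotalg [:: i; i; j];
  braid_q : forall i j, dots dotalg [:: i; j; i];
  phi : forall i j, dots dotalg [:: i; j] -> dots dotalg [:: j; i];
  phi_linear : forall i j, klinear (@phi i j);
  del : forall i, dots dotalg [:: i; i] -> dots dotalg [:: i; i];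
  del_linear : forall i, klinear (@del i) }.
Arguments phi {kk} h i j f.
Arguments del {kk} h i f.

Section Diagrams.
Variables (kk : comPzRingType) (H : heckeData kk).
Local Notation I := (color H).
Local Notation Rw := (dots (@dotalg kk H)).

(* A single crossing with identity strands on both sides; the first word is the
   bottom. *)
Inductive crossing : seq I -> seq I -> Type :=
| crossing0 i j b : permitted i j -> crossing (i :: j :: b) (j :: i :: b)
| crossingS k v w : crossing v w -> crossing (k :: v) (k :: w).

(* Decorated diagrams from the bottom word v to a top word: vertical stacks of
   crossings and of elements of R_w placed at a given height.  The outermost
   constructor is the top of the diagram. *)
Inductive diag (v : seq I) : seq I -> Type :=
| dnil : diag v v
| ddot w : Rw w -> diag v w -> diag v w
| dcross w w' : crossing w w' -> diag v w -> diag v w'.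

(* x ** y is x on top of y *)
Fixpoint dcomp v w u (x : diag w u) : diag v w -> diag v u :=
  match x with
  | dnil => id
  | ddot _ f x' => fun y => ddot f (dcomp x' y)
  | dcross _ _ s x' => fun y => dcross s (dcomp x' y)
  end.
Local Notation "x ** y" := (dcomp x y)
  (at level 40, y at level 40, right associativity).

Definition dot v (f : Rw v) : diag v v := ddot f (dnil v).
Definition cross i j b (p : permitted i j) : diag (i :: j :: b) (j :: i :: b) :=
  dcross (crossing0 b p) (dnil _).

(* Horizontal composition with the identity of a on the left. *)
Fixpoint dshift1 k v w (x : diag v w) : diag (k :: v) (k :: w) :=
  match x with
  | dnil => dnil _
  | ddot w f x' => ddot (tpure 1 f : Rw (k :: w)) (dshift1 k x')
  | dcross _ _ s x' => dcross (crossingS k s) (dshift1 k x')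
  end.
Fixpoint dshift a v w (x : diag v w) : diag (a ++ v) (a ++ w) :=
  if a is k :: a' then dshift1 k (dshift a' x) else x.

Definition lincomb v w := seq (kk * diag v w).
Definition lscale c v w (Z : lincomb v w) : lincomb v w :=
  [seq (c * p.1, p.2) | p <- Z].
Definition lshift a v w (Z : lincomb v w) : lincomb (a ++ v) (a ++ w) :=
  [seq (p.1, dshift a p.2) | p <- Z].
Definition lcomp v v' w' w (T : diag w' w) (Z : lincomb v' w') (B : diag v v') :
  lincomb v w := [seq (p.1, T ** p.2 ** B) | p <- Z].

(* The bottom words of these diagrams are xy ++ b for ss, xyz ++ b for the
   others; pxy is the permission for x on the left crossing y on the right. *)
Section Words.
Variables (x y z : I) (b : seq I).
Variables (pxy : permitted x y) (pxz : permitted x z) (pyz : permitted y z).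
Definition ss (pyx : permitted y x) := cross b pyx ** cross b pxy.
Definition st := cross (y :: b) pxz ** dshift [:: x] (cross b pyz).
Definition ts := dshift [:: y] (cross b pxz) ** cross (z :: b) pxy.
Definition sts := cross (x :: b) pyz ** ts.
Definition tst := dshift [:: z] (cross b pxy) ** st.
End Words.

Definition padr v (b : seq I) (f : Rw v) : Rw (v ++ b) := tcat f (1 : Rw b).

(* [crossrule L Z]: the relation L = Z, directed from L to Z, with identity
   strands b on the right. *)
Inductive crossrule : forall v w, diag v w -> lincomb v w -> Prop :=
| rule_ii i b (p : permitted i i) :
    crossrule (ss b p p)
      [:: (1, dot (padr b (alpha i) : Rw (i :: i :: b)) ** cross b p);
          (1, dot (padr b (beta i) : Rw (i :: i :: b)))]
| rule_ji i j b (pij : permitted i j) (pji : permitted j i) : i != j ->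
    crossrule (ss b pji pij)
      [:: (1, dot (padr b (quad j i) : Rw (j :: i :: b)))]
| rule_iii i b (p : permitted i i) :
    crossrule (sts b p p p)
      [:: (lam i i i, tst b p p p);
          (1, dot (padr b (braid_a i) : Rw (i :: i :: i :: b)) ** st b p p);
          (1, dot (padr b (braid_b i) : Rw (i :: i :: i :: b)) ** ts b p p);
          (1, dot (padr b (braid_c i) : Rw (i :: i :: i :: b))
                ** cross (i :: b) p);
          (1, dot (padr b (braid_d i) : Rw (i :: i :: i :: b))
                ** dshift [:: i] (cross b p));
          (1, dot (padr b (braid_e i) : Rw (i :: i :: i :: b)))]
| rule_iij i j b (pii : permitted i i) (pij : permitted i j) : i != j ->
    crossrule (sts b pii pij pij)
      [:: (lam j i i, tst b pii pij pij);
          (1, dot (padr b (braid_pjii j i) : Rw (j :: i :: i :: b))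
                ** st b pij pij)]
| rule_jii i j b (pii : permitted i i) (pji : permitted j i) : i != j ->
    crossrule (sts b pji pji pii)
      [:: (lam i i j, tst b pji pji pii);
          (1, dot (padr b (braid_piij i j) : Rw (i :: i :: j :: b))
                ** ts b pji pji)]
| rule_iji i j b (pii : permitted i i) (pij : permitted i j)
    (pji : permitted j i) : i != j ->
    crossrule (sts b pij pii pji)
      [:: (lam i j i, tst b pij pii pji);
          (1, dot (padr b (braid_q i j) : Rw (i :: j :: i :: b)))]
| rule_ijk i j k b (pij : permitted i j) (pik : permitted i k)
    (pjk : permitted j k) : i != j -> i != k -> j != k ->
    crossrule (sts b pij pik pjk) [:: (lam k j i, tst b pij pik pjk)].

(* [dotrule s f Z]: moving f left past the crossing s; all strands of the
   diagram are taken into account, and phi, del are extended by the identity on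
   the tensor factors of the strands a, b not involved in the crossing. *)
Inductive dotrule : forall v w, diag v w -> Rw v -> lincomb v w -> Prop :=
| dot_ii a i b (p : permitted i i) (f : Rw (a ++ [:: i; i] ++ b)) :
    dotrule (dshift a (cross b p)) f
      [:: (1, dot (text (phi H i i) f : Rw (a ++ i :: i :: b))
                ** dshift a (cross b p));
          (1, dot (text (del H i) f : Rw (a ++ i :: i :: b)))]
| dot_ij a i j b (p : permitted i j) (f : Rw (a ++ [:: i; j] ++ b)) : i != j ->
    dotrule (dshift a (cross b p)) f
      [:: (1, dot (text (phi H i j) f : Rw (a ++ j :: i :: b))
                ** dshift a (cross b p))].

(* The interchange law for a crossing of colors xy and a crossing of colors zu
   to the right of it. *)
Inductive far v w : diag v w -> diag v w -> Prop :=
| Far a x y c z u e (pxy : permitted x y) (pzu : permitted z u)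
    (T : diag (a ++ y :: x :: c ++ u :: z :: e) w)
    (B : diag v (a ++ x :: y :: c ++ z :: u :: e)) :
    let s := dshift c (cross e pzu) in
    far (T ** dshift a (cross (c ++ u :: z :: e) pxy
                          ** dshift [:: x; y] s) ** B)
        (T ** dshift a (dshift [:: y; x] s
                          ** cross (c ++ z :: u :: e) pxy) ** B).

Definition isotopic v w : diag v w -> diag v w -> Prop :=
  clos_refl_sym_trans _ (@far v w).

Inductive crossstep v w : diag v w -> lincomb v w -> Prop :=
| CrossStep a u u' (T : diag (a ++ u') w) (L : diag u u') Z
    (B : diag v (a ++ u)) :
    crossrule L Z -> crossstep (T ** dshift a L ** B) (lcomp T (lshift a Z) B).

Inductive dotstep v w : diag v w -> lincomb v w -> Prop :=
| DotStep u u' (T : diag u' w) (s : diag u u') f Z (B : diag v u) :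
    dotrule s f Z -> dotstep (T ** s ** dot f ** B) (lcomp T Z B).

(* Hom(v, w) in the category is the quotient of linear combinations of diagrams
   by the congruence below: k-linearity, ring structure of the dots, interchange
   law (hom_far, hom_slide, and commutativity of R_u) and the given relations.
   Every generating equality is imposed inside arbitrary diagrams T, B above and
   below and with arbitrary identity strands left and right, so this congruence
   is the one generated by the relations under both compositions. *)
Inductive hom_eq v w : lincomb v w -> lincomb v w -> Prop :=
| hom_refl X : hom_eq X X
| hom_sym X Y : hom_eq X Y -> hom_eq Y X
| hom_trans X Y Z : hom_eq X Y -> hom_eq Y Z -> hom_eq X Z
| hom_cat X X' Y Y' : hom_eq X X' -> hom_eq Y Y' -> hom_eq (X ++ Y) (X' ++ Y')
| hom_swap X Y : hom_eq (X ++ Y) (Y ++ X)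
| hom_scale c X Y : hom_eq X Y -> hom_eq (lscale c X) (lscale c Y)
| hom_coef0 d : hom_eq [:: (0, d)] [::]
| hom_coefD c c' d : hom_eq [:: (c + c', d)] [:: (c, d); (c', d)]
| hom_dotD u (T : diag u w) (f g : Rw u) (B : diag v u) :
    hom_eq [:: (1, T ** dot (f + g) ** B)]
           [:: (1, T ** dot f ** B); (1, T ** dot g ** B)]
| hom_dotM u (T : diag u w) (f g : Rw u) (B : diag v u) :
    hom_eq [:: (1, T ** dot f ** dot g ** B)] [:: (1, T ** dot (f * g) ** B)]
| hom_dot_scal u (T : diag u w) c (B : diag v u) :
    hom_eq [:: (1, T ** dot (scal (Rw u) c) ** B)] [:: (c, T ** B)]
| hom_far d d' : far d d' -> hom_eq [:: (1, d)] [:: (1, d')]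
| hom_slide a x y b (pxy : permitted x y) (g : Rw a) (h : Rw b)
    (T : diag (a ++ y :: x :: b) w) (B : diag v (a ++ x :: y :: b)) :
    hom_eq
      [:: (1, T ** dshift a (cross b pxy)
                ** dot (tcat g (tcat (1 : Rw [:: x; y]) h)
                        : Rw (a ++ x :: y :: b)) ** B)]
      [:: (1, T ** dot (tcat g (tcat (1 : Rw [:: y; x]) h)
                        : Rw (a ++ y :: x :: b))
                ** dshift a (cross b pxy) ** B)]
| hom_cross d Z : crossstep d Z -> hom_eq [:: (1, d)] Z
| hom_dot d Z : dotstep d Z -> hom_eq [:: (1, d)] Z.

Definition hom_eqb v w (X Y : {classic lincomb v w}) : bool := `[< hom_eq X Y >].

Lemma hom_eqb_refl v w : reflexive (@hom_eqb v w).
Proof. by move=> X; apply/asboolP; constructor. Qed.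
Lemma hom_eqb_sym v w : symmetric (@hom_eqb v w).
Proof. by move=> X Y; apply/asboolP/asboolP => h; apply: hom_sym. Qed.
Lemma hom_eqb_trans v w : transitive (@hom_eqb v w).
Proof.
by move=> Y X Z /asboolP h /asboolP h'; apply/asboolP; apply: hom_trans h'.
Qed.

Canonical hom_equiv v w := EquivRel (@hom_eqb v w)
  (@hom_eqb_refl v w) (@hom_eqb_sym v w) (@hom_eqb_trans v w).

Definition hom v w := {eq_quot (hom_equiv v w)}.
HB.instance Definition _ v w := Choice.on (hom v w).
HB.instance Definition _ v w := EqQuotient.on (hom v w).

Definition hclass v w (X : lincomb v w) : hom v w :=
  \pi_(hom v w) (X : {classic lincomb v w}).
Definition hrepr v w (x : hom v w) : lincomb v w := repr x.

Lemma hclassP v w (X Y : lincomb v w) : hclass X = hclass Y <-> hom_eq X Y.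
Proof.
split=> [/eqP|h]; first by rewrite piE => /asboolP.
by apply/eqP; rewrite piE; apply/asboolP.
Qed.

Lemma hreprK v w (x : hom v w) : hclass (hrepr x) = x.
Proof. exact: reprK. Qed.

Lemma hom_repr v w (X : lincomb v w) : hom_eq (hrepr (hclass X)) X.
Proof. by apply/hclassP; rewrite hreprK. Qed.

Definition hzero v w : hom v w := hclass [::].
Definition hadd v w (x y : hom v w) : hom v w := hclass (hrepr x ++ hrepr y).
Definition hopp v w (x : hom v w) : hom v w := hclass (lscale (-1) (hrepr x)).

Lemma haddE v w (X Y : lincomb v w) :
  hadd (hclass X) (hclass Y) = hclass (X ++ Y).
Proof. by apply/hclassP; apply: hom_cat; apply: hom_repr. Qed.

Lemma haddA v w : associative (@hadd v w).
Proof.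
move=> x y z; rewrite -[x]hreprK -[y]hreprK -[z]hreprK !haddE.
by rewrite catA.
Qed.
Lemma haddC v w : commutative (@hadd v w).
Proof.
move=> x y; rewrite -[x]hreprK -[y]hreprK !haddE.
by apply/hclassP; apply: hom_swap.
Qed.
Lemma hadd0 v w : left_id (hzero v w) (@hadd v w).
Proof. by move=> x; rewrite -[x]hreprK haddE. Qed.

Lemma hclass_cons v w c d (X : lincomb v w) :
  hclass ((c, d) :: X) = hadd (hclass [:: (c, d)]) (hclass X).
Proof. by rewrite haddE. Qed.

Lemma haddN v w : left_inverse (hzero v w) (@hopp v w) (@hadd v w).
Proof.
move=> x; rewrite -{2}[x]hreprK haddE; apply/hclassP.
elim: (hrepr x) => [|[c d] X ih] /=; first exact: hom_refl.
set m := lscale _ _ in ih *.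
apply: (@hom_trans _ _ _ ([:: (- 1 * c, d); (c, d)] ++ (m ++ X))).
  apply: (@hom_cat _ _ [:: _] [:: _] (m ++ [:: (c, d)] ++ X)
                       ([:: (c, d)] ++ m ++ X)); first exact: hom_refl.
  rewrite !catA; apply: hom_cat; last exact: hom_refl.
  exact: hom_swap.
rewrite -[X in hom_eq _ X]cat0s; apply: hom_cat => //.
apply: (@hom_trans _ _ _ [:: (- 1 * c + c, d)]).
  by apply: hom_sym; apply: hom_coefD.
by rewrite mulN1r addNr; apply: hom_coef0.
Qed.

HB.instance Definition _ v w := GRing.isZmodule.Build (hom v w)
  (@haddA v w) (@haddC v w) (@hadd0 v w) (@haddN v w).

Definition ldot v w (f : Rw w) (X : lincomb v w) : lincomb v w :=
  [seq (p.1, ddot f p.2) | p <- X].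

Lemma ldot_comp v v' w' w f (T : diag w' w) (Z : lincomb v' w') (B : diag v v') :
  ldot f (lcomp T Z B) = lcomp (ddot f T) Z B.
Proof. by rewrite /ldot /lcomp -map_comp. Qed.

Lemma hom_eq_ldot v w (f : Rw w) (X Y : lincomb v w) :
  hom_eq X Y -> hom_eq (ldot f X) (ldot f Y).
Proof.
elim=> {X Y} /=.
- by move=> X; apply: hom_refl.
- by move=> X Y _ h; apply: hom_sym.
- by move=> X Y Z _ h _ h'; apply: hom_trans h'.
- by move=> X X' Y Y' _ h _ h'; rewrite /ldot !map_cat; apply: hom_cat.
- by move=> X Y; rewrite /ldot !map_cat; apply: hom_swap.
- move=> c X Y _ h; have e Z : ldot f (lscale c Z) = lscale c (ldot f Z).
    by rewrite /ldot /lscale -!map_comp.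
  by rewrite !e; apply: hom_scale.
- by move=> d; apply: hom_coef0.
- by move=> c c' d; apply: hom_coefD.
- by move=> u T g h B; apply: (hom_dotD (ddot f T)).
- by move=> u T g h B; apply: (hom_dotM (ddot f T)).
- by move=> u T c B; apply: (hom_dot_scal (ddot f T)).
- by move=> d d' []*; apply: hom_far; apply: (Far _ _ (ddot f _)).
- by move=> a x y b p g h T B; apply: (hom_slide _ _ _ (ddot f T)).
- move=> d _ [a u u' T L Z B h]; rewrite ldot_comp.
  by apply: hom_cross; apply: (CrossStep (ddot f T)).
- move=> d _ [u u' T s g Z B h]; rewrite ldot_comp.
  by apply: hom_dot; apply: (DotStep (ddot f T)).
Qed.

(* R_w acts on Hom(v, w) by dots at the top. *)
Definition hdot v w (f : Rw w) (x : hom v w) : hom v w :=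
  hclass (ldot f (hrepr x)).

Lemma hdotE v w (f : Rw w) (X : lincomb v w) :
  hdot f (hclass X) = hclass (ldot f X).
Proof. by apply/hclassP; apply: hom_eq_ldot; apply: hom_repr. Qed.

Lemma hdotA v w (f g : Rw w) (x : hom v w) : hdot f (hdot g x) = hdot (f * g) x.
Proof.
rewrite -[x]hreprK !hdotE; apply/hclassP.
elim: (hrepr x) => [|[c d] X ih] /=; first exact: hom_refl.
apply: (@hom_cat _ _ [:: _] [:: _]) ih.
have := hom_scale c (hom_dotM (dnil w) f g d).
by rewrite /lscale /= mulr1.
Qed.
Lemma hdot1 v w : left_id (1 : Rw w) (@hdot v w).
Proof.
move=> x; rewrite -[x]hreprK hdotE; apply/hclassP.
elim: (hrepr x) => [|[c d] X ih] /=; first exact: hom_refl.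
apply: (@hom_cat _ _ [:: _] [:: _]) ih.
have := hom_scale c (hom_dot_scal (dnil w) 1 d).
by rewrite /lscale /= mulr1 rmorph1.
Qed.
Lemma hdotDr v w : right_distributive (@hdot v w) +%R.
Proof.
move=> f x y; rewrite -[x]hreprK -[y]hreprK [_ + _]haddE !hdotE.
by rewrite [RHS]haddE /ldot map_cat.
Qed.
Lemma hdotDl v w (x : hom v w) : {morph (@hdot v w)^~ x : f g / f + g}.
Proof.
move=> f g; rewrite -[x]hreprK !hdotE.
elim: (hrepr x) => [|[c d] X ih] /=; first by rewrite [RHS]haddE.
rewrite hclass_cons (hclass_cons _ _ (ldot f X)) (hclass_cons _ _ (ldot g X)).
rewrite [hclass (ldot _ X)]ih [RHS]addrACA; congr (hadd _ _).
rewrite [RHS]haddE; apply/hclassP.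
have := hom_scale c (hom_dotD (dnil w) f g d).
by rewrite /lscale /= mulr1.
Qed.

HB.instance Definition _ v w :=
  GRing.Zmodule_isLmodule.Build (Rw w) (hom v w)
    (@hdotA v w) (@hdot1 v w) (@hdotDr v w) (@hdotDl v w).

Fixpoint height v w (s : crossing v w) : nat :=
  match s with
  | crossing0 _ _ _ _ => 0
  | crossingS _ _ _ s' => (height s').+1
  end.

(* Letters k : nat stand for s_(k+1); the word is read from top to bottom. *)
Fixpoint expr v w (d : diag v w) : seq nat :=
  match d with
  | dnil => [::]
  | ddot _ _ d' => expr d'
  | dcross _ _ s d' => height s :: expr d'
  end.

Fixpoint undecorated v w (d : diag v w) : bool :=
  match d with
  | dnil => true
  | ddot _ _ _ => false
  | dcross _ _ _ d' => undecorated d'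
  end.

End Diagrams.

Definition simple_tr n (k : nat) : 'S_n :=
  match insub k, insub k.+1 with
  | Some i, Some j => tperm i j
  | _, _ => 1%g
  end.

(* The rightmost letter acts first; (s * t) x = t (s x) in MathComp. *)
Definition perm_of_expr n (e : seq nat) : 'S_n :=
  foldr (fun k g => (g * simple_tr n k)%g) 1%g e.

Definition reduced_expr n (g : 'S_n) (e : seq nat) : Prop :=
  [/\ all (fun k => k.+1 < n)%N e, perm_of_expr n e = g &
      forall e', all (fun k => k.+1 < n)%N e' -> perm_of_expr n e' = g ->
        (size e <= size e')%N].

Definition is_basis (R : pzRingType) (M : lmodType R) (T : finType)
    (b : T -> M) : Prop :=
  forall x, exists! c : {ffun T -> R}, x = \sum_t c t *: b t.

Section Conditions.
Variables (kk : comPzRingType) (H : heckeData kk).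
Local Notation I := (color H).
Local Notation Rw := (dots (@dotalg kk H)).
Local Notation "x ** y" := (dcomp x y)
  (at level 40, y at level 40, right associativity).

Definition reduced_diagram n (v w : n.-tuple I) (g : 'S_n) (d : diag v w) :=
  undecorated d /\ reduced_expr g (expr d).

(* g carries the strand at position p at the bottom to position g p at the
   top. *)
Definition permissible n (v w : n.-tuple I) (g : 'S_n) : Prop :=
  (forall p, tnth w (g p) = tnth v p) /\
  exists d : diag v w, reduced_diagram g d.

Definition permissible_perm n (v w : n.-tuple I) :=
  {g : 'S_n | `[< permissible v w g >]}.

Definition has_reduced_bases : Prop :=
  forall n (v w : n.-tuple I) (D : permissible_perm v w -> diag v w),
    (forall g, reduced_diagram (val g) (D g)) ->
    is_basis (fun g => hclass [:: (1, D g)] : hom v w).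

(* One reduction of a diagram.  The dot 1 is no decoration: it is erased and
   never moved.  Otherwise an undecorated crossing s = s1 would itself be
   reducible to phi(1) s + del(1), and the ambiguity s f g at f = g = 1 would
   say nothing. *)
Inductive step (v w : seq I) : diag v w -> lincomb v w -> Prop :=
| step_cross d Z : crossstep d Z -> step d Z
| step_dot u u' (T : diag u' w) (s : diag u u') f Z (B : diag v u) :
    f <> 1 -> dotrule s f Z -> step (T ** s ** dot f ** B) (lcomp T Z B)
| step_mul u (T : diag u w) (f g : Rw u) (B : diag v u) :
    step (T ** dot f ** dot g ** B) [:: (1, T ** dot (f * g) ** B)]
| step_unit u (T : diag u w) (B : diag v u) :
    step (T ** dot (1 : Rw u) ** B) [:: (1, T ** B)]
| step_far d d' : far d d' -> step d [:: (1, d')]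
| step_far_sym d d' : far d d' -> step d' [:: (1, d)].

Inductive reduce1 (v w : seq I) (S : diag v w -> lincomb v w -> Prop) :
  lincomb v w -> lincomb v w -> Prop :=
| Reduce1 X c d Y Z : S d Z ->
    reduce1 S (X ++ (c, d) :: Y) (X ++ lscale c Z ++ Y).

Definition reduces (v w : seq I) (S : diag v w -> lincomb v w -> Prop) :=
  clos_refl_trans _ (reduce1 S).

Fixpoint topdots (v w : seq I) (d : diag v w) : Rw w :=
  match d in diag _ w return Rw w with
  | ddot _ f d' => f * topdots d'
  | _ => 1
  end.
Fixpoint undot (v w : seq I) (d : diag v w) : diag v w :=
  match d in diag _ w return diag v w with
  | dnil => dnil v
  | ddot _ _ d' => undot d'
  | dcross _ _ s d' => dcross s d'
  end.

(* All dots are at the top. *)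
Definition left_form (v w : seq I) (X : lincomb v w) : bool :=
  all (fun p => undecorated (undot p.2)) X.

Definition left_coef (v w : seq I) (X : lincomb v w) (d : diag v w) : Rw w :=
  \sum_(p <- X | `[< isotopic (undot p.2) d >])
    scal (Rw w) p.1 * topdots p.2.

Definition joinable (v w : seq I) (X Y : lincomb v w) : Prop :=
  exists X' Y', [/\ reduces (@step v w) X X', reduces (@step v w) Y Y',
    left_form X', left_form Y' & left_coef X' =1 left_coef Y'].

(* L1 and L2 are left-hand sides with T1 L1 B1 = T2 L2 B2 up to isotopy. *)
Definition resolvable (v w u1 u1' u2 u2' : seq I)
    (T1 : diag u1' w) (L1 : diag u1 u1') (B1 : diag v u1)
    (T2 : diag u2' w) (L2 : diag u2 u2') (B2 : diag v u2) : Prop :=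
  exists Z1 Z2, [/\ crossrule L1 Z1, crossrule L2 Z2 &
    joinable (lcomp T1 Z1 B1) (lcomp T2 Z2 B2)].

(* Z' is obtained by moving f past all crossings of L. *)
Definition dot_resolvable (v w : seq I) (L : diag v w) (f : Rw v) : Prop :=
  exists Z Z', [/\ crossrule L Z,
    reduces (@dotstep _ _ v w) [:: (1, L ** dot f)] Z', left_form Z' &
    joinable (lcomp (dnil w) Z (dot f)) Z'].

Definition overlap_sss : Prop :=
  forall (x y : I) (pxy : permitted x y) (pyx : permitted y x),
    resolvable (dnil _) (ss [::] pyx pxy) (cross [::] pxy)
               (cross [::] pxy) (ss [::] pxy pyx) (dnil _).

Definition overlap_ssts : Prop :=
  forall (x y z : I) (pxy : permitted x y) (pxz : permitted x z)
    (pyz : permitted y z) (pzy : permitted z y),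
    resolvable (dnil _) (ss [:: x] pyz pzy) (ts [::] pxy pxz)
               (cross [:: x] pzy) (sts [::] pxy pxz pyz) (dnil _).

Definition overlap_stss : Prop :=
  forall (x y z : I) (pxy : permitted x y) (pyx : permitted y x)
    (pxz : permitted x z) (pyz : permitted y z),
    resolvable (dnil _) (sts [::] pyx pyz pxz) (cross [:: z] pxy)
               (st [::] pxz pyz) (ss [:: z] pxy pyx) (dnil _).

Definition overlap_ststs : Prop :=
  forall (x y z : I) (pxy : permitted x y) (pxz : permitted x z)
    (pyz : permitted y z) (pyx : permitted y x) (pzx : permitted z x),
    resolvable (dnil _) (sts [::] pyz pyx pzx) (ts [::] pxy pxz)
               (st [::] pzx pyx) (sts [::] pxy pxz pyz) (dnil _).

(* On the left the word is read as s t s u t s, on the right as the isotopic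
   s t u s t s. *)
Definition overlap_stsuts : Prop :=
  forall (x y z k : I) (pxy : permitted x y) (pxz : permitted x z)
    (pxk : permitted x k) (pyz : permitted y z) (pyk : permitted y k)
    (pzk : permitted z k),
    resolvable
      (dnil _) (sts [:: x] pyz pyk pzk)
        (dshift [:: y; z] (cross [::] pxk) ** ts [:: k] pxy pxz)
      (cross [:: y; x] pzk ** dshift [:: z] (cross [:: x] pyk)
         ** dshift [:: z; y] (cross [::] pxk))
        (sts [:: k] pxy pxz pyz) (dnil _).

Definition ambiguity_ssf : Prop :=
  forall (x y : I) (pxy : permitted x y) (pyx : permitted y x) (f : Rw [:: x; y]),
    dot_resolvable (ss [::] pxy pyx) f.

Definition ambiguity_stsf : Prop :=
  forall (x y z : I) (pxy : permitted x y) (pxz : permitted x z)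
    (pyz : permitted y z) (f : Rw [:: x; y; z]),
    dot_resolvable (sts [::] pxy pxz pyz) f.

Definition ambiguity_sfg : Prop :=
  forall (x y : I) (pxy : permitted x y) (f g : Rw [:: x; y]),
    exists2 Z, dotrule (cross [::] pxy) f Z &
      joinable [:: (1, cross [::] pxy ** dot (f * g))]
               (lcomp (dnil _) Z (dot g)).

End Conditions.

(* Main.v *)
From HB Require Import structures.
Require Import Defs.
From mathcomp Require Import all_boot all_algebra all_fingroup boolp zify.
From Stdlib Require Import Relations.Relation_Operators.
Import GRing.Theory.

Set Implicit Arguments.
Unset Strict Implicit.
Unset Printing Implicit Defensive.
Local Open Scope ring_scope.

(** This is a diamond lemma whose coefficients are dots and whose monomials are
    the words of crossings.

    Modulo far commutations a word contains a repeated letter or a braid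
    j (j+1) j, unless it is a normal form ([word_shaped]).  Giving the letter j
    the weight n - j on n strands, every relation lowers the weight, also
    sts |-> tst.  Hence every diagram reduces to a combination of normal forms
    with all dots at the top ([reduce_normal]), and a diagram of a reduced word
    reduces to an invertible multiple of one normal form plus shorter diagrams
    ([reduce_lead]).

    If reduced diagrams form bases, then the coefficients of two reductions of
    equal morphisms to normal forms agree, so that equal morphisms are joinable
    ([bases_joinable]).  In particular all ambiguities are resolvable.

    Conversely, by reduction the normal forms span, and an arbitrary choice of
    reduced diagrams is related to the normal forms by a triangular matrix with
    invertible diagonal ([triangular_basis]); only the linear independence of
    the normal forms is at stake.  For this the category is made to act.
    Families of dots, one for each coloring of the strands, form a commutative
    ring D, on which a crossing at a given place induces an endomorphism mv
    (from the maps phi) and a twisted derivation dl (from the maps del).  Let F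
    be the free D-module on the normal forms on n strands.  Operators s_j on F
    with s_j (f x) = mv_j f s_j x + dl_j f x are defined by recursion on n and on
    the weight, in such a way that a normal form sends the first basis vector to
    the basis vector it indexes ([run_nf]); the independence follows once the
    s_j satisfy the relations ([hom_sound], [nf_independent]).

    The relations are proved by induction on the weight ([pact_act]).  When they
    hold below a certain weight, each reduction of diagrams of smaller weight is
    an identity between operators ([low_step]), so that a resolvable ambiguity
    becomes an identity between its two results.  Writing a basis vector as a
    crossing applied to one of smaller weight turns a relation at the next
    weight into such an identity, with ssts, sss, stss, ststs and stsuts
    according to the place of the leftmost strand ([rel_cancel], [rel_braid]);
    the ambiguities ssf and stsf pass from basis vectors to their multiples.
    The ambiguity sfg says that phi is multiplicative and del a twisted
    derivation ([sfg_axioms]). *)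

(** * Words and weights *)

Definition word := seq nat.
Definition shw (j : nat) (e : word) : word := map (addn j) e.
(** The weights decrease from left to right, so that replacing j (j+1) j by
    (j+1) j (j+1) lowers the weight. *)
Definition wt (n : nat) (e : word) : nat := sumn [seq (n - j)%N | j <- e].
Definition inword (n : nat) (e : word) : bool := all (fun j => j.+1 < n)%N e.
Definition dn (k l : nat) : word := rev (iota l (k - l)).
(** The left-hand sides of the quadratic relation and of the braid relation; the
    boolean selects the relation throughout. *)
Definition lhs (q : bool) : word := if q then [:: 0; 1; 0] else [:: 0; 0].

Lemma wt_cat n e1 e2 : wt n (e1 ++ e2) = (wt n e1 + wt n e2)%N.
Proof. by rewrite /wt map_cat sumn_cat. Qed.
Lemma wt_cons n j e : wt n (j :: e) = (n - j + wt n e)%N.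
Proof. by []. Qed.
Lemma wt_S n e : wt n.+1 (map S e) = wt n e.
Proof. by rewrite /wt -map_comp; congr sumn; apply: eq_map => j /=; rewrite subSS. Qed.

Lemma dnn k : dn k k = [::].
Proof. by rewrite /dn subnn. Qed.
Lemma dnS k l : (l <= k)%N -> dn k.+1 l = k :: dn k l.
Proof.
move=> h; rewrite /dn subSn // -addn1 iotaD rev_cat /=.
by rewrite (_ : (l + (k - l))%N = k) //; lia.
Qed.
Lemma dn_rcons k l : (l < k)%N -> dn k l = dn k l.+1 ++ [:: l].
Proof.
move=> h; rewrite /dn (_ : (k - l = (k - l.+1).+1)%N) /=; last by lia.
by rewrite rev_cons cats1.
Qed.
Lemma dn_cat k m l : (l <= m <= k)%N -> dn k l = dn k m ++ dn m l.
Proof.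
move=> h; rewrite /dn (_ : (k - l = (m - l) + (k - m))%N); last by lia.
by rewrite iotaD rev_cat (_ : (l + (m - l))%N = m) //; lia.
Qed.
Lemma mem_dn k l j : (j \in dn k l) = (l <= j < k)%N.
Proof. by rewrite /dn mem_rev mem_iota; apply/idP/idP; lia. Qed.
Lemma inword_dn n k l : (k < n)%N -> inword n (dn k l).
Proof. by move=> h; apply/allP => j; rewrite mem_dn; lia. Qed.
Lemma inword_cat n e1 e2 : inword n (e1 ++ e2) = inword n e1 && inword n e2.
Proof. exact: all_cat. Qed.

(** A permutation of n points is recorded by the position k of the strand
    starting at the left, and by the permutation of the other strands.  In its
    normal form the other strands are permuted first; then the leftmost strand
    crosses k of them. *)
Fixpoint code (n : nat) : finType :=
  if n is m.+1 then ('I_m.+1 * code m)%type : finType else unit.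

Fixpoint nf (n : nat) : code n -> word :=
  if n is m.+1 return code n -> word then
    fun c => dn c.1 0 ++ map S (nf c.2)
  else fun _ => [::].

Fixpoint code1 (n : nat) : code n :=
  if n is m.+1 return code n then (ord0, code1 m) else tt.

Lemma nf_inword n (c : code n) : inword n (nf c).
Proof.
elim: n c => [|n ih] //= [k c]; rewrite inword_cat inword_dn //=.
by rewrite /inword all_map; apply: sub_all (ih c) => j /=.
Qed.
Lemma nf1 n : nf (code1 n) = [::].
Proof. by elim: n => //= n ->. Qed.

(** * Abstract dots *)

(** What the construction of the module uses of the dots of all colorings.  In
    the application [mv j] and [dl j] are the twist and the twisted derivation of
    a crossing at place j, [sh] places dots one strand further to the right,
    [idem] singles out the indicator functions of sets of colorings, and [rhs q]
    lists the coefficients and words of the right-hand side of the relation q.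
    There mv j 1 is the indicator function of the colorings at the top for which
    the crossing j is permitted. *)
Record dotSystem := DotSystem {
  dring :> comPzRingType;
  mv : nat -> dring -> dring;
  dl : nat -> dring -> dring;
  sh : dring -> dring;
  idem : dring -> Prop;
  rhs : bool -> seq (dring * word);
  mvD : forall j f g, mv j (f + g) = mv j f + mv j g;
  dlD : forall j f g, dl j (f + g) = dl j f + dl j g;
  shD : forall f g, sh (f + g) = sh f + sh g;
  mvM : forall j f g, mv j (f * g) = mv j f * mv j g;
  dlM : forall j f g, dl j (f * g) = mv j f * dl j g + dl j f * g;
  shM : forall f g, sh (f * g) = sh f * sh g;
  sh1 : sh 1 = 1;
  mv_sh : forall j f, mv j.+1 (sh f) = sh (mv j f);
  dl_sh : forall j f, dl j.+1 (sh f) = sh (dl j f);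
  mvmv : forall i j f, (i.+1 < j)%N -> mv i (mv j f) = mv j (mv i f);
  mvdl : forall i j f, (i.+1 < j)%N -> mv i (dl j f) = dl j (mv i f);
  dlmv : forall i j f, (i.+1 < j)%N -> dl i (mv j f) = mv j (dl i f);
  dldl : forall i j f, (i.+1 < j)%N -> dl i (dl j f) = dl j (dl i f);
  mv_sh2 : forall f, mv 0 (sh (sh f)) = sh (sh f) * mv 0 1;
  dl_sh2 : forall f, dl 0 (sh (sh f)) = 0;
  idem1 : idem 1;
  idem_mv : forall j u, idem u -> idem (mv j u);
  idemM : forall u, idem u -> u * u = u;
  dl_idem : forall j u, idem u -> dl j u = 0;
  rhs_words : forall q, [seq p.2 | p <- rhs q] =
    if q then [:: [:: 1; 0; 1]; [:: 0; 1]; [:: 1; 0]; [:: 0]; [:: 1]; [::]]%N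
    else [:: [:: 0]; [::]]%N;
  rhs_far : forall (q : bool) p i, p \in rhs q -> (q.+1 < i)%N ->
    mv i p.1 = p.1 * mv i 1 /\ dl i p.1 = 0;
  rhs_idem : forall q p j u, p \in rhs q -> idem u ->
    iter j sh p.1 * foldr mv u (shw j (lhs q)) =
    iter j sh p.1 * foldr mv u (shw j p.2) }.

Section Dots.
Variable D : dotSystem.
Implicit Types (f g u : D).

Definition mvw (e : word) (f : D) : D := foldr (@mv D) f e.
Definition shn (j : nat) (f : D) : D := iter j (@sh D) f.

Lemma additive0 (V V' : zmodType) (h : V -> V') :
  (forall x y, h (x + y) = h x + h y) -> h 0 = 0.
Proof. by move=> hD; apply: (addrI (h 0)); rewrite -hD !addr0. Qed.

Lemma mv0 j : mv j (0 : D) = 0. Proof. exact: additive0 (mvD j). Qed.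
Lemma dl0 j : dl j (0 : D) = 0. Proof. exact: additive0 (dlD j). Qed.
Lemma sh0 : sh (0 : D) = 0. Proof. exact: additive0 (@shD D). Qed.
Lemma dl1 j : dl j (1 : D) = 0. Proof. exact/dl_idem/idem1. Qed.
Lemma mv1M j f : mv j 1 * mv j f = mv j f.
Proof. by rewrite -mvM mul1r. Qed.
Lemma mv1dl j f : mv j 1 * dl j f = dl j f.
Proof. by rewrite -{2}[f]mul1r dlM dl1 mul0r addr0. Qed.

Lemma mvw_cat e1 e2 f : mvw (e1 ++ e2) f = mvw e1 (mvw e2 f).
Proof. by rewrite /mvw foldr_cat. Qed.
Lemma idem_mvw e u : idem u -> idem (mvw e u).
Proof. by move=> hu; elim: e => //= j e ih; apply: idem_mv. Qed.
Lemma mvw_sh e f : mvw (map S e) (sh f) = sh (mvw e f).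
Proof. by elim: e => //= j e ->; rewrite mv_sh. Qed.
Lemma mv_mvw j e f : all (fun i => (i.+1 < j) || (j.+1 < i))%N e ->
  mv j (mvw e f) = mvw e (mv j f).
Proof.
elim: e => //= i e ih /andP[hij he]; rewrite -ih //.
by case/orP: hij => hij; [symmetry|]; apply: mvmv.
Qed.

Lemma shnS j f : shn j.+1 f = sh (shn j f). Proof. by []. Qed.
Lemma mv_shn i j f : mv (i + j) (shn j f) = shn j (mv i f).
Proof. by elim: j => [|j ih]; rewrite ?addn0 ?addnS //= mv_sh ih. Qed.
Lemma dl_shn i j f : dl (i + j) (shn j f) = shn j (dl i f).
Proof. by elim: j => [|j ih]; rewrite ?addn0 ?addnS //= dl_sh ih. Qed.
Lemma shnM j f g : shn j (f * g) = shn j f * shn j g.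
Proof. by elim: j => //= j ->; rewrite shM. Qed.
Lemma shn1 j : shn j 1 = 1.
Proof. by elim: j => //= j ->; rewrite sh1. Qed.
Lemma shn0 j : shn j 0 = 0.
Proof. by elim: j => //= j ->; rewrite sh0. Qed.

Definition inert i f := mv i f = f * mv i 1 /\ dl i f = 0.

Lemma inert_mvM i f g : inert i f -> mv i (f * g) = f * mv i g.
Proof. by case=> h _; rewrite mvM h -mulrA mv1M. Qed.
Lemma inert_dlM i f g : inert i f -> dl i (f * g) = f * dl i g.
Proof. by case=> h h'; rewrite dlM h h' mul0r addr0 -mulrA mv1dl. Qed.

Lemma inert_shn i j f : inert i f -> inert (i + j) (shn j f).
Proof.
case=> h h'; split; rewrite ?mv_shn ?dl_shn ?h ?h' ?shn0 //.
by rewrite shnM -[in RHS](shn1 j) mv_shn.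
Qed.
Lemma inert_sh2 i j f : (i.+1 < j)%N -> inert i (shn j f).
Proof.
move=> h; rewrite (_ : j = i + (j - i.+2).+2)%N; last by lia.
rewrite /shn iterD -[i]/(0 + i)%N; apply: inert_shn.
by split; [apply: mv_sh2|apply: dl_sh2].
Qed.
Lemma inert_rhs (q : bool) p i j : p \in rhs D q ->
  (i.+1 < j)%N || (j + q.+1 < i)%N -> inert i (shn j p.1).
Proof.
move=> hp /orP[h|h]; first exact: inert_sh2.
rewrite -(@subnK j i); last by lia.
by apply: inert_shn; apply: rhs_far hp _; lia.
Qed.

Lemma rhs_word (q : bool) p : p \in rhs D q -> all (fun i => i < q.+1)%N p.2 /\
  forall n j, (j + q.+1 < n)%N -> (wt n (shw j p.2) < wt n (shw j (lhs q)))%N.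
Proof.
move=> /(map_f (fun p => p.2)); rewrite rhs_words; case: q; rewrite !inE.
  case/or4P => [| | |/or3P[]] /eqP ->; split=> // n j; rewrite /wt /=; lia.
by case/orP => /eqP ->; split=> // n j; rewrite /wt /=; lia.
Qed.

(** * Partial actions *)

Section Actions.
Variable V : lmodType D.
Implicit Types (s : nat -> V -> V) (x y : V).

Definition twisted s := (forall j x y, s j (x + y) = s j x + s j y) /\
  (forall j f x, s j (f *: x) = mv j f *: s j x + dl j f *: x).

Definition run s (e : word) x : V := foldr s x e.

Definition rhs_op s (q : bool) (j : nat) x : V :=
  \sum_(p <- rhs D q) shn j p.1 *: run s (shw j p.2) x.

(** Operators satisfying the relations as long as the total weight of the vector
    and of the word is less than M.  The filtration [Fl] bounds the weight of
    vectors.  This is the form in which relations are available during the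
    induction on the weight. *)
Record pact (n : nat) s (Fl : nat -> V -> Prop) (M : nat) : Prop := Pact {
  pact_semi : twisted s;
  pact_mono : forall m m' x, (m <= m')%N -> Fl m x -> Fl m' x;
  pact_D : forall m x y, Fl m x -> Fl m y -> Fl m (x + y);
  pact_Z : forall m f x, Fl m x -> Fl m (f *: x);
  pact_s : forall j m x, (j.+1 < n)%N -> Fl m x -> Fl (m + (n - j))%N (s j x);
  pact_rel : forall (q : bool) j m x, (j + q.+1 < n)%N -> Fl m x ->
    (m + wt n (shw j (lhs q)) < M)%N ->
    run s (shw j (lhs q)) x = rhs_op s q j x;
  pact_far : forall i j m x, (i.+1 < j)%N -> (j.+1 < n)%N -> Fl m x ->
    (m + (n - i) + (n - j) < M)%N -> s i (s j x) = s j (s i x) }.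

Section Twisted.
Variable s : nat -> V -> V.
Hypothesis hs : twisted s.

Lemma run_cons j e x : run s (j :: e) x = s j (run s e x).
Proof. by []. Qed.
Lemma run_cat e1 e2 x : run s (e1 ++ e2) x = run s e1 (run s e2 x).
Proof. by rewrite /run foldr_cat. Qed.
Lemma s0 j : s j 0 = 0.
Proof. exact: additive0 (hs.1 j). Qed.
Lemma runD e x y : run s e (x + y) = run s e x + run s e y.
Proof. by elim: e => //= j e ->; rewrite hs.1. Qed.
Lemma run0 e : run s e 0 = 0.
Proof. exact: additive0 (runD e). Qed.
Lemma s_sum j (T : Type) (r : seq T) (P : pred T) (h : T -> V) :
  s j (\sum_(t <- r | P t) h t) = \sum_(t <- r | P t) s j (h t).
Proof. by apply: (big_morph (s j) (hs.1 j)); apply: s0. Qed.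
Lemma rhs_opD q j x y : rhs_op s q j (x + y) = rhs_op s q j x + rhs_op s q j y.
Proof.
by rewrite /rhs_op -big_split; apply: eq_bigr => p _; rewrite runD scalerDr.
Qed.
Lemma rhs_op0 q j : rhs_op s q j 0 = 0.
Proof. exact: additive0 (rhs_opD q j). Qed.

Lemma s_inert i f x : inert i f -> s i (f *: x) = f *: s i x.
Proof.
move=> [h h']; rewrite hs.2 h h' scale0r addr0 -scalerA; congr (_ *: _).
by rewrite -{2}[x]scale1r hs.2 dl1 scale0r addr0.
Qed.

Lemma s_rhs_op i (q : bool) j x : (i.+1 < j)%N || (j + q.+1 < i)%N ->
  (forall p, p \in rhs D q ->
     s i (run s (shw j p.2) x) = run s (shw j p.2) (s i x)) ->
  s i (rhs_op s q j x) = rhs_op s q j (s i x).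
Proof.
move=> hi hp; rewrite /rhs_op s_sum !big_seq; apply: eq_bigr => p pq.
by rewrite s_inert ?hp //; apply: inert_rhs pq hi.
Qed.

Lemma s_idem j u x : idem u -> s j (u *: x) = mv j u *: s j x.
Proof. by move=> hu; rewrite hs.2 dl_idem // scale0r addr0. Qed.
Lemma run_idem e u x : idem u -> run s e (u *: x) = mvw e u *: run s e x.
Proof.
by move=> hu; elim: e => //= j e ->; apply/s_idem/idem_mvw.
Qed.
Lemma rhs_op_idem q j u x : idem u ->
  rhs_op s q j (u *: x) = mvw (shw j (lhs q)) u *: rhs_op s q j x.
Proof.
move=> hu; rewrite /rhs_op scaler_sumr !big_seq; apply: eq_bigr => p pq.
by rewrite run_idem // !scalerA [in RHS]mulrC; congr (_ *: _); rewrite /mvw rhs_idem.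
Qed.

Lemma far_scale i j f x : (i.+1 < j)%N -> s i (s j x) = s j (s i x) ->
  s i (s j (f *: x)) = s j (s i (f *: x)).
Proof.
move=> hij e; rewrite !(hs.1, hs.2) e mvmv // mvdl // dlmv // dldl //.
by rewrite -!addrA; congr (_ + _); rewrite addrCA.
Qed.

End Twisted.

Section Pact.
Variables (n M : nat) (s : nat -> V -> V) (Fl : nat -> V -> Prop).
Hypothesis hP : pact n s Fl M.

Lemma pact_run e m x : inword n e -> Fl m x -> Fl (m + wt n e)%N (run s e x).
Proof.
elim: e => [|j e ih] //=; first by rewrite addn0.
move=> /andP[hj he] hx; rewrite wt_cons addnCA addnC.
by apply: (pact_s hP) => //; apply: ih.
Qed.

Lemma inword_lhs (q : bool) j : (j + q.+1 < n)%N -> inword n (shw j (lhs q)).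
Proof. by case: q => /= h; rewrite /inword /=; lia. Qed.
Lemma inword_rhs (q : bool) j p : p \in rhs D q -> (j + q.+1 < n)%N ->
  inword n (shw j p.2).
Proof.
move=> /rhs_word[h _] hj; rewrite /inword all_map; apply: sub_all h => i /=.
by lia.
Qed.

Lemma pact_rhs_op (q : bool) j m x : (j + q.+1 < n)%N -> Fl m x ->
  Fl (m + wt n (shw j (lhs q))).-1 (rhs_op s q j x).
Proof.
move=> hj hx; rewrite /rhs_op big_seq.
apply: (big_ind (Fl _)).
- rewrite -(scale0r x); apply: (pact_Z hP); apply: (pact_mono hP) hx.
  by case: (q) hj => hj; rewrite /wt /=; move: hj => /=; lia.
- by move=> y z; apply: (pact_D hP).
- move=> p pq; apply: (pact_Z hP).
  apply: (pact_mono hP) (pact_run (inword_rhs pq hj) hx).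
  by have := (rhs_word pq).2 _ _ hj; lia.
Qed.

Definition farl i j := ((i.+1 < j) || (j.+1 < i))%N.

Lemma pact_farl i j m x : farl i j -> (i.+1 < n)%N -> (j.+1 < n)%N -> Fl m x ->
  (m + (n - i) + (n - j) < M)%N -> s i (s j x) = s j (s i x).
Proof.
move=> /orP[] hij hi hj hx hM; first exact: (pact_far hP) hx hM.
by symmetry; apply: (pact_far hP) hx _ => //; lia.
Qed.

Lemma pact_far_run i e m x : all (farl i) e -> (i.+1 < n)%N -> inword n e ->
  Fl m x -> (m + (n - i) + wt n e < M)%N -> s i (run s e x) = run s e (s i x).
Proof.
move=> + hi + hx; elim: e => //= j e ih /andP[hij he] /andP[hj he'].
rewrite wt_cons => hM; rewrite -ih //; last by lia.
by apply: (pact_farl hij hi hj (pact_run he' hx)); lia.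
Qed.

Lemma pact_far_rhs i (q : bool) j m x : (i.+1 < j)%N || (j + q.+1 < i)%N ->
  (i.+1 < n)%N -> (j + q.+1 < n)%N -> Fl m x ->
  (m + (n - i) + wt n (shw j (lhs q)) <= M)%N ->
  s i (rhs_op s q j x) = rhs_op s q j (s i x).
Proof.
move=> hij hi hj hx hM; apply: (s_rhs_op (pact_semi hP) hij) => p pq.
have [h /(_ n j hj) h'] := rhs_word pq.
apply: (pact_far_run _ hi (inword_rhs pq hj) hx); last by lia.
by rewrite all_map; apply: sub_all h => l /=; rewrite /farl; lia.
Qed.

Lemma pact_run_rhs e (q : bool) j m x :
  all (fun i => (i.+1 < j) || (j + q.+1 < i))%N e -> inword n e ->
  (j + q.+1 < n)%N -> Fl m x ->
  (m + wt n e + wt n (shw j (lhs q)) <= M)%N ->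
  run s e (rhs_op s q j x) = rhs_op s q j (run s e x).
Proof.
move=> + + hj hx; elim: e => //= i e ih /andP[hij he] /andP[hi he'].
rewrite wt_cons => hM; rewrite ih //; last by lia.
by apply: (pact_far_rhs hij hi hj (pact_run he' hx)); lia.
Qed.

End Pact.
End Actions.
End Dots.

(** * Resolved ambiguities and free modules *)

Section Resolves.
Variable D : dotSystem.

(** The consequences of resolvability that the construction needs: below the
    weight of the overlap, the two ways to apply the relations to it agree as
    operators, and a relation that holds at x also holds at f x. *)
Record resolves : Prop := Resolves {
  res_sss : forall (T : finType) n (s : nat -> {ffun T -> D^o} -> {ffun T -> D^o})
      Fl M j m x, pact n s Fl M -> Fl m x -> (j + 1 < n)%N ->
    (m + wt n (shw j [:: 0; 0; 0]%N) <= M)%N ->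
    rhs_op s false j (s j x) = s j (rhs_op s false j x);
  res_ssts : forall (T : finType) n (s : nat -> {ffun T -> D^o} -> {ffun T -> D^o})
      Fl M j m x, pact n s Fl M -> Fl m x -> (j + 2 < n)%N ->
    (m + wt n (shw j [:: 0; 0; 1; 0]%N) <= M)%N ->
    rhs_op s false j (s j.+1 (s j x)) = s j (rhs_op s true j x);
  res_stss : forall (T : finType) n (s : nat -> {ffun T -> D^o} -> {ffun T -> D^o})
      Fl M j m x, pact n s Fl M -> Fl m x -> (j + 2 < n)%N ->
    (m + wt n (shw j [:: 0; 1; 0; 0]%N) <= M)%N ->
    rhs_op s true j (s j x) = s j (s j.+1 (rhs_op s false j x));
  res_ststs : forall (T : finType) n (s : nat -> {ffun T -> D^o} -> {ffun T -> D^o})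
      Fl M j m x, pact n s Fl M -> Fl m x -> (j + 2 < n)%N ->
    (m + wt n (shw j [:: 0; 1; 0; 1; 0]%N) <= M)%N ->
    rhs_op s true j (s j.+1 (s j x)) = s j (s j.+1 (rhs_op s true j x));
  res_stsuts : forall (T : finType) n (s : nat -> {ffun T -> D^o} -> {ffun T -> D^o})
      Fl M j m x, pact n s Fl M -> Fl m x -> (j + 3 < n)%N ->
    (m + wt n (shw j [:: 0; 1; 0; 2; 1; 0]%N) <= M)%N ->
    rhs_op s true j (s j.+2 (s j.+1 (s j x))) =
    s j (s j.+1 (s j.+2 (rhs_op s true j x)));
  res_dots : forall (T : finType) n (s : nat -> {ffun T -> D^o} -> {ffun T -> D^o})
      Fl M (q : bool) j m x f, pact n s Fl M -> Fl m x -> (j + q.+1 < n)%N ->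
    (m + wt n (shw j (lhs q)) <= M)%N ->
    run s (shw j (lhs q)) x = rhs_op s q j x ->
    run s (shw j (lhs q)) (f *: x) = rhs_op s q j (f *: x) }.

End Resolves.

Section Free.
Variable D : dotSystem.
Implicit Types (f g u : D).

Definition freem n : lmodType D := {ffun code n -> D^o}.
Definition ev n (c : code n) : freem n := [ffun c' => (c' == c)%:R].
(** The colorings at the top for which a normal form is permissible.  The basis
    vector of a code is cut down to these colorings. *)
Definition pidem n (c : code n) : D := mvw (nf c) 1.
Definition bas n (c : code n) : freem n := pidem c *: ev c.

Lemma freemZ n f (x : freem n) c : (f *: x) c = f * x c :> D.
Proof. by rewrite ffunE. Qed.
Lemma basE n (c c' : code n) : bas c c' = (if c' == c then pidem c else 0) :> D.
Proof. by rewrite freemZ ffunE; case: eqP => _; rewrite ?mulr1 ?mulr0. Qed.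

Lemma idem_pidem n (c : code n) : idem (pidem c).
Proof. exact/idem_mvw/idem1. Qed.
Lemma pidemM n (c : code n) : pidem c * pidem c = pidem c.
Proof. exact/idemM/idem_pidem. Qed.

(** The extension of values on basis vectors to a map that moves dots past the
    crossing j. *)
Definition lin n (a : nat -> code n -> freem n) (j : nat) (x : freem n) : freem n :=
  \sum_c ((mv j (x c : D) : D) *: a j c + (dl j (x c : D) : D) *: ev c).

Lemma linD n (a : nat -> code n -> freem n) j x y :
  lin a j (x + y) = lin a j x + lin a j y.
Proof.
rewrite /lin -big_split; apply: eq_bigr => c _ /=.
by rewrite ffunE mvD dlD !scalerDl addrACA.
Qed.

Lemma free_sum n (x : freem n) : x = \sum_c (x c : D) *: ev c.
Proof.
apply/ffunP => c; rewrite sum_ffunE (bigD1 c) //= big1 ?addr0 => [|c' ne].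
  by rewrite !ffunE eqxx; apply/esym/mulr1.
by rewrite !ffunE eq_sym (negbTE ne); apply: mulr0.
Qed.

Lemma lin_semi n (a : nat -> code n -> freem n) : twisted (lin a).
Proof.
split=> [j x y|j f x]; first exact: linD.
rewrite [X in dl j f *: X]free_sum /lin !scaler_sumr -big_split.
apply: eq_bigr => c _ /=.
by rewrite freemZ mvM dlM scalerDr !scalerA scalerDl addrA.
Qed.

Lemma lin_ev n (a : nat -> code n -> freem n) j c :
  lin a j (ev c) = mv j 1 *: a j c.
Proof.
rewrite /lin (bigD1 c) //= big1 ?addr0 => [|c' ne].
  by rewrite ffunE eqxx dl1 scale0r addr0.
by rewrite ffunE (negbTE ne) mv0 dl0 !scale0r addr0.
Qed.

Lemma lin_bas n (a : nat -> code n -> freem n) j c :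
  lin a j (bas c) = mv j (pidem c) *: a j c.
Proof.
rewrite (s_idem (lin_semi a)) ?lin_ev ?scalerA; last exact: idem_pidem.
by rewrite -mvM mulr1.
Qed.

Lemma lin_scale_bas n (a : nat -> code n -> freem n) j f c :
  lin a j (f *: bas c) = (mv j f * mv j (pidem c)) *: a j c + dl j f *: bas c.
Proof. by rewrite (lin_semi a).2 lin_bas scalerA. Qed.

(** The span of the basis vectors of weight at most m, as an inductive predicate:
    an identity between additive maps on it is checked on multiples of basis
    vectors. *)
Inductive Fil n (m : nat) : freem n -> Prop :=
| Fil0 : Fil m 0
| FilD x y : Fil m x -> Fil m y -> Fil m (x + y)
| Filb f c : (wt n (nf c) <= m)%N -> Fil m (f *: bas c).

Lemma Fil_mono n m m' (x : freem n) : (m <= m')%N -> Fil m x -> Fil m' x.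
Proof.
move=> hm; elim=> {x} [|x y _ hx _ hy|f c hc]; first exact: Fil0.
  exact: FilD.
by apply: Filb; lia.
Qed.
Lemma FilZ n m f (x : freem n) : Fil m x -> Fil m (f *: x).
Proof.
elim=> {x} [|x y _ hx _ hy|g c hc]; first by rewrite scaler0; apply: Fil0.
  by rewrite scalerDr; apply: FilD.
by rewrite scalerA; apply: Filb.
Qed.
Lemma Fil_sum n m (T : Type) (r : seq T) (P : pred T) (h : T -> freem n) :
  (forall t, P t -> Fil m (h t)) -> Fil m (\sum_(t <- r | P t) h t).
Proof.
move=> hh; apply: (big_ind (Fil m)) => //; first exact: Fil0.
by move=> x y; apply: FilD.
Qed.
Lemma Fil_bas n (c : code n) : Fil (wt n (nf c)) (bas c).
Proof. by rewrite -[bas c]scale1r; apply: Filb. Qed.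

(** The operators are defined by recursion on the weight; the following says that
    a computation of weight less than w only depends on their values there. *)
Section Local.
Variables (n w : nat) (a a' : nat -> code n -> freem n).
Definition agree := forall j c, (j.+1 < n)%N -> (wt n (nf c) + (n - j) < w)%N ->
  a j c = a' j c /\ Fil (wt n (nf c) + (n - j)) (a' j c).
Hypothesis haa : agree.

Lemma lin_local j m x : (j.+1 < n)%N -> (m + (n - j) < w)%N -> Fil m x ->
  lin a j x = lin a' j x /\ Fil (m + (n - j)) (lin a' j x).
Proof.
move=> hj hm; elim=> {x} [|x y _ [e h] _ [e' h']|f c hc].
- by rewrite !(s0 (lin_semi _)); split=> //; apply: Fil0.
- by rewrite !linD e e'; split=> //; apply: FilD.
rewrite !lin_scale_bas; have [||-> h] := haa (j := j) (c := c) => //; first by lia.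
split=> //; apply: FilD; last by apply: Filb; lia.
by apply: FilZ; apply: Fil_mono h; lia.
Qed.

Lemma run_local e m x : inword n e -> (m + wt n e < w)%N -> Fil m x ->
  run (lin a) e x = run (lin a') e x /\ Fil (m + wt n e) (run (lin a') e x).
Proof.
elim: e => [|j e ih] /=; first by rewrite addn0.
rewrite wt_cons => /andP[hj he] hm hx.
have [|-> h] := ih he _ hx; first by lia.
have [|-> h'] := lin_local hj _ h; first by lia.
by split=> //; apply: Fil_mono h'; lia.
Qed.

Lemma rhs_op_local (q : bool) j m x : (j + q.+1 < n)%N ->
  (m + wt n (shw j (lhs q)) <= w)%N -> Fil m x ->
  rhs_op (lin a) q j x = rhs_op (lin a') q j x /\
  Fil (m + wt n (shw j (lhs q))).-1 (rhs_op (lin a') q j x).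
Proof.
move=> hj hm hx; rewrite /rhs_op !big_seq; split.
  apply: eq_bigr => p pq; congr (_ *: _).
  have h := (rhs_word pq).2 _ _ hj.
  by have [|//] := run_local (inword_rhs pq hj) _ hx; lia.
apply: Fil_sum => p pq; apply: FilZ.
have h := (rhs_word pq).2 _ _ hj.
have [|_] := run_local (inword_rhs pq hj) _ hx; first by lia.
by apply: Fil_mono; lia.
Qed.
End Local.

End Free.

(** * Construction of the operators *)

Section Level.
Variables (D : dotSystem) (m : nat).
Local Notation n := m.+1.
Implicit Types (f g u : D) (c : code m).

(** The coordinates of a code on n strands: [bl l c] is the vector of the normal
    form in which the leftmost strand ends at place l. *)
Definition mk (l : nat) (c : code m) : code n := (inord l, c).
Definition bl (l : nat) (c : code m) : freem D n := bas D (mk l c).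
Definition wl (l : nat) (c : code m) : nat := (wt n (dn l 0) + wt m (nf c))%N.

Lemma nf_mk l c : (l <= m)%N -> nf (mk l c) = dn l 0 ++ map S (nf c).
Proof. by move=> h /=; rewrite inordK. Qed.
Lemma wt_mk l c : (l <= m)%N -> wt n (nf (mk l c)) = wl l c.
Proof. by move=> h; rewrite nf_mk // wt_cat wt_S. Qed.
Lemma mkE (c : code n) : exists2 l, (l <= m)%N & exists c', c = mk l c'.
Proof.
case: c => k c; exists k; first by rewrite -ltnS.
by exists c; rewrite /mk inord_val.
Qed.
Lemma wlS l c : (l < n)%N -> wl l.+1 c = (n - l + wl l c)%N.
Proof. by move=> h; rewrite /wl dnS // wt_cons addnA. Qed.
Lemma wl_dn l k c : (l <= k)%N -> wl k c = (wt n (dn k l) + wl l c)%N.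
Proof. by move=> h; rewrite /wl (@dn_cat k l 0) // wt_cat addnA. Qed.

Lemma wt_dn k l : (l < k)%N -> wt n (dn k l) = (wt n (dn k l.+1) + (n - l))%N.
Proof. by move=> h; rewrite dn_rcons // wt_cat [wt n [:: l]]/wt /= addn0. Qed.

Lemma Fil_bl l c f w : (l <= m)%N -> (wl l c <= w)%N -> Fil w (f *: bl l c).
Proof. by move=> h h'; apply: Filb; rewrite wt_mk. Qed.

Variable a' : nat -> code m -> freem D m.
Local Notation s' := (lin a').
Hypothesis hP' : forall M, pact m s' (@Fil D m) M.

(** The result of moving a dot f from below the crossings l, ..., l + r - 1
    to the top, every crossing being evaluated by the map a. *)
Fixpoint push (a : nat -> code n -> freem D n) (r l : nat) (f : D) (c : code m) :
    freem D n :=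
  if r is r'.+1 then
    run (lin a) (dn (l + r) l.+1) (dl l f *: bl l c) + push a r' l.+1 (mv l f) c
  else f *: bl l c.

Definition push_all a (k : nat) (y : freem D m) : freem D n :=
  \sum_c push a k 0 (sh (y c : D)) c.

(** The forced value of s_j on the basis vector with leftmost strand ending at k:
    for j = k it is the next basis vector; for j = k - 1 the relation ss applies
    at the top; for j > k the crossing commutes with the leftmost strand and acts
    on the others; for j < k - 1 it commutes with the crossings above place j + 1
    and creates a braid.  Its right-hand side involves only vectors of smaller
    weight, on which s is evaluated by the map a. *)
Definition body (a : nat -> code n -> freem D n) (j : nat) (x : code n) :
    freem D n :=
  let: (k, c) := (x : 'I_n * code m) in
  if j == k then bl k.+1 c
  else if j.+1 == k then rhs_op (lin a) false j (bl j c)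
  else if (k < j)%N then push_all a k (s' j.-1 (bas D c))
  else run (lin a) (dn k j.+2) (rhs_op (lin a) true j (bl j c)).

Lemma bodyE a j k c : (k <= m)%N -> body a j (mk k c) =
  if j == k then bl k.+1 c
  else if j.+1 == k then rhs_op (lin a) false j (bl j c)
  else if (k < j)%N then push_all a k (s' j.-1 (bas D c))
  else run (lin a) (dn k j.+2) (rhs_op (lin a) true j (bl j c)).
Proof. by move=> h; rewrite /body /mk inordK. Qed.

(** The recursion on the weight, made structural; by [upE] the amount of fuel
    does not matter once it exceeds the weight. *)
Fixpoint fuel (w : nat) (j : nat) (x : code n) : freem D n :=
  if w is w'.+1 then body (fuel w') j x else 0.

Definition up (j : nat) (x : code n) : freem D n :=
  fuel (wt n (nf x) + (n - j)).+1 j x.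

Lemma pushD a r l f g c : push a r l (f + g) c = push a r l f c + push a r l g c.
Proof.
elim: r l f g => [|r ih] l f g /=; first by rewrite scalerDl.
by rewrite dlD scalerDl (runD (lin_semi a)) mvD ih addrACA.
Qed.
Lemma push0 a r l c : push a r l 0 c = 0.
Proof. exact: (additive0 (fun f g => pushD a r l f g c)). Qed.
Lemma push_allD a k x y : push_all a k (x + y) = push_all a k x + push_all a k y.
Proof.
rewrite /push_all -big_split; apply: eq_bigr => c _ /=.
by rewrite ffunE shD pushD.
Qed.
Lemma push_all0 a k : push_all a k 0 = 0.
Proof. exact: additive0 (push_allD a k). Qed.
Lemma push_all_bas a k f c :
  push_all a k (f *: bas D c) = push a k 0 (sh (f * pidem D c)) c.
Proof.
rewrite /push_all (bigD1 c) //= big1 ?addr0 => [|c' ne].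
  by rewrite freemZ basE eqxx.
by rewrite freemZ basE (negbTE ne) mulr0 sh0 push0.
Qed.

Section BodyLocal.
Variables (w : nat) (a1 a2 : nat -> code n -> freem D n).
Hypothesis h12 : agree w a1 a2.

Lemma push_local r l f c : (l + r <= m)%N -> (wl (l + r) c <= w)%N ->
  push a1 r l f c = push a2 r l f c /\ Fil (wl (l + r) c) (push a2 r l f c).
Proof.
elim: r l f => [|r ih] l f /=.
  by rewrite addn0 => h h'; split=> //; apply: Fil_bl.
rewrite addnS -addSn => h h'.
have [//|//|-> hF] := ih l.+1 (mv l f).
have [||//|-> hF'] := run_local h12 (e := dn (l.+1 + r) l.+1) (m := wl l c)
  (x := dl l f *: bl l c).
- by apply: inword_dn.
- by move: h'; rewrite (@wl_dn l) 1?(@wt_dn _ l) ?addSn; lia.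
- by apply: Fil_bl => //; lia.
split=> //; apply: FilD => //; apply: Fil_mono hF'.
by rewrite (@wl_dn l.+1 (l.+1 + r)) 1?wlS; lia.
Qed.

Lemma push_all_local k v y : (k <= m)%N -> Fil v y ->
  (wt n (dn k 0) + v <= w)%N ->
  push_all a1 k y = push_all a2 k y /\
  Fil (wt n (dn k 0) + v) (push_all a2 k y).
Proof.
move=> hk + hw; elim=> {y} [|x y _ [e h] _ [e' h']|f c hc].
- by rewrite !push_all0; split=> //; apply: Fil0.
- by rewrite !push_allD e e'; split=> //; apply: FilD.
rewrite !push_all_bas.
have [||-> hF] := @push_local k 0 (sh (f * pidem D c)) c => //.
  by rewrite add0n /wl; lia.
by split=> //; apply: Fil_mono hF; rewrite add0n /wl; lia.
Qed.

Lemma body_local j x : (j < m)%N -> (wt n (nf x) + (n - j) = w)%N ->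
  body a1 j x = body a2 j x /\ Fil w (body a2 j x).
Proof.
have [k hk [c ->]] := mkE x; rewrite wt_mk; last exact: hk.
rewrite !bodyE; try exact: hk; move=> hj hw.
have [jk|jk] := eqVneq j k.
  subst k; split=> //; rewrite -[bl _ _]scale1r; apply: Fil_bl => //.
  by rewrite wlS; lia.
have [jk1|jk1] := eqVneq j.+1 k.
  subst k; have hb : Fil (wl j c) (bl j c).
    by rewrite -[bl _ _]scale1r; apply: Fil_bl => //; lia.
  have e : (wl j c + wt n (shw j (lhs false)) = w)%N.
    by rewrite -hw wlS; [rewrite /wt /=; lia|lia].
  have [||-> hF] := rhs_op_local h12 (q := false) (j := j) _ _ hb.
  - by move=> /=; lia.
  - by rewrite e.
  by split; [|apply: Fil_mono hF; lia].
case: ltnP => kj.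
  have hy : Fil (wt m (nf c) + (m - j.-1)) (s' j.-1 (bas D c)).
    by apply: (pact_s (hP' 0)); [lia|apply: Fil_bas].
  have [|e hF] := push_all_local hk hy.
    by rewrite -hw /wl; lia.
  by split; [|apply: Fil_mono hF; rewrite -hw /wl; lia].
have hb : Fil (wl j c) (bl j c).
  by rewrite -[bl _ _]scale1r; apply: Fil_bl => //; lia.
have e : (wl j c + wt n (shw j (lhs true)) + wt n (dn k j.+2) = w)%N.
  rewrite -hw (@wl_dn j k) 1?(@wt_dn k j) 1?(@wt_dn k j.+1); try lia.
  by rewrite [wt n (shw _ _)]/wt /=; lia.
have [||-> hF] := rhs_op_local h12 (q := true) (j := j) (m := wl j c) _ _ hb.
- by move=> /=; lia.
- by lia.
have [||-> hF'] := run_local h12 (e := dn k j.+2) _ _ hF.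
- by apply: inword_dn; lia.
- by rewrite -e [wt n (shw _ _)]/wt /=; lia.
by split; [|apply: Fil_mono hF'; rewrite -e; lia].
Qed.
End BodyLocal.

Lemma fuelS w j x : fuel w.+1 j x = body (fuel w) j x.
Proof. by []. Qed.
Lemma upE0 j x : up j x = body (fuel (wt n (nf x) + (n - j))) j x.
Proof. exact: fuelS. Qed.

Lemma fuel_up w : forall j x w', (j < m)%N -> (wt n (nf x) + (n - j) < w')%N ->
  (wt n (nf x) + (n - j) < w)%N ->
  fuel w' j x = up j x /\ Fil (wt n (nf x) + (n - j)) (up j x).
Proof.
elim: w => // w ih j x w' hj hw' hw.
have ag w1 : (wt n (nf x) + (n - j) <= w1)%N ->
    agree (wt n (nf x) + (n - j)) (fuel w1) up.
  by move=> hw1 i y hi hy; apply: ih => //; lia.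
have [e hF] := body_local (ag _ (leqnn _)) hj erefl.
case: w' hw' => [|w'] hw'; first by lia.
have [e' _] := body_local (ag w' hw') hj erefl.
by rewrite fuelS upE0 e e'; split; [reflexivity|exact: hF].
Qed.

Lemma upE j x : (j < m)%N ->
  up j x = body up j x /\ Fil (wt n (nf x) + (n - j)) (up j x).
Proof.
move=> hj; split; last exact: (@fuel_up _ j x _ hj (leqnn _) (leqnn _)).2.
rewrite upE0; have ag : agree (wt n (nf x) + (n - j))
    (fuel (wt n (nf x) + (n - j))) up by move=> i y hi h; exact: (fuel_up hi h h).
exact: proj1 (body_local ag hj erefl).
Qed.

End Level.

(** * Values of the operators on basis vectors *)

Section Equations.
Variables (D : dotSystem) (m : nat).
Local Notation n := m.+1.
Implicit Types (f g u : D) (c : code m).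
Variable a' : nat -> code m -> freem D m.
Local Notation s' := (lin a').
Hypothesis hP' : forall M, pact m s' (@Fil D m) M.
Local Notation s := (lin (up a')).
Local Notation bl := (@bl D m).
Local Notation semi := (lin_semi (up a')).

Lemma pidem_mk l c : (l <= m)%N ->
  pidem D (mk l c) = mvw (dn l 0) (sh (pidem D c)).
Proof. by move=> h; rewrite /pidem nf_mk // mvw_cat -mvw_sh sh1. Qed.

(** The value of s_j on a basis vector is read off from its definition as soon as
    this value is supported on the colorings for which the word is permissible. *)
Lemma s_bas j x v : (j < m)%N -> body a' (up a') j x = v ->
  mv j (pidem D x) *: v = v -> s j (bas D x) = v.
Proof. by move=> hj <-; rewrite lin_bas (upE hP' x hj).1. Qed.

Lemma s_step k c : (k < m)%N -> s k (bl k c) = bl k.+1 c.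
Proof.
move=> hk; apply: s_bas => //; first by rewrite bodyE ?eqxx //; lia.
have e : pidem D (mk k.+1 c) = mv k (pidem D (mk k c)).
  by rewrite !pidem_mk ?dnS /= ?addn0 //; lia.
by rewrite /bl /bas e scalerA idemM //; apply/idem_mv/idem_pidem.
Qed.

Lemma run_step k l c : (l <= k <= m)%N -> run s (dn k l) (bl l c) = bl k c.
Proof.
elim: k => [|k ih] hk; first by rewrite (_ : l = 0%N) ?dnn //; lia.
have [e|ne] := eqVneq l k.+1; first by rewrite e dnn.
by rewrite dnS ?[run _ _ _]/= ?ih ?s_step //; lia.
Qed.

(** The action on the strands other than the leftmost one. *)
Definition liftm (y : freem D m) : freem D n :=
  \sum_c (sh (y c : D) : D) *: bl 0 c.

Lemma liftmD x y : liftm (x + y) = liftm x + liftm y.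
Proof.
rewrite /liftm -big_split; apply: eq_bigr => c _ /=.
by rewrite ffunE shD scalerDl.
Qed.
Lemma liftm0 : liftm 0 = 0. Proof. exact: additive0 liftmD. Qed.
Lemma liftmZ f y : liftm (f *: y) = sh f *: liftm y.
Proof.
rewrite /liftm scaler_sumr; apply: eq_bigr => c _.
by rewrite freemZ shM scalerA.
Qed.
Lemma liftm_bas c : liftm (bas D c) = bl 0 c.
Proof.
rewrite /liftm (bigD1 c) //= big1 ?addr0 => [|c' ne]; rewrite basE ?eqxx.
  have -> : sh (pidem D c) = pidem D (mk 0 c) by rewrite pidem_mk.
  by rewrite scalerA pidemM.
by rewrite (negbTE ne) sh0 scale0r.
Qed.

Lemma push_run r l f c : (l + r <= m)%N ->
  push (up a') r l f c = run s (dn (l + r) l) (f *: bl l c).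
Proof.
elim: r l f => [|r ih] l f; first by rewrite addn0 dnn.
rewrite addnS -addSn => h; rewrite [push _ _ _ _ _]/= ih // addnS -addSn.
rewrite [in RHS]dn_rcons; last by lia.
rewrite run_cat [run _ [:: l] _]/= semi.2 s_step; last by lia.
by rewrite (runD semi) addrC.
Qed.

Lemma push_all_run k y : (k <= m)%N ->
  push_all (up a') k y = run s (dn k 0) (liftm y).
Proof.
move=> hk; rewrite /push_all /liftm.
rewrite (big_morph (run s (dn k 0)) (runD semi _) (run0 semi _)).
by apply: eq_bigr => c _; rewrite push_run.
Qed.

Lemma s_cancel j c : (j < m)%N -> s j (bl j.+1 c) = rhs_op s false j (bl j c).
Proof.
move=> hj; apply: s_bas => //.
  by rewrite bodyE // (negbTE (_ : j != j.+1)) ?eqxx //; lia.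
have e : bl j c = pidem D (mk j c) *: bl j c by rewrite scalerA pidemM.
rewrite [X in _ = rhs_op _ _ _ X]e (rhs_op_idem semi); last exact: idem_pidem.
by rewrite !pidem_mk ?dnS /= ?addn0 //; lia.
Qed.

Lemma s_pass j k c : (k < j < m)%N ->
  s j (bl k c) = run s (dn k 0) (liftm (s' j.-1 (bas D c))).
Proof.
move=> /andP[kj jm]; apply: s_bas => //.
  rewrite bodyE; last by lia.
  rewrite (negbTE (_ : j != k)); last by lia.
  rewrite (negbTE (_ : j.+1 != k)); last by lia.
  by rewrite kj push_all_run //; lia.
have e : s' j.-1 (bas D c) = mv j.-1 (pidem D c) *: s' j.-1 (bas D c).
  by rewrite lin_bas scalerA idemM //; apply/idem_mv/idem_pidem.
rewrite [in RHS]e liftmZ (run_idem semi); last first.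
  by rewrite -mv_sh -[sh _]mul1r; have := idem_pidem D (mk 0 c);
     rewrite pidem_mk // mul1r; apply: idem_mv.
rewrite -mv_sh prednK ?pidem_mk; try lia.
rewrite mv_mvw //; apply/allP => i; rewrite mem_dn; lia.
Qed.

Lemma s_braid j k c : (j.+1 < k)%N -> (k <= m)%N ->
  s j (bl k c) = run s (dn k j.+2) (rhs_op s true j (bl j c)).
Proof.
move=> jk km; apply: s_bas; first by lia.
  rewrite bodyE; last by lia.
  rewrite (negbTE (_ : j != k)); last by lia.
  rewrite (negbTE (_ : j.+1 != k)); last by lia.
  by rewrite (negbTE (_ : ~~ (k < j)%N)); last by lia.
have e : bl j c = pidem D (mk j c) *: bl j c by rewrite scalerA pidemM.
rewrite [X in _ = run _ _ (rhs_op _ _ _ X)]e.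
rewrite (rhs_op_idem semi); last exact: idem_pidem.
rewrite (run_idem semi); last by apply/idem_mvw/idem_pidem.
congr (_ *: _).
rewrite [mvw (shw _ _) _]/= !addn0 addn1 -mv_mvw; last first.
  by apply/allP => i; rewrite mem_dn; lia.
congr (mv _ _); rewrite !pidem_mk; try lia.
rewrite (@dn_cat k j 0); last by lia.
rewrite mvw_cat (@dn_rcons k j); last by lia.
rewrite mvw_cat (@dn_rcons k j.+1); last by lia.
by rewrite mvw_cat.
Qed.

End Equations.

(** * The relations, by induction on the weight *)

Section Relations.
Variables (D : dotSystem) (m : nat).
Local Notation n := m.+1.
Implicit Types (f g u : D) (c : code m).
Hypothesis hD : resolves D.
Variable a' : nat -> code m -> freem D m.
Local Notation s' := (lin a').
Hypothesis hP' : forall M, pact m s' (@Fil D m) M.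
Local Notation s := (lin (up a')).
Local Notation bl := (@bl D m).
Local Notation semi := (lin_semi (up a')).
Local Notation liftm := (@liftm D m).

Lemma Fil1_bl l c : (l <= m)%N -> Fil (wl l c) (bl l c).
Proof. by move=> h; rewrite -[bl l c]scale1r; apply: Fil_bl. Qed.

(** If the leftmost strand stays at the left, the crossings of the other strands
    act as on m strands. *)
Lemma s_lift j w y : (j.+1 < m)%N -> Fil w y -> s j.+1 (liftm y) = liftm (s' j y).
Proof.
move=> hj; elim=> {y} [|x y _ ex _ ey|f c hc].
- by rewrite liftm0 (s0 semi) (s0 (lin_semi a')) liftm0.
- by rewrite liftmD (semi.1) ex ey (lin_semi a').1 liftmD.
rewrite liftmZ liftm_bas semi.2 (lin_semi a').2 liftmD 2!liftmZ liftm_bas mv_sh dl_sh.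
by rewrite s_pass ?dnn //; lia.
Qed.

Lemma run_lift e w y : inword m e -> Fil w y ->
  run s (map S e) (liftm y) = liftm (run s' e y).
Proof.
move=> + hy; elim: e => //= j e ih /andP[hj he].
by rewrite ih // (s_lift hj (pact_run (hP' 0) he hy)).
Qed.

(** A filtration finer than [Fil]: at the weight w itself only the basis vectors
    whose leftmost strand ends at l are allowed. *)
Inductive Top (l w : nat) : freem D n -> Prop :=
| Top0 : Top l w 0
| TopD x y : Top l w x -> Top l w y -> Top l w (x + y)
| Topb f c : (wl l c <= w)%N -> Top l w (f *: bl l c)
| TopL x : (0 < w)%N -> Fil w.-1 x -> Top l w x.

Lemma Top_lift w y : Fil w y -> Top 0 w (liftm y).
Proof.
elim=> {y} [|x y _ hx _ hy|f c hc]; first by rewrite liftm0; apply: Top0.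
  by rewrite liftmD; apply: TopD.
by rewrite liftmZ liftm_bas; apply: Topb; rewrite /wl dnn.
Qed.

Lemma Fil_s j w x : (j < m)%N -> Fil w x -> Fil (w + (n - j)) (s j x).
Proof.
move=> hj hx; have FilS : agree (w + (n - j)).+1 (up a') (up a').
  by move=> i d hi _; split=> //; have [] := upE hP' d hi.
have hj' : (j.+1 < n)%N by [].
exact: (lin_local FilS hj' (ltnSn _) hx).2.
Qed.

Lemma Top_s l w x : (l < m)%N -> Top l w x -> Top l.+1 (w + (n - l)) (s l x).
Proof.
move=> hl; elim=> {x} [|x y _ hx _ hy|f c hc|x hw hx].
- by rewrite (s0 semi); apply: Top0.
- by rewrite semi.1; apply: TopD.
- rewrite semi.2 s_step //; apply: TopD.
    by apply: Topb; rewrite wlS; lia.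
  by apply: TopL; [lia|apply: Fil_bl; lia].
- apply: TopL; first by lia.
  by apply: Fil_mono (Fil_s hl hx); lia.
Qed.

Lemma Top_run k l w x : (l <= k <= m)%N -> Top l w x ->
  Top k (w + wt n (dn k l)) (run s (dn k l) x).
Proof.
elim: k => [|k ih] hk hx.
  by rewrite (_ : l = 0%N) in hx *; [rewrite dnn addn0|lia].
have [e|ne] := eqVneq l k.+1; first by rewrite -e dnn addn0.
rewrite dnS; last by lia.
have -> : (w + wt n (k :: dn k l) = w + wt n (dn k l) + (n - k))%N.
  by rewrite wt_cons; lia.
by apply: Top_s; [lia|apply: ih => //; lia].
Qed.

(** Far commutation when one of the crossings extends the leftmost strand holds by
    the definition of the operators: no relation of smaller weight is involved.
    It is what makes [Top] useful: for the vectors in [Top l w] a relation at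
    total weight M, beyond the reach of the induction hypothesis, reduces to this
    case. *)
Lemma far_stop i l f c : farl i l -> (i < m)%N -> (l < m)%N ->
  s i (s l (f *: bl l c)) = s l (s i (f *: bl l c)).
Proof.
move=> hil hi hl.
have e : s i (s l (bl l c)) = s l (s i (bl l c)).
  rewrite s_step //; case/orP: hil => h.
    by rewrite !s_braid ?dnS //; lia.
  by rewrite !s_pass ?dnS //; lia.
case/orP: hil => h; first exact: (far_scale semi f h e).
by symmetry; exact: (far_scale semi f h (esym e)).
Qed.

(** If the leftmost strand ends at j, a relation at j holds by the definition of
    the operators. *)
Lemma rel_stop (q : bool) j c : (j + q.+1 < n)%N ->
  run s (shw j (lhs q)) (bl j c) = rhs_op s q j (bl j c).
Proof.
case: q => /= h; rewrite !addn0 ?addn1 s_step ?s_step ?s_cancel //; try lia.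
by rewrite s_braid ?dnn //; lia.
Qed.

(** In this section the relations are known below weight M, and are proved at
    weight M. *)
Section Step.
Variable M : nat.
Hypothesis hP : pact n s (@Fil D n) M.

Lemma Top_far i l w x : farl i l -> (i < m)%N -> (l < m)%N -> Top l w x ->
  (w + (n - i) + (n - l) <= M)%N -> s i (s l x) = s l (s i x).
Proof.
move=> hil hi hl + hM; elim=> {x} [|x y _ ex _ ey|f c hc|x hw hx].
- by rewrite !(s0 semi).
- by rewrite !semi.1 ex ey.
- exact: far_stop.
- by apply: (pact_farl hP hil hi hl hx); lia.
Qed.

Lemma Top_far_run i k l w x : all (farl i) (dn k l) -> (i < m)%N ->
  (l <= k <= m)%N -> Top l w x -> (w + (n - i) + wt n (dn k l) <= M)%N ->
  s i (run s (dn k l) x) = run s (dn k l) (s i x).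
Proof.
move=> + hi; elim: k => [|k ih] hf hk hx hM.
  by rewrite (_ : l = 0%N) ?dnn //; lia.
have [e|ne] := eqVneq l k.+1; first by rewrite e dnn.
have lk : (l <= k)%N by lia.
move: hf hM; rewrite dnS // wt_cons [all _ _]/= => /andP[hik hf] hM.
have hl : (l <= k <= m)%N by lia.
rewrite !run_cons -(ih hf hl hx); last by lia.
by apply: (Top_far hik hi _ (Top_run hl hx)); lia.
Qed.

Lemma rel_top (q : bool) j w x : (j + q.+1 < n)%N -> Top j w x ->
  (w + wt n (shw j (lhs q)) <= M)%N ->
  run s (shw j (lhs q)) x = rhs_op s q j x.
Proof.
move=> hj + hM; elim=> {x} [|x y _ ex _ ey|f c hc|x hw hx].
- by rewrite (run0 semi) (rhs_op0 semi).
- by rewrite (runD semi) (rhs_opD semi) ex ey.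
- have hb : Fil (wl j c) (bl j c) by apply: Fil1_bl; lia.
  by apply: (res_dots hD f hP hb hj _ (rel_stop c hj)); lia.
- by apply: (pact_rel hP hj hx); lia.
Qed.

(** Crossings to the right of the leftmost strand commute with all its
    crossings. *)
Lemma run_pass k e w y : all (fun i => k <= i)%N e -> inword m e ->
  (k <= m)%N -> Fil w y ->
  (w + wt n (dn k 0) + wt n (map S e) <= M)%N ->
  run s (map S e) (run s (dn k 0) (liftm y)) =
  run s (dn k 0) (liftm (run s' e y)).
Proof.
move=> + + hk hy; elim: e => // j e ih /andP[kj he] /andP[hj he'].
rewrite [map S _]/= wt_cons !run_cons => hM.
have hy' := pact_run (hP' 0) he' hy.
rewrite ih //; last by lia.
rewrite -(s_lift hj hy').
apply: (Top_far_run _ hj _ (Top_lift hy')) => //.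
- by apply/allP => i; rewrite mem_dn /farl; lia.
- by rewrite -(wt_S m e); lia.
Qed.

Lemma rel_pass (q : bool) j k c : (k < j)%N -> (j + q.+1 < n)%N -> (k <= m)%N ->
  (wl k c + wt n (shw j (lhs q)) <= M)%N ->
  run s (shw j (lhs q)) (bl k c) = rhs_op s q j (bl k c).
Proof.
move=> kj hj hk hM.
have shwS e : shw j e = map S (shw j.-1 e).
  by rewrite /shw -map_comp; apply: eq_map => i /=; lia.
have hb : Fil (wt m (nf c)) (bas D c) by exact: Fil_bas.
have key e : inword m (shw j.-1 e) -> (wt n (shw j e) <= wt n (shw j (lhs q)))%N ->
    run s (shw j e) (bl k c) = run s (dn k 0) (liftm (run s' (shw j.-1 e) (bas D c))).
  move=> he hw; rewrite -(@run_step _ _ a' hP' k 0) // -liftm_bas shwS.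
  apply: (run_pass _ he hk hb).
    by rewrite all_map; apply/allP => i _ /=; lia.
  by move: hM hw; rewrite /wl -shwS; lia.
have hj' : (j.-1 + q.+1 < m)%N by lia.
rewrite key ?inword_lhs // (pact_rel (hP' _) hj' hb (ltnSn _)) /rhs_op.
rewrite (big_morph liftm (@liftmD _ _) (@liftm0 _ _)).
rewrite (big_morph (run s (dn k 0)) (runD semi _) (run0 semi _)).
rewrite !big_seq; apply: eq_bigr => p pq; rewrite liftmZ key; last first.
- by apply: ltnW; apply: (rhs_word pq).2.
- exact: inword_rhs pq hj'.
rewrite -shnS prednK; last by lia.
have : all (fun l => l.+1 < j)%N (dn k 0) by apply/allP => l; rewrite mem_dn; lia.
elim: (dn k 0) => // l e ih /andP[hl he]; rewrite !run_cons (ih he).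
by apply: (s_inert semi); apply: inert_sh2.
Qed.

(** If the leftmost strand ends at k > j, the vector is obtained from one ending
    at j, and the relation ss for s_j overlaps the word of this vector in sss
    (k = j + 1) or in ssts. *)
Lemma rel_cancel j k c : (j < k <= m)%N ->
  (wl k c + wt n (shw j (lhs false)) <= M)%N ->
  s j (s j (bl k c)) = rhs_op s false j (bl k c).
Proof.
rewrite {1}/wt /= !addn0 => hk hM.
have hb : Fil (wl j c) (bl j c) by apply: Fil1_bl; lia.
have [e|ne] := eqVneq k j.+1.
  subst k; rewrite (s_cancel hP'); last by lia.
  rewrite -(s_step hP') ?(res_sss hD hP hb) //; try lia.
  by move: hM; rewrite wlS /wt /=; lia.
rewrite (s_braid hP'); try lia.
have e : wl k c = (wt n (dn k j.+2) + (n - j.+1) + (n - j) + wl j c)%N.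
  by rewrite (@wl_dn m j k) 1?(@wt_dn m k j) 1?(@wt_dn m k j.+1); lia.
have hF := pact_rhs_op hP (q := true) (j := j) _ hb.
rewrite (pact_far_run hP _ _ (inword_dn _ _) (hF _)); try lia; last first.
- by rewrite /wt /= -[sumn _]/(wt n _); lia.
- by apply/allP => i; rewrite mem_dn /farl; lia.
rewrite -(res_ssts hD hP hb); try lia; last by rewrite /wt /=; lia.
rewrite (pact_run_rhs hP (m := wl j c + (n - j) + (n - j.+1))).
- rewrite (s_step hP') ?(s_step hP') ?(run_step hP') //; lia.
- by apply/allP => i; rewrite mem_dn; lia.
- by apply: inword_dn; lia.
- by move=> /=; lia.
- by do 2! [apply: (pact_s hP); first by lia].
- by rewrite [wt n (shw _ _)]/wt /=; lia.
Qed.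

(** Likewise for the braid relation: the overlaps are stss, ststs and stsuts for
    k = j + 1, k = j + 2 and k > j + 2. *)
Lemma rel_braid j k c : (j < k <= m)%N -> (j.+2 < n)%N ->
  (wl k c + wt n (shw j (lhs true)) <= M)%N ->
  s j (s j.+1 (s j (bl k c))) = rhs_op s true j (bl k c).
Proof.
rewrite {1}/wt /= !addn0 addn1 => hk hj hM.
have hb : Fil (wl j c) (bl j c) by apply: Fil1_bl; lia.
have [e|ne] := eqVneq k j.+1.
  subst k; rewrite (s_cancel hP'); last by lia.
  rewrite -(s_step hP') ?(res_stss hD hP hb) //; try lia.
  by move: hM; rewrite wlS /wt /=; lia.
rewrite (s_braid hP'); try lia.
have [e|ne2] := eqVneq k j.+2.
  subst k; rewrite dnn -(s_step hP'); last by lia.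
  rewrite -(s_step hP'); last by lia.
  rewrite (res_ststs hD hP hb) //; try lia.
  by move: hM; rewrite !wlS /wt /=; lia.
rewrite dn_rcons ?run_cat; last by lia.
have e : wl k c = (wt n (dn k j.+3) + (n - j.+2) + (n - j.+1) + (n - j) + wl j c)%N.
  by rewrite (@wl_dn m j k) 1?(@wt_dn m k j) 1?(@wt_dn m k j.+1)
      1?(@wt_dn m k j.+2); lia.
have hF : Fil (wl j c + (n - j) + (n - j.+1) + (n - j) + (n - j.+2)).-1
            (s j.+2 (rhs_op s true j (bl j c))).
  have hF := pact_rhs_op hP (q := true) (j := j) _ hb.
  have := Fil_s (j := j.+2) _ (hF _); rewrite /wt /=; move=> h.
  by apply: Fil_mono (h _ _); lia.
rewrite run_cons (_ : run s [::] _ = rhs_op s true j (bl j c)) //.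
have far1 i : (i < j.+2)%N -> all (farl i) (dn k j.+3).
  by move=> hi; apply/allP => l; rewrite mem_dn /farl; lia.
rewrite (pact_far_run hP (far1 j.+1 _) _ (inword_dn _ _) hF); try lia.
rewrite (pact_far_run hP (far1 j _) _ (inword_dn _ _)
          (Fil_s (j := j.+1) _ hF)); try lia.
rewrite -(res_stsuts hD hP hb); try lia; last by rewrite /wt /=; lia.
rewrite (pact_run_rhs hP (m := wl j c + (n - j) + (n - j.+1) + (n - j.+2))).
- rewrite !(s_step hP') ?(run_step hP') //; lia.
- by apply/allP => i; rewrite mem_dn; lia.
- by apply: inword_dn; lia.
- by move=> /=; lia.
- by do 3! [apply: (pact_s hP); first by lia].
- by rewrite [wt n (shw _ _)]/wt /=; lia.
Qed.

Lemma rel_bl (q : bool) j k c : (j + q.+1 < n)%N -> (k <= m)%N ->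
  (wl k c + wt n (shw j (lhs q)) <= M)%N ->
  run s (shw j (lhs q)) (bl k c) = rhs_op s q j (bl k c).
Proof.
move=> hj hk hM; case: (ltngtP k j) => kj.
- exact: rel_pass.
- case: q hj hM => hj hM; rewrite /= !addn0 ?addn1.
    by apply: rel_braid => //; [rewrite kj|move: hj => /=; lia].
  by apply: rel_cancel => //; rewrite kj.
- by subst k; apply: rel_stop.
Qed.

(** Far commutation needs no ambiguity: after commuting the crossings i and j
    down to the leftmost strand, each of them meets its own relation, and these
    can be applied in either order. *)
Lemma far_bl i j k c : (i.+1 < j)%N -> (j < m)%N -> (k <= m)%N ->
  (wl k c + (n - i) + (n - j) <= M)%N ->
  s i (s j (bl k c)) = s j (s i (bl k c)).
Proof.
move=> ij jm km hM.
have fij : farl i j by rewrite /farl ij.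
have fji : farl j i by rewrite /farl ij orbT.
have hc : Fil (wt m (nf c)) (bas D c) by exact: Fil_bas.
case: (ltngtP k i) => ki.
- have bE : bl k c = run s (dn k 0) (liftm (bas D c)).
    by rewrite liftm_bas (run_step hP').
  have pass e : all (fun l => k <= l)%N e -> inword m e ->
      (wt n (map S e) <= (n - i) + (n - j))%N ->
      run s (map S e) (bl k c) = run s (dn k 0) (liftm (run s' e (bas D c))).
    move=> he he' hw; rewrite bE; apply: (run_pass he he' km hc).
    by move: hM; rewrite /wl; lia.
  have /= e1 := pass [:: i.-1; j.-1]; have /= e2 := pass [:: j.-1; i.-1].
  rewrite !prednK in e1 e2; try lia.
  rewrite e1 ?e2 /inword /wt /=; try lia.
  congr (run _ _ (liftm _)).
  by apply: (pact_farl (hP' _) _ _ _ hc (ltnSn _)); rewrite /farl; lia.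
- have hbi : Fil (wl i c) (bl i c) by apply: Fil1_bl; lia.
  have far1 l c' : farl i l -> (l < m)%N ->
      s i (s l (bl l c')) = s l (s i (bl l c')).
    move=> hf hl; rewrite -[bl l c']scale1r; apply: far_stop => //; lia.
  have stop_j : s j (s i (bl i c)) = s i (s j (bl i c)).
    by rewrite -[bl i c]scale1r; apply: far_stop => //; lia.
  have [kj|] := ltnP k j; last first.
    rewrite leq_eqVlt => /predU1P[<-|jk]; first by apply: far1.
    have hbj : Fil (wl j c) (bl j c) by apply: Fil1_bl; lia.
    have ei : s i (bl j c) = run s (dn j i.+2) (rhs_op s true i (bl i c)).
      by apply: (s_braid hP'); lia.
    have ewl : wl j c = (wt n (dn j i.+2) + (n - i.+1) + (n - i) + wl i c)%N.
      by rewrite (@wl_dn m i j) 1?(@wt_dn m j i) 1?(@wt_dn m j i.+1); lia.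
    have hz : Fil (wl j c + (n - i)).-1 (s i (bl j c)).
      rewrite ei; have h := pact_rhs_op hP (q := true) (j := i) _ hbi.
      have := pact_run hP (inword_dn i.+2 (_ : (j < n)%N)) (h _).
      rewrite [wt n (shw _ _)]/wt /= => h'.
      by apply: Fil_mono (h' _ _); rewrite ?ewl; lia.
    have [e|ne] := eqVneq k j.+1.
      subst k; move: hM; rewrite wlS; last by lia.
      move=> hM; rewrite (s_cancel hP'); last by lia.
      rewrite -(s_step hP') ?(far1 _ _ fij jm); last by lia.
      rewrite (pact_far_rhs hP _ _ _ hbj); try lia; last first.
        by rewrite /wt /=; lia.
      have /= := pact_rel hP (q := false) (j := j) _ hz.
      by rewrite !addn0 => ->; [|lia|rewrite /wt /=; lia].
    have ewk : wl k c = (wt n (dn k j.+2) + (n - j.+1) + (n - j) + wl j c)%N.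
      by rewrite (@wl_dn m j k) 1?(@wt_dn m k j) 1?(@wt_dn m k j.+1); lia.
    rewrite (s_braid hP'); try lia.
    have hF := pact_rhs_op hP (q := true) (j := j) _ hbj.
    rewrite (pact_far_run hP _ _ (inword_dn _ _) (hF _)); try lia; last first.
    + by rewrite [wt n (shw _ _)]/wt /=; lia.
    + by apply/allP => l; rewrite mem_dn /farl; lia.
    rewrite (pact_far_rhs hP _ _ _ hbj); try lia; last first.
      by rewrite /wt /=; lia.
    have Tb : Top j (wl j c) (bl j c).
      by rewrite -[bl j c]scale1r; apply: Topb.
    rewrite -(@run_step _ _ a' hP' k j); last by lia.
    rewrite (Top_far_run _ _ _ Tb); try lia; last first.
    + by move: (@wl_dn m j k c); lia.
    + by apply/allP => l; rewrite mem_dn /farl; lia.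
    rewrite (@dn_rcons k j) ?(@dn_rcons k j.+1); try lia.
    rewrite !run_cat; have hz1 := Fil_s (j := j) _ hz.
    have hz2 := Fil_s (j := j.+1) _ (hz1 _).
    rewrite (pact_far_run hP _ _ (inword_dn _ _) (hz2 _ _)); try lia; last first.
    + by apply/allP => l; rewrite mem_dn /farl; lia.
    have /= := pact_rel hP (q := true) (j := j) _ hz.
    by rewrite !addn0 addn1 => ->; [|lia|rewrite /wt /=; lia].
  have hbk : Top i (wl i c + (n - j)) (s j (bl i c)).
    rewrite (s_pass hP'); last by lia.
    have h := Top_lift (pact_s (hP' 0) (j := j.-1) _ hc).
    have := Top_run (l := 0) (k := i) _ (h _).
    rewrite (_ : (m - j.-1 = n - j)%N); last by lia.
    by rewrite /wl addnAC [(wt m _ + _)%N]addnC; apply; lia.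
  have [e|ne] := eqVneq k i.+1.
    subst k; move: hM; rewrite wlS; last by lia.
    move=> hM; rewrite (s_cancel hP'); last by lia.
    rewrite -(s_step hP'); last by lia.
    rewrite stop_j (pact_far_rhs hP _ _ _ hbi); try lia; last by rewrite /wt /=; lia.
    have /= := rel_top (q := false) _ hbk.
    by rewrite !addn0 => ->; [|lia|rewrite /wt /=; lia].
  have ewk : wl k c = (wt n (dn k i.+2) + (n - i.+1) + (n - i) + wl i c)%N.
    by rewrite (@wl_dn m i k) 1?(@wt_dn m k i) 1?(@wt_dn m k i.+1); lia.
  have -> : s j (bl k c) = run s (dn k i.+2) (s i.+1 (s i (s j (bl i c)))).
    rewrite !(s_pass hP'); try lia.
    rewrite (@dn_cat k i 0); last by lia.
    rewrite (@dn_rcons k i) ?(@dn_rcons k i.+1); try lia.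
    by rewrite !run_cat.
  have T2 := Top_s (l := i.+1) _ (Top_s (l := i) _ hbk).
  rewrite (Top_far_run _ _ _ (T2 _ _)); try lia; last first.
  + by apply/allP => l; rewrite mem_dn /farl; lia.
  rewrite (@s_braid _ _ a' hP' i k); try lia.
  have hF := pact_rhs_op hP (q := true) (j := i) _ hbi.
  rewrite (pact_far_run hP _ _ (inword_dn _ _) (hF _)); try lia; last first.
  + by rewrite [wt n (shw _ _)]/wt /=; lia.
  + by apply/allP => l; rewrite mem_dn /farl; lia.
  rewrite (pact_far_rhs hP _ _ _ hbi); try lia; last by rewrite /wt /=; lia.
  have /= := rel_top (q := true) _ hbk.
  by rewrite !addn0 addn1 => ->; [|lia|rewrite /wt /=; lia].
- by subst k; rewrite -[bl i c]scale1r; symmetry; apply: far_stop; lia.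
Qed.

Lemma pactS : pact n s (@Fil D n) M.+1.
Proof.
split.
- exact: semi.
- by move=> w w' x; apply: Fil_mono.
- exact: FilD.
- by move=> w f x; apply: FilZ.
- by move=> j w x hj; apply: Fil_s.
- move=> q j w x hj + hM; elim=> {x} [|x y _ ex _ ey|f d hd].
  + by rewrite (run0 semi) (rhs_op0 semi).
  + by rewrite (runD semi) (rhs_opD semi) ex ey.
  have [k hk [c e]] := mkE d; rewrite {}e wt_mk // in hd *.
  apply: (res_dots hD f hP (Fil1_bl c hk) hj); first by lia.
  by apply: rel_bl => //; lia.
- move=> i j w x ij hj + hM; elim=> {x} [|x y _ ex _ ey|f d hd].
  + by rewrite !(s0 semi).
  + by rewrite !semi.1 ex ey.
  have [k hk [c e]] := mkE d; rewrite {}e wt_mk // in hd *.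
  by apply: (far_scale semi f ij); apply: far_bl => //; lia.
Qed.

End Step.

Lemma pact_up M : pact n s (@Fil D n) M.
Proof.
elim: M => [|M ih]; last exact: pactS.
split.
- exact: semi.
- by move=> w w' x; apply: Fil_mono.
- exact: FilD.
- by move=> w f x; apply: FilZ.
- by move=> j w x hj; apply: Fil_s.
- by move=> q j w x _ _; rewrite ltn0.
- by move=> i j w x _ _ _; rewrite ltn0.
Qed.

End Relations.

Section Model.
Variable D : dotSystem.
Hypothesis hD : resolves D.

Fixpoint strand_act (n : nat) : nat -> code n -> freem D n :=
  if n is m.+1 return nat -> code n -> freem D n then up (@strand_act m)
  else fun _ _ => 0.

Lemma pact_act n M : pact n (lin (@strand_act n)) (@Fil D n) M.
Proof.
elim: n M => [|n ih] M; last exact: pact_up.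
split=> //; first exact: lin_semi.
- by move=> w w' x; apply: Fil_mono.
- exact: FilD.
- by move=> w f x; apply: FilZ.
Qed.

Lemma run_nf n (c : code n) :
  run (lin (@strand_act n)) (nf c) (bas D (code1 n)) = bas D c.
Proof.
elim: n c => [|n ih] c; first by case: c.
have [k hk [c' ->]] := mkE c; rewrite nf_mk // run_cat.
have -> : bas D (code1 n.+1) = liftm (bas D (code1 n)).
  by rewrite liftm_bas /bl /mk (_ : inord 0 = ord0) //; apply: val_inj; rewrite /= inordK.
rewrite (run_lift (fun M => pact_act n M) (nf_inword _) (Fil_bas _ _)) ih liftm_bas.
by rewrite (run_step (fun M => pact_act n M)).
Qed.

End Model.

(** * Tensor products of dots *)

Section TensorMaps.
Variable kk : comPzRingType.

Lemma klinear0 (A B : comAlg kk) (g : A -> B) : klinear g -> g 0 = 0.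
Proof. by case=> gD _; apply: additive0. Qed.

Definition tmapr (A B B' : comAlg kk) (g : B -> B') :
    tens_alg A B -> tens_alg A B' := tlift (fun a b => tpure a (g b)).

Section Tmapr.
Variables (A B B' : comAlg kk) (g : B -> B').
Hypothesis hg : klinear g.

Lemma tmapr_bal : balanced (fun (a : A) b => tpure a (g b)).
Proof.
split=> [a1 a2 b|a b1 b2|c a b]; first exact: tpureDl.
  by rewrite hg.1 tpureDr.
by rewrite tpure_scal hg.2.
Qed.
Lemma tmapr_pure a b : tmapr g (tpure a b : tens_alg A B) = tpure a (g b).
Proof. exact: tlift_pure tmapr_bal a b. Qed.
Lemma tmaprD x y : @tmapr A B B' g (x + y) = tmapr g x + tmapr g y.
Proof. exact: tliftD tmapr_bal x y. Qed.
Lemma tmapr0 : @tmapr A B B' g 0 = 0.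
Proof. exact: additive0 tmaprD. Qed.
Lemma tmapr_klin : klinear (@tmapr A B B' g).
Proof.
split=> [x y|c x]; first exact: tmaprD.
elim/tens_ind: x => [|x y ex ey|a b]; first by rewrite mulr0 tmapr0 mulr0.
  by rewrite mulrDr !tmaprD ex ey mulrDr.
by rewrite [_ * _]tmul_pure tmapr_pure tmapr_pure [RHS]tmul_pure !mul1r.
Qed.
Lemma tmaprM (g' g'' : B -> B') :
  klinear g' -> klinear g'' -> (forall x y, g (x * y) = g' x * g'' y) ->
  forall x y : tens_alg A B,
    tmapr g (x * y) = @tmapr A B B' g' x * @tmapr A B B' g'' y.
Proof.
have D0 h : klinear h -> klinear (@tmapr A B B' h).
  case=> hD hZ; split=> [x y|c x].
    by apply: tliftD; split=> *; rewrite ?hD ?tpureDl ?tpureDr ?tpure_scal ?hZ.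
  have bal : balanced (fun (a : A) b => tpure a (h b)).
    by split=> *; rewrite ?hD ?tpureDl ?tpureDr ?tpure_scal ?hZ.
  elim/tens_ind: x => [|x y ex ey|a b]; first by rewrite mulr0 /tmapr tlift0 // mulr0.
    by rewrite mulrDr /tmapr !tliftD // mulrDr -ex -ey.
  by rewrite [_ * _]tmul_pure /tmapr !tlift_pure // [RHS]tmul_pure !mul1r.
move=> hg' hg'' hM x y.
have [aD' _] := D0 _ hg'; have [aD'' _] := D0 _ hg''.
have a0' := klinear0 (D0 _ hg'); have a0'' := klinear0 (D0 _ hg'').
elim/tens_ind: x => [|x1 x2 e1 e2|a b].
- by rewrite mul0r tmapr0 a0' mul0r.
- by rewrite mulrDl tmaprD aD' e1 e2 mulrDl.
elim/tens_ind: y => [|y1 y2 e1 e2|a1 b1].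
- by rewrite mulr0 tmapr0 a0'' mulr0.
- by rewrite mulrDr tmaprD aD'' e1 e2 mulrDr.
have pure h : klinear h -> forall a b, @tmapr A B B' h (tpure a b) = tpure a (h b).
  case=> hD hZ a2 b2; apply: tlift_pure.
  by split=> *; rewrite ?hD ?tpureDl ?tpureDr ?tpure_scal ?hZ.
by rewrite [tpure _ _ * _]tmul_pure !pure // [RHS]tmul_pure hM.
Qed.
End Tmapr.

Lemma eq_tmapr (A B B' : comAlg kk) (g h : B -> B') : g =1 h ->
  @tmapr A B B' g =1 @tmapr A B B' h.
Proof. by move=> e x; apply: eq_bigr => p _; rewrite e. Qed.

End TensorMaps.

Section Words.
Variables (kk : comPzRingType) (I : eqType) (R : I -> comAlg kk).
Local Notation Rw := (dots R).
Local Notation tcat := (@tcat kk I R _ _).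

Lemma tcatDl v w (f f' : Rw v) (g : Rw w) : tcat (f + f') g = tcat f g + tcat f' g.
Proof. by rewrite ((tcat_bilinear R v w).2 g).1. Qed.
Lemma tcatDr v w (f : Rw v) (g g' : Rw w) : tcat f (g + g') = tcat f g + tcat f g'.
Proof. by rewrite ((tcat_bilinear R v w).1 f).1. Qed.
Lemma tcat0l v w (g : Rw w) : tcat (0 : Rw v) g = 0.
Proof. exact: (additive0 (fun x y => tcatDl x y g)). Qed.
Lemma tcat0r v w (f : Rw v) : tcat f (0 : Rw w) = 0.
Proof. exact: (additive0 (tcatDr f)). Qed.
Lemma tcat_pure i v w (r : R i) (f : Rw v) (g : Rw w) :
  tcat (tpure r f : Rw (i :: v)) g = tpure r (tcat f g) :> Rw (i :: v ++ w).
Proof.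
rewrite /= tlift_pure //; split=> [a a' b|a b b'|c a b]; first exact: tpureDl.
  by rewrite tcatDl tpureDr.
by rewrite ((tcat_bilinear R v w).2 g).2 tpure_scal.
Qed.
Lemma tcat1_cons k v w (g : Rw w) :
  tcat (1 : Rw (k :: v)) g = tpure 1 (tcat (1 : Rw v) g).
Proof. exact: (@tcat_pure k v w 1 1 g). Qed.
Lemma tcat1_nil w (g : Rw w) : tcat (1 : Rw [::]) g = g.
Proof. by rewrite /= rmorph1 mul1r. Qed.
Lemma tcat1 v w : tcat (1 : Rw v) (1 : Rw w) = 1.
Proof.
elim: v => [|i v ih]; first by rewrite /= rmorph1 mul1r.
by rewrite -[1 : Rw (i :: v)]/(tpure 1 1) tcat_pure ih.
Qed.

(** Tensors over a concatenation are sums of concatenated tensors. *)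
Lemma gen_ind v w (P : Rw (v ++ w) -> Prop) :
  P 0 -> (forall x y, P x -> P y -> P (x + y)) ->
  (forall f g, P (tcat f g)) -> forall x, P x.
Proof.
elim: v P => [|i v ih] P P0 PD Pc x.
  by have := Pc 1 x; rewrite /= rmorph1 mul1r.
elim/tens_ind: x => // r f; elim/ih: f.
- have e : tpure r 0 = 0 :> Rw (i :: v ++ w).
    exact: (additive0 (fun x y => @tpureDr kk (R i) (Rw (v ++ w)) r x y)).
  by rewrite e.
- by move=> x y hx hy; rewrite (tpureDr (A := R i) (B := Rw (v ++ w))); apply: PD.
- by move=> f g; rewrite -tcat_pure.
Qed.

Lemma tcatM v w (f f' : Rw v) (g g' : Rw w) :
  tcat f g * tcat f' g' = tcat (f * f') (g * g').
Proof.
elim: v f f' => [|i v ih] f f'.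
  by rewrite /= rmorphM mulrACA.
elim/tens_ind: f => [|x y ex ey|r f].
- by rewrite tcat0l !mul0r tcat0l.
- by rewrite tcatDl !mulrDl tcatDl ex ey.
elim/tens_ind: f' => [|x y ex ey|r' f'].
- by rewrite tcat0l !mulr0 tcat0l.
- by rewrite tcatDl !mulrDr tcatDl ex ey.
by rewrite !tcat_pure [LHS]tmul_pure ih [tpure r f * _]tmul_pure tcat_pure.
Qed.

Lemma text0E b v w (f : Rw v -> Rw w) (x : Rw v) (h : Rw b) : klinear f ->
  @text kk I R [::] b v w f (tcat x h) = tcat (f x) h.
Proof.
move=> hf; have := @textE kk I R [::] b v w f 1 x h hf.
by rewrite /= !rmorph1 !mul1r.
Qed.
Lemma textD a b v w (f : Rw v -> Rw w) x y : klinear f ->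
  @text kk I R a b v w f (x + y) = text f x + text f y.
Proof.
move=> hf; have [fD fZ] := hf.
have bal1 g : balanced (fun x h => @Defs.tcat kk I R a _ g (@Defs.tcat kk I R w b (f x) h)).
  split=> [x1 x2 h'|x' h1 h2|c x' h'].
  - by rewrite fD tcatDl tcatDr.
  - by rewrite !tcatDr.
  by rewrite fZ ((tcat_bilinear R _ _).2 _).2 -((tcat_bilinear R _ _).1 _).2.
apply: (tsplit_facts _).1; split=> [g1 g2 t|g' t1 t2|c g' t].
- by rewrite -tsplitDF; apply: eq_tsplit => x' h'; rewrite tcatDl.
- exact: (tsplit_facts (bal1 g')).1.
rewrite (tsplit_facts (bal1 g')).2; apply: eq_tsplit => x' h'.
by rewrite fZ ((tcat_bilinear R _ _).2 _).2 ((tcat_bilinear R _ _).2 _).2 ((tcat_bilinear R _ _).1 _).2.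
Qed.
Lemma text_0 a b v w (f : Rw v -> Rw w) : klinear f ->
  @text kk I R a b v w f 0 = 0.
Proof. by move=> hf; apply: additive0 => x y; apply: textD. Qed.
Lemma tcatZl v w c (f : Rw v) (g : Rw w) :
  tcat (scal (Rw v) c * f) g = scal (Rw (v ++ w)) c * tcat f g.
Proof. exact: ((tcat_bilinear R v w).2 g).2. Qed.
Lemma text0_klin b v w (f : Rw v -> Rw w) : klinear f ->
  klinear (@text kk I R [::] b v w f).
Proof.
move=> hf; split=> [x y|c x]; first exact: textD.
elim/(@gen_ind v b): x => [|x y ex ey|x h].
- by rewrite mulr0 text_0 // mulr0.
- by rewrite mulrDr !textD // ex ey mulrDr.
have -> : scal (Rw ([::] ++ v ++ b)) c * tcat x h = tcat (scal (Rw v) c * x) h.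
  by rewrite tcatZl.
by rewrite !text0E // hf.2 tcatZl.
Qed.
Lemma text0M b v w (f f' f'' : Rw v -> Rw w) : klinear f -> klinear f' ->
  klinear f'' -> (forall x y, f (x * y) = f' x * f'' y) -> forall x y,
  @text kk I R [::] b v w f (x * y) = text f' x * text f'' y.
Proof.
move=> hf hf' hf'' hM x y.
elim/(@gen_ind v b): x => [|x1 x2 e1 e2|x h].
- by rewrite mul0r !text_0 // mul0r.
- by rewrite mulrDl !textD // e1 e2 mulrDl.
elim/(@gen_ind v b): y => [|y1 y2 e1 e2|y h'].
- by rewrite mulr0 !text_0 // mulr0.
- by rewrite mulrDr !textD // e1 e2 mulrDr.
transitivity (@text kk I R [::] b v w f (tcat (x * y) (h * h'))).
  by congr (text _ _); exact: (tcatM x y h h').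
by rewrite !text0E // hM; exact: (esym (tcatM (f' x) (f'' y) h h')).
Qed.
Lemma text_cons k a b v w (f : Rw v -> Rw w) : klinear f ->
  @text kk I R (k :: a) b v w f =1 tmapr (@text kk I R a b v w f).
Proof.
move=> hf x.
have kl : forall a, klinear (@text kk I R a b v w f).
  move=> {x}a0; split=> [x y|c x]; first exact: textD.
  elim/(@gen_ind a0 (v ++ b)): x => [|x y ex ey|g x].
  - by rewrite mulr0 text_0 // mulr0.
  - by rewrite mulrDr !textD // ex ey mulrDr.
  elim/(@gen_ind v b): x => [|x y ex ey|x h].
  - by rewrite tcat0r mulr0 text_0 // mulr0.
  - by rewrite tcatDr mulrDr !textD // ex ey mulrDr.
  by rewrite -tcatZl !textE // tcatZl.
elim/(@gen_ind (k :: a) (v ++ b)): x => [|x y ex ey|g x].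
- by rewrite text_0 // tmapr0.
- by rewrite textD // (tmaprD (kl a)) ex ey.
elim/tens_ind: g => [|g1 g2 e1 e2|r g].
- by rewrite tcat0l text_0 // tmapr0.
- by rewrite tcatDl textD // (tmaprD (kl a)) e1 e2.
rewrite tcat_pure (tmapr_pure (kl a)) -tcat_pure.
elim/(@gen_ind v b): x => [|x y ex ey|x h].
- rewrite !tcat0r !text_0 //; apply: esym.
  exact: (additive0 (fun x y => @tpureDr kk (R k) (Rw (a ++ w ++ b)) r x y)).
- by rewrite !tcatDr !textD // ex ey -tpureDr.
by rewrite !textE // tcat_pure.
Qed.

(** Transport between words, zero when the words differ: it allows equations
    between tensors over words that are only propositionally equal, and makes the
    dot-moving relations uniform in the colors. *)
Definition castw v w (f : Rw v) : Rw w :=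
  if @eqP _ v w is ReflectT e then eq_rect v (fun w => Rw w : Type) f w e else 0.

Lemma castw_id v (f : Rw v) : castw v f = f.
Proof. by rewrite /castw; case: eqP => // e; rewrite (eq_axiomK e). Qed.
Lemma castw_neq v w (f : Rw v) : v != w -> castw w f = 0.
Proof. by rewrite /castw; case: eqP. Qed.
Lemma castw_fam (G : forall w, Rw w) v w : v = w -> castw w (G v) = G w.
Proof. by move=> e; subst w; rewrite castw_id. Qed.
Lemma castw_klin v w : klinear (@castw v w).
Proof.
have [e|ne] := eqVneq v w.
  by subst w; split=> [x y|c x]; rewrite !castw_id.
by split=> [x y|c x]; rewrite !castw_neq // ?addr0 ?mulr0.
Qed.
Lemma castw_tcat v w b (f : Rw v) (g : Rw b) :
  castw (w ++ b) (tcat f g) = tcat (castw w f) g.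
Proof.
have [e|ne] := eqVneq v w; first by subst w; rewrite !castw_id.
rewrite (castw_neq f ne) tcat0l castw_neq //.
apply: contra ne => /eqP e; have hs : size v = size w.
  by move/(congr1 size): e; rewrite !size_cat => /addIn.
by move/eqP: e; rewrite eqseq_cat // => /andP[].
Qed.

Lemma castw_cons k v w r (f : Rw v) :
  castw (k :: w) (tpure r f : Rw (k :: v)) = tpure r (castw w f).
Proof.
have [e|ne] := eqVneq v w; first by subst w; rewrite !castw_id.
rewrite !castw_neq //; last by apply: contra ne => /eqP[->].
by apply/esym; exact: (additive0 (fun x y => @tpureDr kk (R k) (Rw w) r x y)).
Qed.

End Words.

(** * Crossings and far commutation *)

Section Diag.
Variables (kk : comPzRingType) (H : heckeData kk).
Local Notation I := (color H).
Local Notation Rw := (dots (@dotalg kk H)).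
Local Notation crossing := (@crossing kk H).
Local Notation diag := (@diag kk H).
Local Notation "x ** y" := (dcomp x y)
  (at level 40, y at level 40, right associativity).

Lemma dcompA v w u t (x : diag u t) (y : diag w u) (z : diag v w) :
  (x ** y) ** z = x ** y ** z.
Proof.
by elim: x y => //= [u' f x ih|u' t' s x ih] y; rewrite ih.
Qed.
Lemma dcomp1 v w (x : diag v w) : x ** dnil v = x.
Proof. by elim: x => //= [u f x ->|u u' s x ->]. Qed.
Lemma dshift1_comp k v w u (x : diag w u) (y : diag v w) :
  dshift1 k (x ** y) = dshift1 k x ** dshift1 k y.
Proof. by elim: x y => //= [u' f x ih|u' t' s x ih] y; rewrite ih. Qed.

Fixpoint cshift (a : seq I) v w (s : crossing v w) :
    crossing (a ++ v) (a ++ w) :=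
  if a is k :: a' then crossingS k (cshift a' s) else s.

Definition cdiag v w (s : crossing v w) : diag v w := dcross s (dnil v).

Lemma dshift_cdiag a v w (s : crossing v w) :
  dshift a (cdiag s) = cdiag (cshift a s).
Proof. by elim: a => //= k a ->. Qed.

(** Dependent elimination of crossings: every crossing consists of a crossing of
    two strands and identity strands on both sides. *)
Lemma crossing_shift_ind (P : forall v w, crossing v w -> Prop) :
  (forall a i j b (p : permitted i j), P _ _ (cshift a (crossing0 b p))) ->
  forall v w (s : crossing v w), P v w s.
Proof.
move=> h v w s; elim: s P h => {v w} [i j b p|k v w s ih] P h.
  exact: (h [::]).
by apply: (ih (fun v w s => P (k :: v) (k :: w) (crossingS k s))) => a *;
  apply: (h (k :: a)).
Qed.

(** Inversion of a crossing according to its height, with top or bottom word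
    already split. *)
Lemma crossing_top_S u x w (s : crossing u (x :: w))
    (P : forall u, crossing u (x :: w) -> Prop) :
  (forall u' (s' : crossing u' w), P (x :: u') (crossingS x s')) ->
  (0 < height s)%N -> P u s.
Proof.
refine (match s as s0 in Defs.crossing u0 w0 return
  (match w0 return crossing u0 w0 -> Prop with
   | x :: w => fun s0 => forall P : forall u, crossing u (x :: w) -> Prop,
      (forall u' (s' : crossing u' w), P (x :: u') (crossingS x s')) ->
      (0 < height s0)%N -> P u0 s0
   | [::] => fun _ => True end s0) with
  | crossing0 _ _ _ _ => _ | crossingS _ _ _ _ => _ end P) => //.
Qed.
Lemma crossing_bot_S w x u (s : crossing (x :: u) w)
    (P : forall w, crossing (x :: u) w -> Prop) :
  (forall w' (s' : crossing u w'), P (x :: w') (crossingS x s')) ->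
  (0 < height s)%N -> P w s.
Proof.
refine (match s as s0 in Defs.crossing u0 w0 return
  (match u0 return crossing u0 w0 -> Prop with
   | x :: u => fun s0 => forall P : forall w, crossing (x :: u) w -> Prop,
      (forall w' (s' : crossing u w'), P (x :: w') (crossingS x s')) ->
      (0 < height s0)%N -> P w0 s0
   | [::] => fun _ => True end s0) with
  | crossing0 _ _ _ _ => _ | crossingS _ _ _ _ => _ end P) => //.
Qed.
Lemma crossing_top_0 u x w (s : crossing u (x :: w))
    (P : forall w u, crossing u (x :: w) -> Prop) :
  (forall y b (p : permitted y x), P (y :: b) (y :: x :: b) (crossing0 b p)) ->
  height s = 0%N -> P w u s.
Proof.
refine (match s as s0 in Defs.crossing u0 w0 return
  (match w0 return crossing u0 w0 -> Prop with
   | x :: w => fun s0 => forall P : forall w u, crossing u (x :: w) -> Prop,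
      (forall y b (p : permitted y x), P (y :: b) (y :: x :: b) (crossing0 b p)) ->
      height s0 = 0%N -> P w u0 s0
   | [::] => fun _ => True end s0) with
  | crossing0 _ _ _ _ => _ | crossingS _ _ _ _ => _ end P) => //.
Qed.

Definition far_sym v w (d d' : diag v w) := far d d' \/ far d' d.

Lemma far_shift1 k v w (d d' : diag v w) :
  far d d' -> far (dshift1 k d) (dshift1 k d').
Proof.
case=> a x y c z u e pxy pzu T B /=; rewrite !dshift1_comp.
exact: (@Far _ _ _ _ (k :: a) x y c z u e pxy pzu (dshift1 k T) (dshift1 k B)).
Qed.
Lemma far_sym_shift1 k v w (d d' : diag v w) :
  far_sym d d' -> far_sym (dshift1 k d) (dshift1 k d').
Proof. by case=> h; [left|right]; apply: far_shift1. Qed.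

(** The map of dots given by a family phi2 for two strands, extended to the other
    strands by the identity. *)
Section Cmap.
Variable phi2 : forall i j : I, Rw [:: i; j] -> Rw [:: j; i].
Hypothesis hphi : forall i j, klinear (@phi2 i j).

Fixpoint cmap v w (s : crossing v w) : Rw v -> Rw w :=
  match s in Defs.crossing v w return Rw v -> Rw w with
  | crossing0 i j b p =>
      @text kk I (@dotalg kk H) [::] b [:: i; j] [:: j; i] (@phi2 i j)
  | crossingS k v w s => @tmapr kk (dotalg k) (Rw v) (Rw w) (cmap s)
  end.

Lemma cmap_klin v w (s : crossing v w) : klinear (cmap s).
Proof.
elim: s => {v w} [i j b p|k v w s ih] /=.
  exact: (@text0_klin kk I _ b [:: i; j] [:: j; i] _ (hphi i j)).
exact: tmapr_klin.
Qed.
Lemma cmap0 v w (s : crossing v w) : cmap s 0 = 0.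
Proof. exact: klinear0 (cmap_klin s). Qed.
Lemma cmap_crossing0 i j b (p : permitted i j) (x : Rw [:: i; j]) (h : Rw b) :
  cmap (crossing0 b p) (tcat x h) = tcat (phi2 x) h.
Proof. by rewrite /= text0E. Qed.
Lemma cmap_S k v w (s : crossing v w) r f :
  cmap (crossingS k s) (tpure r f : Rw (k :: v)) = tpure r (cmap s f).
Proof. by rewrite /= tmapr_pure //; apply: cmap_klin. Qed.
Lemma cmap_shift a i j b (p : permitted i j) :
  cmap (cshift a (crossing0 b p)) =1
  @text kk I (@dotalg kk H) a b [:: i; j] [:: j; i] (@phi2 i j).
Proof.
elim: a => [|k a ih] x //; have -> := @text_cons kk I _ k a b [:: i; j] [:: j; i] _ (hphi i j) x.
exact: eq_tmapr.
Qed.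
Lemma cmap_cshift a v w (s : crossing v w) (g : Rw a) (f : Rw v) :
  cmap (cshift a s) (tcat g f) = tcat g (cmap s f).
Proof.
elim: a g => [|k a ih] g.
  by rewrite /= (cmap_klin s).2.
elim/tens_ind: g => [|x y ex ey|r g].
- by rewrite !tcat0l cmap0.
- by rewrite !tcatDl (cmap_klin _).1 ex ey.
by rewrite tcat_pure cmap_S ih tcat_pure.
Qed.
End Cmap.

Lemma cmap_comm (phi psi : forall i j : I, Rw [:: i; j] -> Rw [:: j; i])
    i j (p : permitted i j) b b' (t : crossing b b') (f : Rw (i :: j :: b)) :
  (forall i j, klinear (@phi i j)) -> (forall i j, klinear (@psi i j)) ->
  cmap phi (crossing0 b' p) (cmap psi (crossingS i (crossingS j t)) f) =
  cmap psi (crossingS j (crossingS i t)) (cmap phi (crossing0 b p) f).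
Proof.
move=> hphi hpsi; elim/(@gen_ind kk I (@dotalg kk H) [:: i; j] b): f => [|x y ex ey|x h].
- by rewrite !cmap0.
- by rewrite (cmap_klin hpsi _).1 (cmap_klin hphi _).1 ex ey
     (cmap_klin hphi _).1 (cmap_klin hpsi _).1.
have -> := @cmap_cshift psi hpsi [:: i; j] _ _ t x h.
rewrite !cmap_crossing0 //.
by have -> := @cmap_cshift psi hpsi [:: j; i] _ _ t (phi i j x) h.
Qed.

(** Two crossings far apart can be interchanged, and so can the maps of dots that
    they induce.  The second half gives the commutation axioms of the dots. *)
Lemma far_square u v1 w (s1 : crossing v1 w) (s2 : crossing u v1) :
  farl (height s1) (height s2) ->
  exists v2 (s2' : crossing v2 w) (s1' : crossing u v2),
    [/\ height s2' = height s2, height s1' = height s1,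
        far_sym (dcross s1 (cdiag s2)) (dcross s2' (cdiag s1')) &
        forall phi psi, (forall i j, klinear (@phi i j)) ->
          (forall i j, klinear (@psi i j)) -> forall f,
          cmap phi s1 (cmap psi s2 f) = cmap psi s2' (cmap phi s1' f)].
Proof.
have base i j (p : permitted i j) b b' (t : crossing b b') :
    far (dcross (crossing0 b' p) (cdiag (crossingS i (crossingS j t))))
        (dcross (crossingS j (crossingS i t)) (cdiag (crossing0 b p))).
  elim/crossing_shift_ind: t => c z y e q.
  have := @Far _ _ _ _ [::] i j c z y e p q (dnil _) (dnil _).
  by rewrite /= -[cross e q]/(cdiag (crossing0 e q)) dshift_cdiag.
elim: s1 u s2 => {v1 w} [i j b p|k v1 w s1 ih] u s2 hf.
  have h2 : (1 < height s2)%N by move: hf; rewrite /farl ltn0 orbF.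
  pose Q u (s2 : crossing u (i :: j :: b)) := (1 < height s2)%N ->
    exists v2 (s2' : crossing v2 (j :: i :: b)) (s1' : crossing u v2),
    [/\ height s2' = height s2, height s1' = 0%N,
        far_sym (dcross (crossing0 b p) (cdiag s2)) (dcross s2' (cdiag s1')) &
        forall phi psi, (forall i j, klinear (@phi i j)) ->
          (forall i j, klinear (@psi i j)) -> forall f,
          cmap phi (crossing0 b p) (cmap psi s2 f) =
          cmap psi s2' (cmap phi s1' f)].
  move: (h2); apply: (crossing_top_S (P := Q)); last by lia.
  move=> u' s' {}h2.
  pose Q' u (s : crossing u (j :: b)) := Q _ (crossingS i s).
  move: (h2); apply: (crossing_top_S (P := Q')); last by move: h2 => /=; lia.
  move=> b' t _; exists (j :: i :: b'), (crossingS j (crossingS i t)).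
  exists (crossing0 b' p); split=> //; first by left; apply: base.
  by move=> phi psi hphi hpsi f; apply: cmap_comm.
have [h20|h2] := posnP (height s2).
  pose Q v1 u (s2 : crossing u (k :: v1)) :=
    forall s1 : crossing v1 w, (0 < height s1)%N ->
    exists v2 (s2' : crossing v2 (k :: w)) (s1' : crossing u v2),
    [/\ height s2' = 0%N, height s1' = (height s1).+1,
        far_sym (dcross (crossingS k s1) (cdiag s2)) (dcross s2' (cdiag s1')) &
        forall phi psi, (forall i j, klinear (@phi i j)) ->
          (forall i j, klinear (@psi i j)) -> forall f,
          cmap phi (crossingS k s1) (cmap psi s2 f) =
          cmap psi s2' (cmap phi s1' f)].
  have h1 : (0 < height s1)%N by move: hf; rewrite /farl /= h20; lia.
  rewrite h20; apply: (_ : Q v1 u s2) => //.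
  apply: (crossing_top_0 (P := Q)) h20 => j b p t ht.
  pose Q2 w (s1 : crossing (j :: b) w) :=
    exists v2 (s2' : crossing v2 (k :: w)) (s1' : crossing (j :: k :: b) v2),
    [/\ height s2' = 0%N, height s1' = (height s1).+1,
        far_sym (dcross (crossingS k s1) (cdiag (crossing0 b p)))
          (dcross s2' (cdiag s1')) &
        forall phi psi, (forall i j, klinear (@phi i j)) ->
          (forall i j, klinear (@psi i j)) -> forall f,
          cmap phi (crossingS k s1) (cmap psi (crossing0 b p) f) =
          cmap psi s2' (cmap phi s1' f)].
  apply: (crossing_bot_S (P := Q2)) ht => b' t'.
  exists (j :: k :: b'), (crossing0 b' p), (crossingS j (crossingS k t')).
  split=> //; first by right; apply: base.
  by move=> phi psi hphi hpsi f; rewrite (cmap_comm p).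
have hf' : farl (height s1) (height s2).-1 by move: hf; rewrite /farl /=; lia.
pose Q u (s2 : crossing u (k :: v1)) := farl (height s1) (height s2).-1 ->
    exists v2 (s2' : crossing v2 (k :: w)) (s1' : crossing u v2),
    [/\ height s2' = height s2, height s1' = (height s1).+1,
        far_sym (dcross (crossingS k s1) (cdiag s2)) (dcross s2' (cdiag s1')) &
        forall phi psi, (forall i j, klinear (@phi i j)) ->
          (forall i j, klinear (@psi i j)) -> forall f,
          cmap phi (crossingS k s1) (cmap psi s2 f) =
          cmap psi s2' (cmap phi s1' f)].
apply: (crossing_top_S (P := Q)) h2 hf' => u' s' hf'.
have [v2 [s2' [s1' [e2 e1 hfar hc]]]] := ih _ s' hf'.
exists (k :: v2), (crossingS k s2'), (crossingS k s1'); split=> /=.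
- by rewrite e2.
- by rewrite e1.
- exact: (far_sym_shift1 k hfar).
move=> phi psi hphi hpsi f; elim/tens_ind: f => [|x y ex ey|r f].
- by rewrite !tmapr0 //; apply: cmap_klin.
- by rewrite !tmaprD ?ex ?ey //; apply: cmap_klin.
by rewrite !tmapr_pure ?hc //; apply: cmap_klin.
Qed.

End Diag.

(** * Families of dots *)

Section DotFamilies.
Variables (kk : comPzRingType) (H : heckeData kk).
Local Notation I := (color H).
Local Notation Rw := (dots (@dotalg kk H)).

Definition dotfam := forall w : seq I, Rw w.
HB.instance Definition _ := gen_eqMixin dotfam.
HB.instance Definition _ := gen_choiceMixin dotfam.

Lemma dotfamP (f g : dotfam) : (forall w, f w = g w) -> f = g.
Proof. exact: functional_extensionality_dep. Qed.

Let add (f g : dotfam) : dotfam := fun w => f w + g w.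
Let opp (f : dotfam) : dotfam := fun w => - f w.
Let mul (f g : dotfam) : dotfam := fun w => f w * g w.
Fact addA : associative add.
Proof. by move=> f g h; apply: dotfamP => w; apply: addrA. Qed.
Fact addC : commutative add.
Proof. by move=> f g; apply: dotfamP => w; apply: addrC. Qed.
Fact add0 : left_id (fun w => 0 : Rw w) add.
Proof. by move=> f; apply: dotfamP => w; apply: add0r. Qed.
Fact addN : left_inverse (fun w => 0 : Rw w) opp add.
Proof. by move=> f; apply: dotfamP => w; apply: addNr. Qed.
HB.instance Definition _ := GRing.isZmodule.Build dotfam addA addC add0 addN.
Fact mulA : associative mul.
Proof. by move=> f g h; apply: dotfamP => w; apply: mulrA. Qed.
Fact mulC : commutative mul.
Proof. by move=> f g; apply: dotfamP => w; apply: mulrC. Qed.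
Fact mul1 : left_id (fun w => 1 : Rw w) mul.
Proof. by move=> f; apply: dotfamP => w; apply: mul1r. Qed.
Fact mulDl : left_distributive mul +%R.
Proof. by move=> f g h; apply: dotfamP => w; apply: mulrDl. Qed.
HB.instance Definition _ :=
  GRing.Zmodule_isComPzRing.Build dotfam mulA mulC mul1 mulDl.

Lemma famD (f g : dotfam) w : (f + g) w = f w + g w. Proof. by []. Qed.
Lemma famM (f g : dotfam) w : (f * g) w = f w * g w. Proof. by []. Qed.
Lemma fam0 w : (0 : dotfam) w = 0. Proof. by []. Qed.
Lemma fam1 w : (1 : dotfam) w = 1. Proof. by []. Qed.

End DotFamilies.

Section Moves.
Variables (kk : comPzRingType) (H : heckeData kk).
Local Notation I := (color H).
Local Notation Rw := (dots (@dotalg kk H)).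
Local Notation crossing := (@crossing kk H).
Local Notation K := (dotfam H).

(** A crossing is determined by its height and its top word; there is none if the
    colors do not permit it. *)
Fixpoint pos (j : nat) (w : seq I) {struct w} : option {v & crossing v w} :=
  match w with
  | [::] => None
  | x :: w' =>
    match j with
    | 0 =>
      match w' with
      | [::] => None
      | y :: b =>
        if @idP (permitted y x) is ReflectT p
        then Some (existT (fun v => crossing v (x :: y :: b)) (y :: x :: b) (crossing0 b p))
        else None
      end
    | j'.+1 =>
      if pos j' w' is Some (existT v s)
      then Some (existT (fun v => crossing v (x :: w')) (x :: v) (crossingS x s)) else None
    end
  end.

Lemma pos_height v w (s : crossing v w) :
  pos (height s) w = Some (existT (fun v => crossing v w) v s).
Proof.
elim: s => {v w} [i j b p|k v w s ih] /=; last by rewrite ih.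
by case: {-}_ / idP => // p'; rewrite (bool_irrelevance p' p).
Qed.
Lemma pos_Some j w :
  if pos j w is Some (existT v s) then height s = j else True.
Proof.
elim: w j => [|x w ih] [|j] //=.
  by case: w ih => // y b _; case: {-}_ / idP.
by case: (pos j w) (ih j) => [[v s]|] //= ->.
Qed.

Lemma posP j w : (exists v (s : crossing v w), height s = j) \/ pos j w = None.
Proof.
by case e: (pos j w) (pos_Some j w) => [[v s]|] // h; [left; exists v, s|right].
Qed.

Section Act.
Variable phi2 : forall i j : I, Rw [:: i; j] -> Rw [:: j; i].
Hypothesis hphi : forall i j, klinear (@phi2 i j).

Definition famact (j : nat) (f : K) : K := fun w =>
  if pos j w is Some (existT v s) then cmap phi2 s (f v) else 0.

Lemma famactE v w (s : crossing v w) (f : K) :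
  famact (height s) f w = cmap phi2 s (f v).
Proof. by rewrite /famact pos_height. Qed.
Lemma famact_None j w (f : K) : pos j w = None -> famact j f w = 0.
Proof. by rewrite /famact => ->. Qed.
Lemma famactD j f g : famact j (f + g) = famact j f + famact j g.
Proof.
apply: dotfamP => w; rewrite famD.
have [[v [s <-]]|e] := posP j w; last by rewrite !famact_None ?addr0.
by rewrite !famactE famD (cmap_klin hphi s).1.
Qed.

Definition shK (f : K) : K := fun w =>
  match w with [::] => f [::] | k :: w' => tpure 1 (f w') end.

Lemma famact_sh j f : famact j.+1 (shK f) = shK (famact j f).
Proof.
apply: dotfamP => -[|k w]; first by [].
have [[v [s e]]|e] := posP j w; last first.
  have e' : pos j.+1 (k :: w) = None by rewrite /= e.
  rewrite (famact_None _ e') /shK (famact_None _ e).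
  apply: esym; exact: (additive0 (fun x y => @tpureDr kk (dotalg k) (Rw w) 1 x y)).
by rewrite /= -e -[(height s).+1]/(height (crossingS k s)) !famactE cmap_S.
Qed.
End Act.

Lemma famact_comm (phi psi : forall i j : I, Rw [:: i; j] -> Rw [:: j; i]) i j f :
  (forall i j, klinear (@phi i j)) -> (forall i j, klinear (@psi i j)) ->
  farl i j -> famact phi i (famact psi j f) = famact psi j (famact phi i f).
Proof.
move=> hphi hpsi hij.
have half (phi' psi' : forall i j : I, Rw [:: i; j] -> Rw [:: j; i]) i' j' w :
    (forall i j, klinear (@phi' i j)) -> (forall i j, klinear (@psi' i j)) ->
    farl i' j' -> (exists v1 (s1 : crossing v1 w) u (s2 : crossing u v1),
      height s1 = i' /\ height s2 = j') ->
    famact phi' i' (famact psi' j' f) w = famact psi' j' (famact phi' i' f) w.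
  move=> h h' hij' [v1 [s1 [u [s2 [e1 e2]]]]]; subst i' j'.
  have [v2 [s2' [s1' [h2 h1 _ hc]]]] := far_square hij'.
  by rewrite famactE famactE -h2 famactE -h1 famactE hc.
have zero (phi' psi' : forall i j : I, Rw [:: i; j] -> Rw [:: j; i]) i' j' w :
    (forall i j, klinear (@phi' i j)) ->
    ~ (exists v1 (s1 : crossing v1 w) u (s2 : crossing u v1),
      height s1 = i' /\ height s2 = j') ->
    famact phi' i' (famact psi' j' f) w = 0.
  move=> h' hn; have [[v [s e]]|e] := posP i' w; last by rewrite famact_None.
  rewrite -e famactE; have [[u [s2 e2]]|e2] := posP j' v.
    by case: hn; exists v, s, u, s2.
  by rewrite famact_None // (cmap0 h').
apply: dotfamP => w.
case: (pselect (exists v1 (s1 : crossing v1 w) u (s2 : crossing u v1),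
      height s1 = i /\ height s2 = j)) => h1; first exact: half.
case: (pselect (exists v1 (s1 : crossing v1 w) u (s2 : crossing u v1),
      height s1 = j /\ height s2 = i)) => h2.
  by apply/esym/half => //; rewrite /farl orbC.
by rewrite !zero.
Qed.

(** The map of dots for the term of the dot-moving relation without crossing,
    made uniform in the colors. *)
Definition del2 (i j : I) (f : Rw [:: i; j]) : Rw [:: j; i] :=
  castw [:: j; i] (del H i (castw [:: i; i] f)).

Lemma del2_klin i j : klinear (@del2 i j).
Proof.
have [gD gZ] := del_linear i.
have [cD cZ] := castw_klin (dotalg (h := H)) [:: i; j] [:: i; i].
have [dD dZ] := castw_klin (dotalg (h := H)) [:: i; i] [:: j; i].
by split=> [x y|c x]; rewrite /del2 ?cD ?gD ?dD // cZ gZ dZ.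
Qed.
Lemma del2_id i : @del2 i i =1 del H i.
Proof. by move=> f; rewrite /del2 !castw_id. Qed.
Lemma del2_neq i j (f : Rw [:: i; j]) : i != j -> del2 f = 0.
Proof.
move=> ne; rewrite /del2 castw_neq //.
by apply: contra ne => /eqP[->].
Qed.

(** The twist and the twisted derivation on families of dots: the value at a top
    word w comes from the value at the bottom word, and is zero if the crossing
    is not permitted. *)
Definition mvK := famact (phi H).
Definition dlK := famact del2.

Fixpoint swapw (j : nat) (w : seq I) {struct w} : option (seq I) :=
  match w, j with
  | x :: y :: b, 0 => if permitted y x then Some (y :: x :: b) else None
  | x :: w', j'.+1 => omap (cons x) (swapw j' w')
  | _, _ => None
  end.

Lemma swapw_pos j w : swapw j w = omap (@projT1 _ (fun v => crossing v w)) (pos j w).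
Proof.
elim: w j => [|x w ih] [|j] //=.
  case: w ih => // y b _; case: {-}_ / idP => [p|/negP p] //=; first by rewrite p.
  by rewrite (negbTE p).
case: w ih => [|y b] ih; first by case: j.
by rewrite (ih j); case: (pos j _) => [[v s]|].
Qed.

Definition ind (P : pred (seq I)) : K := fun w => (P w)%:R.
Definition mvP (j : nat) (P : pred (seq I)) : pred (seq I) :=
  fun w => if swapw j w is Some v then P v else false.
Definition mvPw (e : word) (P : pred (seq I)) : pred (seq I) := foldr mvP P e.

Lemma mvP_S j P k w : mvP j.+1 P (k :: w) = mvP j (fun w => P (k :: w)) w.
Proof. by rewrite /mvP /=; case: (swapw j w); case: w. Qed.
Lemma mvPw_S j e P k w :
  mvPw (shw j.+1 e) P (k :: w) = mvPw (shw j e) (fun w => P (k :: w)) w.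
Proof.
elim: e w => //= i e ih w; rewrite mvP_S /mvP.
by case: (swapw (j + i) w) => // v; rewrite ih.
Qed.

End Moves.

Section System.
Variables (kk : comPzRingType) (H : heckeData kk).
Local Notation I := (color H).
Local Notation Rw := (dots (@dotalg kk H)).
Local Notation crossing := (@crossing kk H).
Local Notation K := (dotfam H).

(** What the ambiguity sfg amounts to. *)
Record dot_axioms : Prop := DotAxioms {
  phi_mul : forall i j, permitted i j -> forall f g : Rw [:: i; j],
    phi H i j (f * g) = phi H i j f * phi H i j g;
  phi_one : forall i j : I, permitted i j -> phi H i j 1 = 1;
  del_mul : forall i, permitted i i -> forall f g : Rw [:: i; i],
    del H i (f * g) = phi H i i f * del H i g + del H i f * g;
  del_one : forall i : I, permitted i i -> del H i 1 = 0 }.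

Hypothesis hH : dot_axioms.
Let kphi (i j : I) : klinear (phi H i j) := phi_linear i j.
Let kdel (i j : I) : klinear (@del2 _ H i j) := @del2_klin _ H i j.

Lemma cphiM v w (s : crossing v w) f g :
  cmap (phi H) s (f * g) = cmap (phi H) s f * cmap (phi H) s g.
Proof.
elim: s f g => {v w} [i j b p|k v w s ih] f g.
  apply: (@text0M kk I _ b [:: i; j] [:: j; i]) => //.
  by move=> x y; apply: phi_mul.
by apply: tmaprM => //; apply: cmap_klin.
Qed.
Lemma cphi1 v w (s : crossing v w) : cmap (phi H) s 1 = 1.
Proof.
elim: s => {v w} [i j b p|k v w s ih].
  have -> : (1 : Rw (i :: j :: b)) = tcat (1 : Rw [:: i; j]) (1 : Rw b).
    by rewrite tcat1.
  by rewrite cmap_crossing0 // phi_one //; apply: (@tcat1 kk I _ [:: j; i] b).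
by rewrite -[1 : Rw (k :: v)]/(tpure 1 1) cmap_S // ih.
Qed.
Lemma cdelM v w (s : crossing v w) f g :
  cmap (@del2 kk H) s (f * g) =
  cmap (phi H) s f * cmap (@del2 kk H) s g + cmap (@del2 kk H) s f * castw w g.
Proof.
elim: s f g => {v w} [i j b p|k v w s ih] f g.
  elim/(@gen_ind kk I (@dotalg kk H) [:: i; j] b): f => [|x y ex ey|x h].
  - by rewrite mul0r !cmap0 // !mul0r addr0.
  - rewrite mulrDl !(cmap_klin _ _).1 // ex ey !mulrDl.
    by rewrite -!addrA; congr (_ + _); rewrite addrCA.
  elim/(@gen_ind kk I (@dotalg kk H) [:: i; j] b): g => [|y z ey ez|y h'].
  - by rewrite mulr0 !cmap0 // (klinear0 (castw_klin _ _ _)) !mulr0 addr0.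
  - rewrite mulrDr !(cmap_klin _ _).1 // (castw_klin _ _ _).1 ey ez !mulrDr.
    by rewrite addrACA.
  have -> : castw (j :: i :: b) (tcat y h' : Rw (i :: j :: b)) =
      tcat (castw [:: j; i] y) h'.
    exact: (@castw_tcat kk I (@dotalg kk H) [:: i; j] [:: j; i] b y h').
  have -> : (tcat x h : Rw (i :: j :: b)) * tcat y h' = tcat (x * y) (h * h').
    exact: (@tcatM kk I (@dotalg kk H) [:: i; j] b x y h h').
  rewrite !cmap_crossing0 //.
  have e : del2 (x * y) = phi H i j x * del2 y + del2 x * castw [:: j; i] y.
    have [ij|ne] := eqVneq i j; last first.
      by rewrite !del2_neq // mulr0 mul0r addr0.
    by subst j; rewrite !del2_id castw_id del_mul.
  rewrite e tcatDl; congr (_ + _); apply/esym;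
    exact: (@tcatM kk I (@dotalg kk H) [:: j; i] b).
elim/tens_ind: f => [|x y ex ey|r f].
- by rewrite mul0r !cmap0 // !mul0r addr0.
- rewrite mulrDl !(cmap_klin _ _).1 // ex ey !mulrDl.
  by rewrite -!addrA; congr (_ + _); rewrite addrCA.
elim/tens_ind: g => [|y z ey ez|r' g].
- by rewrite mulr0 !cmap0 // (klinear0 (castw_klin _ _ _)) !mulr0 addr0.
- rewrite mulrDr !(cmap_klin _ _).1 // (castw_klin _ _ _).1 ey ez !mulrDr.
  by rewrite addrACA.
rewrite castw_cons [(tpure r f : Rw (k :: v)) * _]tmul_pure !cmap_S // ih.
by rewrite [X in _ = X + _]tmul_pure [X in _ = _ + X]tmul_pure -tpureDr.
Qed.
Lemma cdel1 v w (s : crossing v w) : cmap (@del2 kk H) s 1 = 0.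
Proof.
elim: s => {v w} [i j b p|k v w s ih].
  have -> : (1 : Rw (i :: j :: b)) = tcat (1 : Rw [:: i; j]) (1 : Rw b).
    by rewrite tcat1.
  rewrite cmap_crossing0 //; have [ij|ne] := eqVneq i j.
    by subst j; rewrite del2_id del_one // tcat0l.
  by rewrite del2_neq // tcat0l.
rewrite -[1 : Rw (k :: v)]/(tpure 1 1) cmap_S // ih.
exact: (additive0 (fun x y => @tpureDr kk (dotalg k) (Rw w) 1 x y)).
Qed.

Lemma cdel_neq v w (s : crossing v w) f : v != w -> cmap (@del2 kk H) s f = 0.
Proof.
elim: s f => {v w} [i j b p|k v w s ih] f ne.
  elim/(@gen_ind kk I (@dotalg kk H) [:: i; j] b): f => [|x y ex ey|x h].
  - by rewrite cmap0.
  - by rewrite (cmap_klin _ _).1 // ex ey addr0.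
  rewrite cmap_crossing0 // del2_neq ?tcat0l //.
  by apply: contra ne => /eqP->.
elim/tens_ind: f => [|x y ex ey|r f].
- by rewrite cmap0.
- by rewrite (cmap_klin _ _).1 // ex ey addr0.
rewrite cmap_S // ih; last by apply: contra ne => /eqP->.
exact: (additive0 (fun x y => @tpureDr kk (dotalg k) (Rw w) r x y)).
Qed.

Lemma mvKM j (f g : K) : mvK j (f * g) = mvK j f * mvK j g.
Proof.
apply: dotfamP => w; rewrite famM.
have [[v [s <-]]|e] := posP j w; last by rewrite /mvK !famact_None // mulr0.
by rewrite /mvK !famactE famM cphiM.
Qed.
Lemma dlKM j (f g : K) : dlK j (f * g) = mvK j f * dlK j g + dlK j f * g.
Proof.
apply: dotfamP => w; rewrite famD !famM.
have [[v [s <-]]|e] := posP j w; last first.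
  by rewrite /mvK /dlK !famact_None // !mul0r addr0.
rewrite /mvK /dlK !famactE famM cdelM; congr (_ + _).
have [vw|ne] := eqVneq v w; first by rewrite (castw_fam g vw).
by rewrite cdel_neq // !mul0r.
Qed.

Lemma mvK_ind j P : mvK j (@ind kk H P) = @ind kk H (mvP j P).
Proof.
apply: dotfamP => w; rewrite /mvK /ind /mvP swapw_pos.
have [[v [s <-]]|e] := posP j w; last by rewrite famact_None // e.
rewrite famactE pos_height /=; case: (P v); first exact: cphi1.
exact: (cmap0 kphi).
Qed.
Lemma dlK_ind j P : dlK j (@ind kk H P) = 0.
Proof.
apply: dotfamP => w; rewrite /dlK fam0 /ind.
have [[v [s <-]]|e] := posP j w; last by rewrite famact_None.
by rewrite famactE; case: (P v); [apply: cdel1|apply: (cmap0 kdel)].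
Qed.
Lemma mvKw_ind e P : foldr (@mvK kk H) (@ind kk H P) e = @ind kk H (mvPw e P).
Proof. by elim: e => //= j e ->; rewrite mvK_ind. Qed.
Lemma ind1 : (1 : K) = @ind kk H predT.
Proof. by apply: dotfamP. Qed.

Lemma shK2E f x y b :
  shK (shK f) (x :: y :: b) = @tcat kk I _ [:: x; y] b 1 (f b).
Proof. by rewrite !tcat1_cons tcat1_nil. Qed.
Lemma mvK_sh2 f : mvK 0 (shK (shK f)) = shK (shK f) * mvK 0 1 :> K.
Proof.
apply: dotfamP => w; rewrite famM.
have [[v [s e]]|e] := posP 0 w; last by rewrite /mvK !famact_None // mulr0.
rewrite /mvK -e !famactE fam1 cphi1 mulr1.
case: s e => {v w} // i j b p _.
by rewrite !shK2E cmap_crossing0 // phi_one.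
Qed.
Lemma dlK_sh2 f : dlK 0 (shK (shK f)) = 0 :> K.
Proof.
apply: dotfamP => w.
have [[v [s e]]|e] := posP 0 w; last by rewrite /dlK famact_None.
rewrite /dlK -e !famactE; case: s e => {v w} // i j b p _.
rewrite shK2E cmap_crossing0 //; have [ij|ne] := eqVneq i j.
  by subst j; rewrite del2_id del_one // tcat0l.
by rewrite del2_neq // tcat0l.
Qed.

Definition coef2 (g : forall x y : I, Rw [:: x; y]) : K := fun w =>
  match w with
  | x :: y :: b =>
      if permitted y x && permitted x y
      then @tcat kk I _ [:: x; y] b (g x y) 1 else 0
  | _ => 0
  end.
Definition coef3 (g : forall x y z : I, Rw [:: x; y; z]) : K := fun w =>
  match w with
  | x :: y :: z :: b =>
      if [&& permitted z y, permitted z x & permitted y x]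
      then @tcat kk I _ [:: x; y; z] b (g x y z) 1 else 0
  | _ => 0
  end.
Definition iii (x y z : I) (g : forall i : I, Rw [:: i; i; i]) : Rw [:: x; y; z] :=
  castw [:: x; y; z] (g x).

Definition coefA := coef2 (fun x y => castw [:: x; y] (@alpha kk H x)).
Definition coefB := coef2 (fun x y =>
  if x == y then castw [:: x; y] (@beta kk H x) else quad x y).
Definition coefLam := coef3 (fun x y z => scal (Rw [:: x; y; z]) (lam x y z)).
Definition coefa := coef3 (fun x y z =>
  if x == y then iii x y z (@braid_a kk H)
  else castw [:: x; y; z] (braid_pjii x y)).
Definition coefb := coef3 (fun x y z =>
  if x == z then iii x y z (@braid_b kk H)
  else castw [:: x; y; z] (braid_piij x z)).
Definition coefc := coef3 (fun x y z => iii x y z (@braid_c kk H)).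
Definition coefd := coef3 (fun x y z => iii x y z (@braid_d kk H)).
Definition coefe := coef3 (fun x y z =>
  if x == y then iii x y z (@braid_e kk H)
  else castw [:: x; y; z] (braid_q x y)).

Definition rhsK (q : bool) : seq (K * word) :=
  if q then [:: (coefLam, [:: 1; 0; 1]); (coefa, [:: 0; 1]); (coefb, [:: 1; 0]);
                (coefc, [:: 0]); (coefd, [:: 1]); (coefe, [::])]%N
  else [:: (coefA, [:: 0]); (coefB, [::])]%N.

Lemma coef2_far g i : (1 < i)%N ->
  mvK i (coef2 g) = coef2 g * mvK i 1 /\ dlK i (coef2 g) = 0.
Proof.
case: i => [|[|i]] // _.
have e x y b : coef2 g (x :: y :: b) = @tcat kk I _ [:: x; y] b
    (if permitted y x && permitted x y then g x y else 0) 1.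
  by rewrite /coef2; case: ifP => // _; rewrite tcat0l.
split; apply: dotfamP => w; rewrite ?famM /mvK /dlK.
  have [[v [s hs]]|en] := posP i.+2 w; last by rewrite !famact_None // mulr0.
  rewrite -hs !famactE fam1 cphi1 mulr1.
  case: s hs => // x v' w' [] // y v'' w'' s _; rewrite !e.
  have -> := @cmap_cshift kk H _ kphi [:: x; y] _ _ s (if permitted y x && permitted x y then g x y else 0) 1.
  by rewrite cphi1.
have [[v [s hs]]|en] := posP i.+2 w; last by rewrite !famact_None.
rewrite -hs !famactE.
case: s hs => // x v' w' [] // y v'' w'' s _; rewrite !e.
have -> := @cmap_cshift kk H _ kdel [:: x; y] _ _ s (if permitted y x && permitted x y then g x y else 0) 1.
by rewrite cdel1 tcat0r.
Qed.

Lemma coef3_far g i : (2 < i)%N ->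
  mvK i (coef3 g) = coef3 g * mvK i 1 /\ dlK i (coef3 g) = 0.
Proof.
case: i => [|[|[|i]]] // _.
pose g' x y z := if [&& permitted z y, permitted z x & permitted y x] then g x y z else 0.
have e x y z b : coef3 g (x :: y :: z :: b) = @tcat kk I _ [:: x; y; z] b
    (g' x y z) 1.
  by rewrite /coef3 /g'; case: ifP => // _; rewrite tcat0l.
split; apply: dotfamP => w; rewrite ?famM /mvK /dlK.
  have [[v [s hs]]|en] := posP i.+3 w; last by rewrite !famact_None // mulr0.
  rewrite -hs !famactE fam1 cphi1 mulr1.
  case: s hs => // x v' w' [] // y v'' w'' [] // z v3 w3 s _; rewrite !e.
  have -> := @cmap_cshift kk H _ kphi [:: x; y; z] _ _ s (g' x y z) 1.
  by rewrite cphi1.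
have [[v [s hs]]|en] := posP i.+3 w; last by rewrite !famact_None.
rewrite -hs !famactE.
case: s hs => // x v' w' [] // y v'' w'' [] // z v3 w3 s _; rewrite !e.
have -> := @cmap_cshift kk H _ kdel [:: x; y; z] _ _ s (g' x y z) 1.
by rewrite cdel1 tcat0r.
Qed.

End System.

Section System.
Variables (kk : comPzRingType) (H : heckeData kk).
Local Notation I := (color H).
Local Notation Rw := (dots (@dotalg kk H)).
Local Notation K := (dotfam H).
Hypothesis hH : dot_axioms H.

Definition idemK (u : K) : Prop := exists P, u = ind P.

Lemma shKD (f g : K) : shK (f + g) = shK f + shK g.
Proof.
by apply: dotfamP => -[|k w] //=; apply: (@tpureDr kk (dotalg k) (Rw w)).
Qed.
Lemma shKM (f g : K) : shK (f * g) = shK f * shK g.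
Proof.
apply: dotfamP => -[|k w] //=; rewrite famM [RHS]tmul_pure mul1r.
by [].
Qed.
Lemma shK1 : shK (1 : K) = 1.
Proof. by apply: dotfamP => -[|k w]. Qed.

Lemma supp_shift (c : K) (e1 e2 : word) :
  (forall P w, c w * (mvPw e1 P w)%:R = c w * (mvPw e2 P w)%:R) ->
  c [::] = 0 -> forall j P w,
  iter j (@shK kk H) c w * (mvPw (shw j e1) P w)%:R =
  iter j (@shK kk H) c w * (mvPw (shw j e2) P w)%:R.
Proof.
move=> h c0; elim=> [|j ih] P w; first by rewrite /shw !map_id.
case: w => [|k w].
  have -> : iter j.+1 (@shK kk H) c [::] = 0 by elim: j {ih} => //= j ->.
  by rewrite !mul0r.
rewrite !mvPw_S /=; have natE (b : bool) :
    (b%:R : Rw (k :: w)) = tpure 1 (b%:R : Rw w).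
  case: b => //=; apply/esym.
  exact: (additive0 (fun x y => @tpureDr kk (dotalg k) (Rw w) 1 x y)).
by rewrite !natE ![_ * tpure 1 _]tmul_pure ih.
Qed.

Lemma coef2_supp g (e1 e2 : word) :
  (forall P x y b, permitted y x -> permitted x y ->
     g x y * (mvPw e1 P (x :: y :: b))%:R =
     g x y * (mvPw e2 P (x :: y :: b))%:R) ->
  forall P w, @coef2 kk H g w * (mvPw e1 P w)%:R = coef2 g w * (mvPw e2 P w)%:R.
Proof.
move=> h P [|x [|y b]]; rewrite ?mul0r // /coef2.
case: ifP => [/andP[p1 p2]|_]; last by rewrite !mul0r.
have bE (t : bool) : (t%:R : Rw (x :: y :: b)) =
    @tcat kk I _ [:: x; y] b (t%:R) 1.
  by case: t; rewrite ?tcat0l // (@tcat1 kk I _ [:: x; y] b).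
have tM u v := @tcatM kk I (@dotalg kk H) [:: x; y] b u v 1 1.
by rewrite !bE (tM (g x y)) (tM (g x y)) h.
Qed.
Lemma coef3_supp g (e1 e2 : word) :
  (forall P x y z b, permitted z y -> permitted z x -> permitted y x ->
     g x y z * (mvPw e1 P [:: x, y, z & b])%:R =
     g x y z * (mvPw e2 P [:: x, y, z & b])%:R) ->
  forall P w, @coef3 kk H g w * (mvPw e1 P w)%:R = coef3 g w * (mvPw e2 P w)%:R.
Proof.
move=> h P [|x [|y [|z b]]]; rewrite ?mul0r // /coef3.
case: ifP => [/and3P[p1 p2 p3]|_]; last by rewrite !mul0r.
have bE (t : bool) : (t%:R : Rw [:: x, y, z & b]) =
    @tcat kk I _ [:: x; y; z] b (t%:R) 1.
  by case: t; rewrite ?tcat0l // (@tcat1 kk I _ [:: x; y; z] b).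
have tM u v := @tcatM kk I (@dotalg kk H) [:: x; y; z] b u v 1 1.
by rewrite !bE (tM (g x y z)) (tM (g x y z)) h.
Qed.

Lemma iii_supp (g : forall i : I, Rw [:: i; i; i]) (x y z : I) (b1 b2 : bool) :
  (x = y -> x = z -> b1 = b2) -> iii x y z g * b1%:R = iii x y z g * b2%:R.
Proof.
move=> h; rewrite /iii; have [e|ne] := eqVneq [:: x; x; x] [:: x; y; z].
  by case: e => e1 e2; rewrite h.
by rewrite castw_neq // !mul0r.
Qed.

Lemma rhsK_supp q p : p \in rhsK H q ->
  p.1 [::] = 0 /\ forall P w,
  p.1 w * (mvPw (lhs q) P w)%:R = p.1 w * (mvPw p.2 P w)%:R.
Proof.
case: q; rewrite !inE; last first.
  case/orP => /eqP ->; split=> //; apply: coef2_supp => P x y b p1 p2;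
    rewrite /= /mvP /= p1 /= p2 //.
  have [e|ne] := eqVneq x y; first by rewrite -e.
  by rewrite castw_neq ?mul0r //; apply: contra ne => /eqP[->].
case/or4P => [| | |/or3P[]] /eqP ->; split=> //;
  apply: coef3_supp => P x y z b p1 p2 p3;
  rewrite /= /mvP /=; do 3? rewrite ?p1 ?p2 ?p3 /=; rewrite //.
- have [e|ne] := eqVneq x y; first by subst y; apply: iii_supp => _ <-.
  have [e|ne'] := eqVneq y z; first by subst z.
  by rewrite castw_neq ?mul0r //; apply: contra ne' => /eqP[->].
- have [e|ne] := eqVneq x z; first by subst z; apply: iii_supp => <- _.
  have [e|ne'] := eqVneq x y; first by subst y.
  by rewrite castw_neq ?mul0r //; apply: contra ne' => /eqP[->].
- by apply: iii_supp => <- <-.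
- by apply: iii_supp => <- <-.
have [e|ne] := eqVneq x y; first by subst y; apply: iii_supp => _ <-.
have [e|ne'] := eqVneq x z; first by subst z.
by rewrite castw_neq ?mul0r //; apply: contra ne' => /eqP[->].
Qed.

Lemma iter_shK_fam j (c : K) (P : pred (seq I)) w :
  iter j (@shK kk H) c w * (P w)%:R = (iter j (@shK kk H) c * ind P : K) w.
Proof. by []. Qed.

(** The families of dots as an abstract system of dots. *)
Definition dotsys : dotSystem.
Proof.
refine (@DotSystem K (@mvK kk H) (@dlK kk H) (@shK kk H) idemK (rhsK H)
  _ _ _ _ _ _ _ _ _ _ _ _ _ _ _ _ _ _ _ _ _ _).
- by move=> j f g; apply: famactD => i k; apply: phi_linear.
- by move=> j f g; apply: famactD => i k; apply: del2_klin.
- exact: shKD.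
- exact: mvKM.
- exact: dlKM.
- exact: shKM.
- exact: shK1.
- by move=> j f; apply: famact_sh => i k; apply: phi_linear.
- by move=> j f; apply: famact_sh => i k; apply: del2_klin.
- move=> i j f ij; apply: famact_comm; try exact: phi_linear.
  by rewrite /farl ij.
- move=> i j f ij; apply: famact_comm; rewrite /farl ?ij //; try exact: phi_linear.
  exact: del2_klin.
- move=> i j f ij; apply: famact_comm; rewrite /farl ?ij //; try exact: phi_linear.
  exact: del2_klin.
- by move=> i j f ij; apply: famact_comm; rewrite /farl ?ij //; exact: del2_klin.
- exact: mvK_sh2.
- exact: dlK_sh2.
- by exists predT; apply: ind1.
- by move=> j u [P ->]; exists (mvP j P); apply: mvK_ind.
- move=> u [P ->]; apply: dotfamP => w; rewrite famM /ind.
  by case: (P w); rewrite ?mulr1 ?mulr0.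
- by move=> j u [P ->]; apply: dlK_ind.
- by case.
- case=> p i; rewrite !inE.
    by case/or4P => [| | |/or3P[]] /eqP -> hi; apply: coef3_far.
  by case/orP => /eqP -> hi; apply: coef2_far.
- move=> q p j u pq [P ->]; have [h0 h] := rhsK_supp pq.
  rewrite !mvKw_ind //; apply: dotfamP => w.
  by have := supp_shift h h0 j P w; rewrite !iter_shK_fam.
Defined.

End System.
Arguments dotsys : simpl never.

(** * Dots on a group of strands *)

Section Pads.
Variables (kk : comPzRingType) (H : heckeData kk).
Local Notation I := (color H).
Local Notation Rw := (dots (@dotalg kk H)).
Local Notation crossing := (@crossing kk H).
Local Notation K := (dotfam H).

(** The family of dots f on the first strands, for the words that start
    with v. *)
Definition pad v (f : Rw v) : K := fun w =>
  castw w (tcat f (1 : Rw (drop (size v) w))).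

Lemma pad_cat v b (f : Rw v) : pad f (v ++ b) = tcat f (1 : Rw b).
Proof.
rewrite /pad; move: (drop _ _) (drop_size_cat b (erefl (size v))) => b' e.
by subst b'; rewrite castw_id.
Qed.
Lemma pad_neq v w (f : Rw v) : (forall b, w <> v ++ b) -> pad f w = 0.
Proof. by move=> h; rewrite /pad castw_neq //; apply/eqP => e; apply: (h _ (esym e)). Qed.
Lemma prefixP' (v w : seq I) : (exists b, w = v ++ b) \/ (forall b, w <> v ++ b).
Proof.
case: (pselect (exists b, w = v ++ b)) => h; [by left|right => b e].
by apply: h; exists b.
Qed.

Lemma padD v (f g : Rw v) : pad (f + g) = pad f + pad g.
Proof.
apply: dotfamP => w; rewrite famD.
have [[b ->]|h] := prefixP' v w; first by rewrite !pad_cat tcatDl.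
by rewrite !pad_neq // addr0.
Qed.
Lemma pad0 v : pad (0 : Rw v) = 0.
Proof. exact: additive0 (@padD v). Qed.
Lemma padM v (f g : Rw v) : pad (f * g) = pad f * pad g.
Proof.
apply: dotfamP => w; rewrite famM.
have [[b ->]|h] := prefixP' v w; first by rewrite !pad_cat tcatM mulr1.
by rewrite !pad_neq // mulr0.
Qed.

Definition scalK (c : kk) : K := fun w => scal (Rw w) c.

Lemma pad_scal v c (f : Rw v) : pad (scal (Rw v) c * f) = scalK c * pad f.
Proof.
apply: dotfamP => w; rewrite famM /scalK.
have [[b ->]|h] := prefixP' v w; first by rewrite !pad_cat tcatZl.
by rewrite !pad_neq // mulr0.
Qed.
Lemma shK_scal c : shK (scalK c) = scalK c.
Proof.
apply: dotfamP => -[|k w] //; rewrite /scalK /=.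
by rewrite -[scal _ c]mulr1 -tpure_scal mulr1.
Qed.

Lemma pad_head k r w : pad (tpure r 1 : Rw [:: k]) (k :: w) = tpure r (1 : Rw w).
Proof. by have := @pad_cat [:: k] w (tpure r 1); rewrite tcat_pure tcat1_nil. Qed.

Lemma pad_cons k v r (f : Rw v) :
  pad (tpure r f : Rw (k :: v)) =
  pad (tpure r 1 : Rw [:: k]) * shK (pad f).
Proof.
apply: dotfamP => -[|k' w]; rewrite famM.
  by rewrite !pad_neq ?mul0r.
have [e|ne] := eqVneq k' k; last first.
  by rewrite !(@pad_neq (k :: _)) ?mul0r // => b [] /eqP; rewrite (negbTE ne).
subst k'; rewrite pad_head {1}/pad tcat_pure castw_cons.
by rewrite [RHS]tmul_pure mulr1 mul1r.
Qed.

Definition delta w (f : Rw w) : K := fun w' => castw w' f.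

Lemma delta_cons k w r (f : Rw w) :
  delta (tpure r f : Rw (k :: w)) =
  pad (tpure r 1 : Rw [:: k]) * shK (delta f).
Proof.
apply: dotfamP => -[|k' w']; rewrite famM.
  by rewrite pad_neq ?mul0r // /delta castw_neq.
have [e|ne] := eqVneq k' k; last first.
  rewrite pad_neq ?mul0r; last by move=> b [] /eqP; rewrite (negbTE ne).
  by rewrite /delta castw_neq //; apply: contra ne => /eqP[->].
subst k'; rewrite pad_head.
by rewrite /delta castw_cons [RHS]tmul_pure mulr1 mul1r.
Qed.
Lemma deltaD w (f g : Rw w) : delta (f + g) = delta f + delta g.
Proof. by apply: dotfamP => w'; rewrite famD /delta (castw_klin _ _ _).1. Qed.
Lemma delta0 w : delta (0 : Rw w) = 0.
Proof. exact: additive0 (@deltaD w). Qed.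
Lemma delta_id w (f : Rw w) : delta f w = f.
Proof. exact: castw_id. Qed.
Lemma delta_fam w (f : K) : delta (1 : Rw w) * f = delta (f w).
Proof.
apply: dotfamP => w'; rewrite famM /delta.
have [e|ne] := eqVneq w w'; last by rewrite !castw_neq // mul0r.
by subst w'; rewrite !castw_id mul1r.
Qed.
Lemma delta1 w : delta (1 : Rw w) = ind (pred1 w).
Proof.
apply: dotfamP => w'; rewrite /ind /delta /= eq_sym.
have [e|ne] := eqVneq w w'; last by rewrite castw_neq.
by subst w'; rewrite castw_id.
Qed.

Lemma shKn_M j (f g : K) :
  iter j (@shK kk H) (f * g) = iter j (@shK kk H) f * iter j (@shK kk H) g.
Proof. by elim: j => //= j ->; rewrite shKM. Qed.
Lemma shKn_D j (f g : K) :
  iter j (@shK kk H) (f + g) = iter j (@shK kk H) f + iter j (@shK kk H) g.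
Proof. by elim: j => //= j ->; rewrite shKD. Qed.

(** A dot concentrated at one coloring is the product of dots on three groups of
    strands, where only the middle one does not commute with the crossings of a
    relation. *)
Lemma delta_cat v w (g : Rw v) (f : Rw w) :
  delta (tcat g f) = pad g * iter (size v) (@shK kk H) (delta f).
Proof.
elim: v g => [|k v ih] g.
  apply: dotfamP => w'; rewrite famM; have -> := @pad_cat [::] w' g.
  by rewrite /= mulr1 /delta (castw_klin _ _ _).2.
elim/tens_ind: g => [|x y ex ey|r g].
- by rewrite tcat0l delta0 pad0 mul0r.
- by rewrite tcatDl deltaD ex ey padD mulrDl.
by rewrite tcat_pure delta_cons ih (pad_cons r g) /= shKM mulrA.
Qed.

(** The dots f on the strands p, p + 1, ..., for the colorings of the strands
    that have the word of f at this place.  In particular [padp p 1] selects the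
    colorings which contain a given word at place p. *)
Definition padp (p : nat) v (f : Rw v) : K := iter p (@shK kk H) (pad f).

Lemma padpD p v (f g : Rw v) : padp p (f + g) = padp p f + padp p g.
Proof. by rewrite /padp padD shKn_D. Qed.
Lemma padp0 p v : padp p (0 : Rw v) = 0.
Proof. exact: additive0 (@padpD p v). Qed.
Lemma padpM p v (f g : Rw v) : padp p (f * g) = padp p f * padp p g.
Proof. by rewrite /padp padM shKn_M. Qed.
Lemma padp_scal p v c (f : Rw v) :
  padp p (scal (Rw v) c * f) = scalK c * padp p f.
Proof.
rewrite /padp pad_scal shKn_M; congr (_ * _).
by elim: p => //= p ->; rewrite shK_scal.
Qed.
Lemma padp1 p a v b : size a = p -> padp p (1 : Rw v) (a ++ v ++ b) = 1.
Proof.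
move=> <-; rewrite /padp; elim: a => [|k a ih] /=.
  by rewrite pad_cat tcat1.
by rewrite ih.
Qed.

Fixpoint cpadr (b : seq I) v w (s : crossing v w) : crossing (v ++ b) (w ++ b) :=
  match s in Defs.crossing v w return crossing (v ++ b) (w ++ b) with
  | crossing0 i j b' p => crossing0 (b' ++ b) p
  | crossingS k v w s => crossingS k (cpadr b s)
  end.
Lemma height_cpadr b v w (s : crossing v w) : height (cpadr b s) = height s.
Proof. by elim: s => //= k v' w' s ->. Qed.

Lemma tcat_assoc1 i b b' (y : Rw [:: i]) (h : Rw b) (g : Rw b') :
  tcat (tcat y h : Rw (i :: b)) g = tcat y (tcat h g) :> Rw (i :: b ++ b').
Proof.
elim/tens_ind: y => [|x y ex ey|r c].
- by rewrite !tcat0l.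
- by rewrite !tcatDl ex ey.
by rewrite !tcat_pure /= tcatZl.
Qed.
Lemma tcat_assoc2 i j b b' (y : Rw [:: i; j]) (h : Rw b) (g : Rw b') :
  tcat (tcat y h : Rw (i :: j :: b)) g = tcat y (tcat h g) :> Rw (i :: j :: b ++ b').
Proof.
elim/tens_ind: y => [|x y ex ey|r c].
- by rewrite !tcat0l.
- by rewrite !tcatDl ex ey.
by rewrite !tcat_pure tcat_assoc1.
Qed.
Lemma tcat_assoc3 i j k b b' (y : Rw [:: i; j; k]) (h : Rw b) (g : Rw b') :
  tcat (tcat y h : Rw (i :: j :: k :: b)) g = tcat y (tcat h g)
  :> Rw (i :: j :: k :: b ++ b').
Proof.
elim/tens_ind: y => [|x y ex ey|r c].
- by rewrite !tcat0l.
- by rewrite !tcatDl ex ey.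
by rewrite !tcat_pure tcat_assoc2.
Qed.

Section ActPad.
Variable phi2 : forall i j : I, Rw [:: i; j] -> Rw [:: j; i].
Hypothesis hphi : forall i j, klinear (@phi2 i j).

Lemma cmap_cpadr b v w (s : crossing v w) (f : Rw v) (g : Rw b) :
  cmap phi2 (cpadr b s) (tcat f g) = tcat (cmap phi2 s f) g.
Proof.
elim: s f => {v w} [i j b' p|k v w s ih] f.
  elim/(@gen_ind kk I (@dotalg kk H) [:: i; j] b'): f => [|x y ex ey|x h].
  - by rewrite tcat0l !cmap0 // tcat0l.
  - by rewrite tcatDl !(cmap_klin hphi _).1 ex ey tcatDl.
  by rewrite tcat_assoc2 !cmap_crossing0 // tcat_assoc2.
elim/tens_ind: f => [|x y ex ey|r f].
- by rewrite tcat0l !cmap0 // tcat0l.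
- by rewrite tcatDl !(cmap_klin hphi _).1 ex ey tcatDl.
by rewrite tcat_pure [cpadr _ _]/= !cmap_S // ih tcat_pure.
Qed.

Lemma crossing_fun v w w' (s : crossing v w) (s' : crossing v w') :
  height s = height s' -> w = w'.
Proof.
elim: s w' s' => {v w} [i j b p|k v w s ih] w' s' h.
  move: h; pose Q v w' (s' : crossing v w') :=
    if v is i :: j :: b then 0%N = height s' -> j :: i :: b = w' else True.
  have : Q _ _ s' by case: s' => // k [|l u] w2 s2.
  exact.
move: s ih h; pose Q v w' (s' : crossing v w') :=
  if v is k :: v then forall s : crossing v w,
    (forall w' (s' : crossing v w'), height s = height s' -> w = w') ->
    (height s).+1 = height s' -> k :: w = w' else True.
have : Q _ _ s'.
  by case: s' => //= k' v' w2 s2 s ih [/ih ->].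
by move=> h s ih; apply: h.
Qed.

Lemma famact_pad v w (s : crossing v w) (f : Rw v) :
  famact phi2 (height s) (pad f) = pad (cmap phi2 s f).
Proof.
apply: dotfamP => w'; have [[b ->]|h] := prefixP' w w'.
  by rewrite -(height_cpadr b) famactE !pad_cat cmap_cpadr.
rewrite (pad_neq _ h).
have [[v' [s' e]]|e] := posP (height s) w'; last by rewrite famact_None.
rewrite -e famactE pad_neq ?cmap0 // => b ev; subst v'.
by apply: (h b); apply: (@crossing_fun _ _ _ s' (cpadr b s)); rewrite height_cpadr.
Qed.
End ActPad.

End Pads.

(** * The action of diagrams *)

Section Sem.
Variables (kk : comPzRingType) (H : heckeData kk).
Local Notation I := (color H).
Local Notation Rw := (dots (@dotalg kk H)).
Local Notation crossing := (@crossing kk H).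
Local Notation diag := (@diag kk H).
Local Notation lincomb := (@lincomb kk H).
Local Notation K := (dotfam H).
Local Notation "x ** y" := (dcomp x y)
  (at level 40, y at level 40, right associativity).
Hypothesis hH : dot_axioms H.
Local Notation D := (dotsys hH).
Local Notation scalK := (@scalK kk H).
Let kphi (i j : I) : klinear (phi H i j) := phi_linear i j.
Let kdel (i j : I) : klinear (@del2 _ H i j) := @del2_klin _ H i j.

Lemma mvE : @mv D = @mvK kk H. Proof. by []. Qed.
Lemma dlE : @dl D = @dlK kk H. Proof. by []. Qed.

Lemma inertM i (f g : D) : inert i f -> inert i g -> inert i (f * g).
Proof.
move=> hf hg; split; first by rewrite inert_mvM // hg.1 mulrA.
by rewrite inert_dlM // hg.2 mulr0.
Qed.
Lemma inertD i (f g : D) : inert i f -> inert i g -> inert i (f + g).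
Proof.
by move=> [f1 f2] [g1 g2]; split; rewrite ?mvD ?dlD ?f1 ?g1 ?f2 ?g2 ?addr0 ?mulrDl.
Qed.
Lemma inert0 i : inert i (0 : D).
Proof. by split; rewrite ?mv0 ?dl0 ?mul0r. Qed.

Lemma inert_scal i c : @inert D i (scalK c).
Proof.
split; apply: dotfamP => w.
  rewrite [RHS]famM mvE /mvK /scalK.
  have [[v [s <-]]|e] := posP i w; last by rewrite !famact_None // mulr0.
  by rewrite !famactE -[scal _ c]mulr1 (cmap_klin kphi s).2.
rewrite dlE /dlK /scalK.
have [[v [s <-]]|e] := posP i w; last by rewrite !famact_None.
by rewrite !famactE -[scal _ c]mulr1 (cmap_klin kdel s).2 cdel1 // mulr0.
Qed.

Lemma inert_pad_head i k (r : dotalg k) :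
  @inert D i.+1 (pad (tpure r 1 : Rw [:: k])).
Proof.
have half phi2 : (forall i j, klinear (@phi2 i j)) -> forall w,
    famact phi2 i.+1 (pad (tpure r 1 : Rw [:: k])) w =
    pad (tpure r 1 : Rw [:: k]) w * famact phi2 i.+1 1 w.
  move=> h [|k' w]; first by rewrite !famact_None // mulr0.
  have [[v [s e]]|e] := posP i.+1 (k' :: w); last by rewrite !famact_None // mulr0.
  rewrite -e !famactE; case: s e => // {k' w v} k' v w s _.
  have [ek|ne] := eqVneq k' k; last first.
    by rewrite !(@pad_neq _ _ [:: k]) ?cmap0 ?mul0r // => b [] /eqP; rewrite (negbTE ne).
  subst k'; rewrite !pad_head fam1 -[1 : Rw (k :: v)]/(tpure 1 1) !cmap_S //.
  by rewrite [RHS]tmul_pure mulr1 mul1r.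
split; apply: dotfamP => w; first exact: half.
rewrite dlE /dlK half // fam0.
have [[v [s <-]]|e] := posP i.+1 w; last by rewrite famact_None // mulr0.
by rewrite famactE fam1 cdel1 // mulr0.
Qed.

Lemma inert_pad i a (g : Rw a) : (size a <= i)%N -> @inert D i (pad g).
Proof.
elim: a i g => [|k a ih] i g hi.
  have -> : pad g = scalK g.
    apply: dotfamP => w; have -> := @pad_cat _ _ [::] w g.
    by rewrite /= mulr1.
  exact: inert_scal.
case: i hi => // i hi; elim/tens_ind: g => [|x y ex ey|r g].
- by rewrite pad0; apply: inert0.
- by rewrite padD; apply: inertD.
rewrite pad_cons; apply: inertM; first exact: inert_pad_head.
by rewrite -[i.+1]addn1; apply: (@inert_shn D i 1); apply: ih.
Qed.

Section Ops.
Variable V : lmodType D.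
Variable s : nat -> V -> V.
Hypothesis hs : twisted s.

(** Diagrams act on vectors at place p.  The idempotent in the case of the
    identity restricts the action to the colorings that contain the bottom word
    of the diagram; the other strands may have any colors. *)
Fixpoint sem (p : nat) v w (d : diag v w) (x : V) : V :=
  match d with
  | dnil => (padp p (1 : Rw v) : D) *: x
  | ddot _ f d' => (padp p f : D) *: sem p d' x
  | dcross _ _ c d' => s (p + height c) (sem p d' x)
  end.

Definition semL p v w (X : lincomb v w) (x : V) : V :=
  \sum_(t <- X) (scalK t.1 : D) *: sem p t.2 x.

Lemma s_padp p v w (c : crossing v w) (f : Rw v) x :
  s (p + height c) ((padp p f : D) *: x) =
  (padp p (cmap (phi H) c f) : D) *: s (p + height c) x +
  (padp p (cmap (@del2 kk H) c f) : D) *: x.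
Proof.
rewrite hs.2 addnC -[padp p f]/(@shn D p (pad f)) mv_shn dl_shn.
by rewrite mvE dlE /mvK /dlK !famact_pad.
Qed.
Lemma s_padp1 p v w (c : crossing v w) x :
  s (p + height c) ((padp p (1 : Rw v) : D) *: x) =
  (padp p (1 : Rw w) : D) *: s (p + height c) x.
Proof. by rewrite s_padp cphi1 // cdel1 // padp0 scale0r addr0. Qed.

Lemma padp1M p v (f : Rw v) (x : V) :
  (padp p (1 : Rw v) : D) *: ((padp p f : D) *: x) = (padp p f : D) *: x.
Proof.
rewrite scalerA (_ : (padp p (1 : Rw v) : D) * (padp p f : D) = padp p f) //.
by rewrite -[RHS]/(padp p f) -[f in RHS]mul1r padpM.
Qed.

Lemma sem_top p v w (d : diag v w) x :
  (padp p (1 : Rw w) : D) *: sem p d x = sem p d x.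
Proof.
elim: d => [|u f d _|u u' c d ih] /=; try exact: padp1M.
by rewrite -s_padp1 ih.
Qed.
Lemma sem_bot p v w (d : diag v w) x :
  sem p d ((padp p (1 : Rw v) : D) *: x) = sem p d x.
Proof.
elim: d => [|u f d ih|u u' c d ih] /=; rewrite ?ih //; exact: padp1M.
Qed.
Lemma sem_comp p v w u (d : diag w u) (d' : diag v w) x :
  sem p (d ** d') x = sem p d (sem p d' x).
Proof.
elim: d d' => [|u' f d ih|u' u'' c d ih] d' /=; rewrite ?ih //.
by rewrite sem_top.
Qed.
Lemma semD p v w (d : diag v w) x y : sem p d (x + y) = sem p d x + sem p d y.
Proof.
elim: d => [|u f d ih|u u' c d ih] /=; rewrite ?ih ?scalerDr //.
by rewrite hs.1.
Qed.
Lemma sem0 p v w (d : diag v w) : sem p d 0 = 0.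
Proof. exact: additive0 (semD p d). Qed.
Lemma semZ p v w (d : diag v w) c x :
  sem p d ((scalK c : D) *: x) = (scalK c : D) *: sem p d x.
Proof.
have mulC' (f : D) (y : V) : f *: ((scalK c : D) *: y) = (scalK c : D) *: (f *: y).
  by rewrite !scalerA mulrC.
elim: d => [|u f d ih|u u' k d ih] /=; rewrite ?ih ?mulC' //.
by apply: (s_inert hs); apply: inert_scal.
Qed.

Lemma semL_cat p v w (X Y : lincomb v w) x :
  semL p (X ++ Y) x = semL p X x + semL p Y x.
Proof. by rewrite /semL big_cat. Qed.
Lemma scalKM c c' (x : V) :
  (scalK (c * c') : D) *: x = (scalK c : D) *: ((scalK c' : D) *: x).
Proof.
rewrite scalerA; congr (_ *: _); apply: dotfamP => w.
by rewrite [RHS]famM /scalK rmorphM.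
Qed.
Lemma scalK1 (x : V) : (scalK 1 : D) *: x = x.
Proof.
rewrite (_ : scalK 1 = 1 :> D) ?scale1r //.
by apply: dotfamP => w; rewrite /scalK rmorph1.
Qed.
Lemma semL_scale p v w c (X : lincomb v w) x :
  semL p (lscale c X) x = (scalK c : D) *: semL p X x.
Proof.
rewrite /semL big_map scaler_sumr; apply: eq_bigr => t _ /=.
exact: scalKM.
Qed.
Lemma semL1 p v w (d : diag v w) x : semL p [:: (1, d)] x = sem p d x.
Proof. by rewrite /semL big_seq1 scalK1. Qed.
Lemma semL_comp p v v' w' w (T : diag w' w) (Z : lincomb v' w') (B : diag v v') x :
  semL p (lcomp T Z B) x = sem p T (semL p Z (sem p B x)).
Proof.
rewrite /semL big_map (big_morph _ (semD p T) (sem0 p T)).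
by apply: eq_bigr => t _ /=; rewrite !sem_comp semZ.
Qed.

Lemma padp_head p k v (f : Rw v) :
  padp p (tpure 1 f : Rw (k :: v)) = padp p (1 : Rw [:: k]) * padp p.+1 f.
Proof.
rewrite /padp pad_cons shKn_M; congr (_ * _).
by rewrite -iterSr.
Qed.
Lemma sem_dshift1 p k v w (d : diag v w) x :
  sem p (dshift1 k d) x = (padp p (1 : Rw [:: k]) : D) *: sem p.+1 d x.
Proof.
elim: d => [|u f d ih|u u' c d ih] /=.
- by rewrite -[1 : Rw (k :: v)]/(tpure 1 1) padp_head -scalerA.
- rewrite padp_head ih [in RHS]scalerA scalerA; congr (_ *: _).
  rewrite -[LHS]/(padp p (1 : Rw [:: k]) * padp p.+1 f * padp p 1 : K).
  by rewrite mulrAC -padpM mulr1.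
rewrite ih addnS -addSn; apply: (s_inert hs).
rewrite addSn -addnS addnC; apply: (@inert_shn D).
exact: inert_pad.
Qed.
Lemma padp_prefix p a v : padp p (1 : Rw (a ++ v)) =
  padp p (1 : Rw a) * padp (p + size a) (1 : Rw v).
Proof.
elim: a p => [|k a ih] p.
  rewrite addn0 (_ : padp p (1 : Rw [::]) = 1) ?mul1r //.
  rewrite /padp (_ : pad _ = 1); first by elim: p => //= p ->; rewrite shK1.
  apply: dotfamP => w; have -> := @pad_cat _ _ [::] w 1.
  by rewrite /= rmorph1 mul1r.
rewrite -[1 : Rw ((k :: a) ++ v)]/(tpure 1 1) (padp_head p k (1 : Rw (a ++ v))) ih.
rewrite -[1 : Rw (k :: a)]/(tpure 1 1) (padp_head p k (1 : Rw a)) mulrA.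
by rewrite [size (_ :: _)]/= addSn addnS.
Qed.
Lemma sem_dshift p a v w (d : diag v w) x :
  sem p (dshift a d) x = (padp p (1 : Rw a) : D) *: sem (p + size a) d x.
Proof.
elim: a p => [|k a ih] p.
  rewrite addn0 (_ : padp p (1 : Rw [::]) = 1) ?scale1r //.
  rewrite /padp (_ : pad _ = 1); first by elim: p => //= p ->; rewrite shK1.
  apply: dotfamP => u; have -> := @pad_cat _ _ [::] u 1.
  by rewrite /= rmorph1 mul1r.
rewrite sem_dshift1 ih -[1 : Rw (k :: a)]/(tpure 1 1) (padp_head p k (1 : Rw a)).
rewrite [size (_ :: _)]/= addSn addnS.
by rewrite scalerA.
Qed.

Lemma sem_undec p v w (d : diag v w) x : undecorated d ->
  sem p d x = run s (shw p (expr d)) ((padp p (1 : Rw v) : D) *: x).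
Proof. by elim: d => //= u u' c d ih /ih ->. Qed.

End Ops.
End Sem.

Section Rules.
Variables (kk : comPzRingType) (H : heckeData kk).
Local Notation I := (color H).
Local Notation Rw := (dots (@dotalg kk H)).
Local Notation diag := (@diag kk H).
Local Notation lincomb := (@lincomb kk H).
Local Notation scalK := (@scalK kk H).

Lemma coef2_pad g x y b : permitted y x -> permitted x y ->
  pad (1 : Rw [:: x, y & b]) * coef2 g = pad (padr b (g x y) : Rw [:: x, y & b]).
Proof.
move=> p1 p2; apply: dotfamP => w; rewrite famM.
have [[b' ->]|h] := prefixP' [:: x, y & b] w; last by rewrite !pad_neq // mul0r.
rewrite !pad_cat [X in X * _]tcat1 mul1r.
have -> : coef2 g ([:: x, y & b] ++ b') = tcat (g x y) (1 : Rw (b ++ b')).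
  by rewrite /coef2 /= p1 p2.
by have := tcat_assoc2 (g x y) (1 : Rw b) (1 : Rw b'); rewrite tcat1; exact: esym.
Qed.
Lemma coef3_pad g x y z b :
  permitted z y -> permitted z x -> permitted y x ->
  pad (1 : Rw [:: x, y, z & b]) * coef3 g =
  pad (padr b (g x y z) : Rw [:: x, y, z & b]).
Proof.
move=> p1 p2 p3; apply: dotfamP => w; rewrite famM.
have [[b' ->]|h] := prefixP' [:: x, y, z & b] w; last by rewrite !pad_neq // mul0r.
rewrite !pad_cat [X in X * _]tcat1 mul1r.
have -> : coef3 g ([:: x, y, z & b] ++ b') = tcat (g x y z) (1 : Rw (b ++ b')).
  by rewrite /coef3 /= p1 p2 p3.
by have := tcat_assoc3 (g x y z) (1 : Rw b) (1 : Rw b'); rewrite tcat1; exact: esym.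
Qed.

Hypothesis hH : dot_axioms H.
Local Notation D := (dotsys hH).
Variable V : lmodType D.
Variable s : nat -> V -> V.
Hypothesis hs : twisted s.

Lemma padp_coef2 q g x y b (v : V) : permitted y x -> permitted x y ->
  (padp q (1 : Rw [:: x, y & b]) : D) *: (shn q (coef2 g : D) *: v) =
  (padp q (padr b (g x y) : Rw [:: x, y & b]) : D) *: v.
Proof.
move=> p1 p2; rewrite scalerA; congr (_ *: _).
by rewrite -[LHS]/(padp q _ * iter q (@shK kk H) (coef2 g)) -shKn_M coef2_pad.
Qed.
Lemma padp_coef3 q g x y z b (v : V) :
  permitted z y -> permitted z x -> permitted y x ->
  (padp q (1 : Rw [:: x, y, z & b]) : D) *: (shn q (coef3 g : D) *: v) =
  (padp q (padr b (g x y z) : Rw [:: x, y, z & b]) : D) *: v.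
Proof.
move=> p1 p2 p3; rewrite scalerA; congr (_ *: _).
by rewrite -[LHS]/(padp q _ * iter q (@shK kk H) (coef3 g)) -shKn_M coef3_pad.
Qed.
Lemma padp_neq2 q v x y b (f : Rw v) (z : V) : v != [:: x; y] ->
  (padp q (padr b (castw [:: x; y] f) : Rw [:: x, y & b]) : D) *: z = 0.
Proof. by move=> ne; rewrite castw_neq // /padr tcat0l padp0 scale0r. Qed.
Lemma padp_neq3 q v x y t b (f : Rw v) (z : V) : v != [:: x; y; t] ->
  (padp q (padr b (castw [:: x; y; t] f) : Rw [:: x, y, t & b]) : D) *: z = 0.
Proof. by move=> ne; rewrite castw_neq // /padr tcat0l padp0 scale0r. Qed.
Lemma padp_lam q x y t b c (z : V) :
  (padp q (padr b (scal (Rw [:: x; y; t]) c) : Rw [:: x, y, t & b]) : D) *: z =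
  (scalK c : D) *: ((padp q (1 : Rw [:: x, y, t & b]) : D) *: z).
Proof.
rewrite scalerA; congr (_ *: _); rewrite -[RHS]/(scalK c * padp q _).
have -> : padr b (scal (Rw [:: x; y; t]) c) = scal (Rw [:: x, y, t & b]) c.
  by have := @tcatZl kk I (@dotalg kk H) [:: x; y; t] b c 1 1; rewrite tcat1 !mulr1.
by rewrite -padp_scal mulr1.
Qed.

(** The relation for given colors is the restriction of the relation that is
    uniform in the colors. *)
Lemma rule_sem q v w (L : diag v w) (Z : lincomb v w) y : crossrule L Z ->
  (padp q (1 : Rw v) : D) *: y = y ->
  exists k, [/\ expr L = lhs k, undecorated L,
    (padp q (1 : Rw w) : D) *: rhs_op s k q y = semL s q Z y &
    all (fun t => expr t.2 \in [seq r.2 | r <- rhsK H k]) Z].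
Proof.
pose stop := (sem_top hs).
have tstE x y' z b (pxy : permitted x y') (pxz : permitted x z) (pyz : permitted y' z) :
    (padp q (1 : Rw [:: x, y', z & b]) : D) *: y = y ->
    (padp q (1 : Rw [:: z, y', x & b]) : D) *: run s (shw q [:: 1; 0; 1]%N) y =
    sem s q (tst b pxy pxz pyz) y.
  by move=> hy; rewrite -(stop q _ _ (tst b pxy pxz pyz)) sem_undec // hy.
case=> {v w L Z}.
- move=> i b p hy; exists false; split=> //.
  rewrite /rhs_op /= !big_cons big_nil addr0 scalerDr !padp_coef2 //; lazy beta.
  rewrite eqxx !castw_id /semL !big_cons big_nil addr0 !scalK1.
  by rewrite /= addn0 hy.
- move=> i j b pij pji ij hy; exists false; split=> //.
  rewrite /rhs_op /= !big_cons big_nil addr0 scalerDr !padp_coef2 //; lazy beta.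
  have ji : j == i = false by rewrite eq_sym (negbTE ij).
  rewrite ji padp_neq2 ?add0r; last by rewrite !eqseq_cons ji andbF.
  by rewrite /semL big_seq1 scalK1 /= hy.
- move=> i b p hy; exists true; split=> //.
  rewrite /rhs_op /= !big_cons big_nil addr0 !scalerDr !padp_coef3 //; lazy beta.
  rewrite padp_lam (tstE _ _ _ b p p p hy) /semL !big_cons big_nil addr0 ?scalK1 //.
  by rewrite eqxx /iii !castw_id /= hy !addn0 !addn1.
- move=> i j b pii pij ij hy; exists true; split=> //.
  have ji : j == i = false by rewrite eq_sym (negbTE ij).
  rewrite /rhs_op /= !big_cons big_nil addr0 !scalerDr !padp_coef3 //; lazy beta.
  rewrite padp_lam (tstE _ _ _ b pii pij pij hy) /semL !big_cons big_nil addr0 ?scalK1 // ji castw_id.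
  rewrite !padp_neq3 ?addr0 ?eqseq_cons ?ji ?eq_sym ?ji ?andbF //.
  by rewrite /= hy !addn0 !addn1.
- move=> i j b pii pji ij hy; exists true; split=> //.
  have ji : j == i = false by rewrite eq_sym (negbTE ij).
  rewrite /rhs_op /= !big_cons big_nil addr0 !scalerDr !padp_coef3 //; lazy beta.
  rewrite padp_lam (tstE _ _ _ b pji pji pii hy) /semL !big_cons big_nil addr0 ?scalK1 // (negbTE ij) eqxx castw_id.
  rewrite /iii !padp_neq3 ?add0r ?addr0 ?eqseq_cons ?(negbTE ij) ?ji ?andbF //.
  by rewrite /= hy !addn0 !addn1.
- move=> i j b pii pij pji ij hy; exists true; split=> //.
  have ji : j == i = false by rewrite eq_sym (negbTE ij).
  rewrite /rhs_op /= !big_cons big_nil addr0 !scalerDr !padp_coef3 //; lazy beta.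
  rewrite padp_lam (tstE _ _ _ b pij pii pji hy) /semL !big_cons big_nil addr0 ?scalK1 // (negbTE ij) eqxx castw_id.
  rewrite /iii !padp_neq3 ?add0r ?addr0 ?eqseq_cons ?(negbTE ij) ?ji ?andbF //.
  by rewrite /= hy !addn0 !addn1.
- move=> i j k b pij pik pjk ij ik jk hy; exists true; split=> //.
  rewrite /rhs_op /= !big_cons big_nil addr0 !scalerDr !padp_coef3 //; lazy beta.
  rewrite padp_lam (tstE _ _ _ b pij pik pjk hy) /semL !big_cons big_nil addr0 ?scalK1 //.
  have kj : k == j = false by rewrite eq_sym (negbTE jk).
  have ki : k == i = false by rewrite eq_sym (negbTE ik).
  have ji : j == i = false by rewrite eq_sym (negbTE ij).
  rewrite kj ki /iii !padp_neq3 ?addr0 ?eqseq_cons ?kj ?ji ?ki ?andbF //.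
Qed.

End Rules.

(** * Words of diagrams and soundness of reduction steps *)

Section Expr.
Variables (kk : comPzRingType) (H : heckeData kk).
Local Notation Rw := (dots (@dotalg kk H)).
Local Notation crossing := (@crossing kk H).
Local Notation diag := (@diag kk H).
Local Notation lincomb := (@lincomb kk H).
Local Notation "x ** y" := (dcomp x y)
  (at level 40, y at level 40, right associativity).

Lemma expr_comp v w u (x : diag w u) (y : diag v w) :
  expr (x ** y) = expr x ++ expr y.
Proof. by elim: x y => //= [u' t s x ih] y; rewrite ih. Qed.
Lemma shw_cat p e1 e2 : shw p (e1 ++ e2) = shw p e1 ++ shw p e2.
Proof. exact: map_cat. Qed.
Lemma shw_shw p q e : shw p (shw q e) = shw (p + q) e.
Proof. by rewrite /shw -map_comp; apply: eq_map => i /=; rewrite addnA. Qed.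
Lemma expr_dshift1 k v w (d : diag v w) : expr (dshift1 k d) = map S (expr d).
Proof. by elim: d => //= u u' s d ->. Qed.
Lemma expr_dshift a v w (d : diag v w) : expr (dshift a d) = shw (size a) (expr d).
Proof.
elim: a => [|k a ih]; first by rewrite /= /shw map_id.
by rewrite /= expr_dshift1 ih /shw -map_comp; apply: eq_map => i.
Qed.
Lemma height_lt v w (s : crossing v w) : ((height s).+1 < size v)%N.
Proof. by elim: s. Qed.
Lemma size_crossing v w (s : crossing v w) : size w = size v.
Proof. by elim: s => //= k v' w' s ->. Qed.
Lemma size_diag v w (d : diag v w) : size w = size v.
Proof. by elim: d => // u u' s d; rewrite (size_crossing s). Qed.
Lemma expr_inword v w (d : diag v w) : inword (size v) (expr d).
Proof.
by elim: d => //= u u' s d ->; rewrite andbT -(size_diag d) height_lt.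
Qed.

Lemma undec_comp v w u (x : diag w u) (y : diag v w) :
  undecorated (x ** y) = undecorated x && undecorated y.
Proof. by elim: x y => //= u' t s x ih y; rewrite ih. Qed.
Lemma undec_dshift a v w (d : diag v w) : undecorated (dshift a d) = undecorated d.
Proof.
elim: a => //= k a <-; elim: (dshift a d) => //=.
Qed.

Definition left_diag v w (d : diag v w) : bool := undecorated (undot d).

Lemma left_dot v w u (T : diag u w) (f g : Rw u) (B : diag v u) :
  left_diag (T ** dot f ** B) ->
  left_diag (T ** dot g ** B) && left_diag (T ** B).
Proof.
rewrite /left_diag; elim: T f g B => [|u' h T ih|u' u'' s T ih] f g B /=.
- by move=> ->.
- exact: ih.
by rewrite !undec_comp /= andbF.
Qed.
Lemma left_cross v w u u' (T : diag u' w) (c : crossing u u') (B : diag v u) :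
  left_diag (T ** cdiag c ** B) -> undecorated B.
Proof.
rewrite /left_diag; elim: T => [|u1 h T ih|u1 u2 s T ih] //=.
by rewrite !undec_comp /= => /andP[].
Qed.
Lemma expr_undot v w (d : diag v w) : expr (undot d) = expr d.
Proof. by elim: d. Qed.

Lemma crossrule_kind v w (L : diag v w) Z : crossrule L Z ->
  exists k, expr L = lhs k /\ undecorated L.
Proof. by case=> *; first [by exists false | by exists true]. Qed.

Lemma dotrule_cdiag v w (d : diag v w) f Z : dotrule d f Z ->
  exists c : crossing v w, d = cdiag c /\
  all (fun t => (expr t.2 == expr d) || (expr t.2 == [::])) Z.
Proof.
case=> {v w d f Z} [a i b p f|a i j b p f ij];
  exists (cshift a (crossing0 b p)); rewrite -dshift_cdiag; split=> //=;
  by rewrite eqxx ?orbT.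
Qed.

Lemma all_comp v v' w' w (T : diag w' w) (Z : lincomb v' w') (B : diag v v')
    (P : pred word) :
  all (fun t => P (expr T ++ expr t.2 ++ expr B)) Z ->
  all (fun t => P (expr t.2)) (lcomp T Z B).
Proof.
rewrite /lcomp all_map; apply: sub_all => t /=.
by rewrite !expr_comp.
Qed.

End Expr.

Section Sound.
Variables (kk : comPzRingType) (H : heckeData kk).
Local Notation Rw := (dots (@dotalg kk H)).
Local Notation diag := (@diag kk H).
Local Notation K := (dotfam H).
Local Notation "x ** y" := (dcomp x y)
  (at level 40, y at level 40, right associativity).
Hypothesis hH : dot_axioms H.
Local Notation D := (dotsys hH).
Variable V : lmodType D.
Variable s : nat -> V -> V.
Hypothesis hs : twisted s.

Lemma padp_supp p a v (y : V) : (padp p (1 : Rw (a ++ v)) : D) *: y = y ->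
  (padp (p + size a)%N (1 : Rw v) : D) *: y = y.
Proof.
move=> h.
transitivity ((padp (p + size a)%N (1 : Rw v) : D) *:
              ((padp p (1 : Rw (a ++ v)) : D) *: y)); first by rewrite h.
rewrite scalerA -[RHS]h; congr (_ *: _).
rewrite -[LHS]/(padp (p + size a)%N (1 : Rw v) * padp p (1 : Rw (a ++ v)) : K).
by rewrite padp_prefix mulrCA -padpM mulr1.
Qed.

(** A reduction step is an identity of operators as soon as the relation that it
    uses holds at the vector to which it is applied. *)
Lemma cross_sound p v w a u u' (T : diag (a ++ u') w) (L : diag u u') Z
    (B : diag v (a ++ u)) x : crossrule L Z ->
  (forall k, expr L = lhs k ->
    run s (shw (p + size a)%N (lhs k)) (sem s p B x) =
    rhs_op s k (p + size a)%N (sem s p B x)) ->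
  sem s p (T ** dshift a L ** B) x = semL s p (lcomp T (Defs.lshift a Z) B) x.
Proof.
move=> hL hrel; rewrite semL_comp // !sem_comp //; congr (sem s p T _).
set y := sem s p B x in hrel *.
have hy : (padp p (1 : Rw (a ++ u)) : D) *: y = y by exact: sem_top.
have hq := padp_supp hy.
have [k [eL uL rZ _]] := rule_sem hs hL hq.
rewrite sem_dshift // /semL big_map /=.
transitivity ((padp p (1 : Rw a) : D) *: semL s (p + size a)%N Z y).
  congr (_ *: _); rewrite -rZ -hrel // -(sem_top hs) sem_undec // hq.
  by rewrite eL.
rewrite /semL scaler_sumr; apply: eq_bigr => t _.
by rewrite sem_dshift // !scalerA mulrC.
Qed.

Lemma dot_sound p v w (d : diag v w) f Z y : dotrule d f Z ->
  (padp p (1 : Rw v) : D) *: y = y ->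
  sem s p d ((padp p f : D) *: y) = semL s p Z y.
Proof.
case=> {v w d f Z} [a i b c f|a i j b c f ij] hy.
  rewrite -[cross b c]/(cdiag (crossing0 b c)) dshift_cdiag /= padp1M s_padp //.
  rewrite /semL !big_cons big_nil addr0 !scalK1 /= hy.
  rewrite !cmap_shift; try exact: phi_linear; try exact: del2_klin.
  by rewrite (_ : @del2 kk H i i = del H i) //; apply: funext; apply: del2_id.
rewrite -[cross b c]/(cdiag (crossing0 b c)) dshift_cdiag /= padp1M s_padp //.
rewrite /semL big_seq1 scalK1 /= hy cmap_shift; try exact: phi_linear.
rewrite cdel_neq // ?padp0 ?scale0r ?addr0 //.
by rewrite eqseq_cat // eqxx /= eqseq_cons (negbTE ij).
Qed.

Lemma sem_dot p v u w (T : diag u w) f (B : diag v u) x :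
  sem s p (T ** dot f ** B) x = sem s p T ((padp p f : D) *: sem s p B x).
Proof.
rewrite !sem_comp //= ; congr (sem s p T _).
by rewrite sem_top.
Qed.

End Sound.

(** * Invariants of reduction *)

Section Joinable.
Variables (kk : comPzRingType) (H : heckeData kk).
Local Notation I := (color H).
Local Notation Rw := (dots (@dotalg kk H)).
Local Notation diag := (@diag kk H).
Local Notation lincomb := (@lincomb kk H).
Local Notation K := (dotfam H).
Local Notation "x ** y" := (dcomp x y)
  (at level 40, y at level 40, right associativity).

Lemma iso_sym v w (d d' : diag v w) : isotopic d d' -> isotopic d' d.
Proof. exact: rst_sym. Qed.
Lemma iso_trans v w (d d' d'' : diag v w) :
  isotopic d d' -> isotopic d' d'' -> isotopic d d''.
Proof. exact: rst_trans. Qed.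
Lemma undotK v w (d : diag v w) : undot (undot d) = undot d.
Proof. by elim: d => //= u f d ->. Qed.

(** [left_coef] adds up the coefficients of an isotopy class.  Removing the terms
    of one class at a time shows that these sums determine the value of a linear
    combination under any evaluation that is invariant under isotopy. *)
Lemma class_sum (A : zmodType) (V : zmodType) v w (Z : seq (A * diag v w))
    (act : A -> V -> V) (G : diag v w -> V) (ok : pred (diag v w)) :
  (forall a b y, act (a + b) y = act a y + act b y) ->
  (forall d d', ok d -> isotopic d d' -> G d = G d') ->
  all (fun t => ok t.2) Z ->
  (forall d, \sum_(t <- Z | `[< isotopic t.2 d >]) t.1 = 0) ->
  \sum_(t <- Z) act t.1 (G t.2) = 0.
Proof.
move=> actD hG; have act0 y : act 0 y = 0 by apply: (additive0 (fun a b => actD a b y)).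
elim: (size Z) {-2}Z (leqnn (size Z)) => {Z} [|n ih] [|t0 Z] //=; rewrite ?big_nil //.
rewrite ltnS => hn hok hZ.
pose P (t : A * diag v w) := `[< isotopic t.2 t0.2 >].
rewrite (bigID P) /=.
have -> : \sum_(t <- t0 :: Z | P t) act t.1 (G t.2) =
          \sum_(t <- t0 :: Z | P t) act t.1 (G t0.2).
  move: hok; rewrite -[_ && _]/(all _ (t0 :: Z)).
  elim: (t0 :: Z) => [|t r ihr] /=; first by rewrite !big_nil.
  move=> /andP[ot /ihr er]; rewrite !big_cons; case: ifP => // /asboolP it.
  by rewrite er (hG _ _ ot it).
rewrite -(big_morph (act^~ (G t0.2)) (fun a b => actD a b _) (act0 _)) hZ act0 add0r.
rewrite -big_filter; apply: ih.
- have P0 : P t0 by apply/asboolP; apply: rst_refl.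
  by rewrite /= P0 /=; apply: leq_trans hn; rewrite size_filter count_size.
- rewrite all_filter; move: hok; rewrite -[_ && _]/(all _ (t0 :: Z)).
  by apply: sub_all => t /= ->; rewrite implybT.
move=> d; rewrite big_filter_cond.
case: (pselect (isotopic t0.2 d)) => h0.
  apply: big1 => t /andP[/asboolP hn0 /asboolP htd]; case: hn0.
  exact: iso_trans htd (iso_sym h0).
rewrite -[RHS](hZ d); apply: eq_bigl => t; rewrite /P.
case: (pselect (isotopic t.2 d)) => htd; last by rewrite (asboolF htd) andbF.
rewrite (asboolT htd) andbT; apply/asboolP => ht0.
by apply: h0; apply: iso_trans (iso_sym ht0) htd.
Qed.

(** An evaluation [G] of diagrams, linear over the dots at the top, that is
    compatible with the reduction steps takes equal values on the two sides of a
    joinable pair.  The predicate [ok] confines the argument to the diagrams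
    which occur. *)
Section Eval.
Variables (v w : seq I) (V : zmodType) (act : Rw w -> V -> V).
Variables (G : diag v w -> V) (ok : pred (diag v w)).
Hypothesis actDl : forall a b y, act (a + b) y = act a y + act b y.
Hypothesis actDr : forall a y z, act a (y + z) = act a y + act a z.
Hypothesis actM : forall a b y, act a (act b y) = act (a * b) y.
Hypothesis G_top : forall d, G d = act (topdots d) (G (undot d)).

Definition evalL (X : lincomb v w) : V :=
  \sum_(t <- X) act (scal (Rw w) t.1) (G t.2).

Lemma act1 d : act 1 (G d) = G d.
Proof. by rewrite G_top actM mul1r. Qed.
Lemma evalL_cat X Y : evalL (X ++ Y) = evalL X + evalL Y.
Proof. exact: big_cat. Qed.
Lemma evalL_scale c X : evalL (lscale c X) = act (scal (Rw w) c) (evalL X).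
Proof.
rewrite /evalL big_map (big_morph _ (actDr _) (additive0 (actDr _))).
by apply: eq_bigr => t _; rewrite actM -rmorphM.
Qed.
Lemma evalL1 d : evalL [:: (1, d)] = G d.
Proof. by rewrite /evalL big_seq1 rmorph1 act1. Qed.

Lemma eval_reduces (S : diag v w -> lincomb v w -> Prop) X X' :
  (forall d Z, S d Z -> ok d -> G d = evalL Z /\ all (fun t => ok t.2) Z) ->
  reduces S X X' -> all (fun t => ok t.2) X ->
  evalL X = evalL X' /\ all (fun t => ok t.2) X'.
Proof.
move=> hS; elim=> {X X'} [X X' [{}X c d Y Z hd]|X|X Y Z _ ih1 _ ih2].
- rewrite !all_cat /= => /and3P[oX od oY]; have [e oZ] := hS _ _ hd od.
  rewrite !evalL_cat evalL_scale -e oX oY andbT; split.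
    by congr (_ + _); rewrite /evalL big_cons.
  by rewrite /lscale all_map.
- by [].
- by move=> /ih1[-> /ih2].
Qed.

Hypothesis ok_step : forall d Z, step d Z -> ok d ->
  G d = evalL Z /\ all (fun t => ok t.2) Z.
Hypothesis ok_undot : forall d, ok d -> ok (undot d).

Lemma eval_iso d d' : isotopic d d' ->
  (ok d -> ok d' /\ G d = G d') /\ (ok d' -> ok d /\ G d = G d').
Proof.
elim=> {d d'} [d d' h|d|d d' _ [h1 h2]|d d' d'' _ [h1 h2] _ [h3 h4]].
- split=> o; first by have [] := ok_step (step_far h) o; rewrite evalL1 //= andbT.
  by have [] := ok_step (step_far_sym h) o; rewrite evalL1 //= andbT.
- by [].
- by split=> [/h2[? ->]|/h1[? ->]].
split=> [/h1[/h3[o ->] ->]|/h4[/h2[o ->] ->]] //.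
Qed.

Lemma eval_left_coef X Y :
  all (fun t => ok t.2) X -> all (fun t => ok t.2) Y ->
  left_coef X =1 left_coef Y -> evalL X = evalL Y.
Proof.
move=> oX oY eXY; apply/eqP; rewrite -subr_eq0; apply/eqP.
pose items (Z : lincomb v w) :=
  [seq (scal (Rw w) t.1 * topdots t.2, undot t.2) | t <- Z].
pose Z := items X ++ [seq (- t.1, t.2) | t <- items Y].
have actN a y : act (- a) y = - act a y.
  apply: (addIr (act a y)); rewrite -actDl !addNr.
  exact: (additive0 (fun a b => actDl a b y)).
have itemsE Z' : evalL Z' = \sum_(t <- items Z') act t.1 (G t.2).
  by rewrite /items big_map; apply: eq_bigr => t _ /=; rewrite G_top actM.
have key : \sum_(t <- Z) act t.1 (G t.2) = 0.
  apply: (@class_sum _ V v w Z act G ok actDl).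
  - by move=> d d' od h; have [/(_ od)[]] := eval_iso h.
  - rewrite all_cat !all_map; apply/andP; split.
      by apply: sub_all oX => t /=; apply: ok_undot.
    by apply: sub_all oY => t /=; apply: ok_undot.
  move=> d; rewrite big_cat /=.
  have e Z' : \sum_(t <- items Z' | `[< isotopic t.2 d >]) t.1 = left_coef Z' d.
    by rewrite big_map.
  rewrite e -[RHS](subrr (left_coef X d)); congr (_ + _).
  by rewrite eXY -e -sumrN big_map.
rewrite -key big_cat /= -itemsE; congr (_ + _).
by rewrite itemsE -sumrN [RHS]big_map; apply: eq_bigr => t _; rewrite actN.
Qed.

Lemma eval_joinable X Y : joinable X Y ->
  all (fun t => ok t.2) X -> all (fun t => ok t.2) Y -> evalL X = evalL Y.
Proof.
case=> X' [Y' [rX rY _ _ e]] oX oY.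
have [-> oX'] := eval_reduces ok_step rX oX.
have [-> oY'] := eval_reduces ok_step rY oY.
exact: eval_left_coef.
Qed.
End Eval.

Section Sound.
Hypothesis hH : dot_axioms H.
Local Notation D := (dotsys hH).
Variable V : lmodType D.
Variables (n M m p : nat) (s : nat -> V -> V) (Fl : nat -> V -> Prop).
Hypothesis hP : pact n s Fl M.
Variable x : V.
Hypothesis hx : Fl m x.
Let hs : twisted s := pact_semi hP.
Local Notation wd d := (wt n (shw p (expr d))).
Local Notation inw d := (inword n (shw p (expr d))).

Lemma Fl_sem v w (d : diag v w) : inw d -> Fl (m + wd d) (sem s p d x).
Proof.
elim: d => [|u f d ih|u u' c d ih] /=.
- by rewrite addn0 => _; apply: (pact_Z hP).
- by move=> /ih; apply: (pact_Z hP).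
move=> /andP[hc /ih hd]; rewrite wt_cons addnCA addnC.
exact: (pact_s hP hc hd).
Qed.

Lemma sem_undot v w (d : diag v w) :
  sem s p d x = (padp p (topdots d) : D) *: sem s p (undot d) x.
Proof.
elim: d => [|u f d ih|u u' c d ih] /=.
- by rewrite padp1M.
- rewrite ih scalerA; congr (_ *: _).
  by rewrite -[LHS]/(padp p f * padp p (topdots d) : K) -padpM.
exact: (esym (sem_top hs p (dcross c d) x)).
Qed.

Section Steps.
Variables (v w : seq I) (ok : pred (diag v w)).
Let act (f : Rw w) (y : V) := (padp p f : D) *: y.
Let G (d : diag v w) := sem s p d x.

Let actDl a b y : act (a + b) y = act a y + act b y.
Proof. by rewrite /act padpD -scalerDl. Qed.
Let actDr a y z : act a (y + z) = act a y + act a z.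
Proof. exact: scalerDr. Qed.
Let actM a b y : act a (act b y) = act (a * b) y.
Proof.
by rewrite /act scalerA; congr (_ *: _); rewrite -[LHS]/(padp p a * padp p b : K) -padpM.
Qed.
Let semL_eval X : semL s p X x = evalL act G X.
Proof.
apply: eq_bigr => t _; rewrite /act /G -[in LHS](sem_top hs p t.2) scalerA.
by congr (_ *: _); rewrite -[scal _ _]mulr1 padp_scal.
Qed.

Lemma reduces_sound (S : diag v w -> lincomb v w -> Prop) X X' :
  (forall d Z, S d Z -> ok d ->
     sem s p d x = semL s p Z x /\ all (fun t => ok t.2) Z) ->
  reduces S X X' -> all (fun t => ok t.2) X ->
  semL s p X x = semL s p X' x /\ all (fun t => ok t.2) X'.
Proof.
move=> hS; rewrite !semL_eval; apply: eval_reduces => //.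
by move=> d Z hd /(hS _ _ hd); rewrite semL_eval.
Qed.

Lemma joinable_sound X Y :
  (forall d Z, step d Z -> ok d ->
     sem s p d x = semL s p Z x /\ all (fun t => ok t.2) Z) ->
  (forall d, ok d -> ok (undot d)) -> joinable X Y ->
  all (fun t => ok t.2) X -> all (fun t => ok t.2) Y ->
  semL s p X x = semL s p Y x.
Proof.
move=> hS hok; rewrite !semL_eval; apply: eval_joinable => //.
  by move=> d; apply: sem_undot.
by move=> d Z hd /(hS _ _ hd); rewrite semL_eval.
Qed.
End Steps.

(** The diagrams on which the relations known so far may be used. *)
Definition low v w (d : diag v w) : bool := inw d && (m + wd d < M)%N.

Lemma crossrule_words v w (L : diag v w) Z : crossrule L Z ->
  exists k, expr L = lhs k /\
  all (fun t => expr t.2 \in [seq r.2 | r <- rhsK H k]) Z.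
Proof. by case=> *; first [by exists false | by exists true]. Qed.

Lemma inword_shw_lhs q (k : bool) : inword n (shw q (lhs k)) = (q + k.+1 < n)%N.
Proof. by case: k; rewrite /inword /=; lia. Qed.

Lemma rhs_lt q (k : bool) e : (q + k.+1 < n)%N -> e \in [seq r.2 | r <- rhsK H k] ->
  inword n (shw q e) && (wt n (shw q e) < wt n (shw q (lhs k)))%N.
Proof.
move=> hq /mapP[r rk ->]; rewrite (@inword_rhs D n k) //=.
by have [_] := @rhs_word D k r rk; apply.
Qed.

Lemma far_low v w (d d' : diag v w) : far d d' ->
  low d = low d' /\ (low d -> sem s p d x = sem s p d' x).
Proof.
case=> a i j c k l e pij pkl T B.
pose X := cross (c ++ l :: k :: e) pij ** dshift [:: i; j] (dshift c (cross e pkl)).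
pose X' := dshift [:: j; i] (dshift c (cross e pkl)) ** cross (c ++ k :: l :: e) pij.
change (low (T ** dshift a X ** B) = low (T ** dshift a X' ** B) /\
  (low (T ** dshift a X ** B) ->
   sem s p (T ** dshift a X ** B) x = sem s p (T ** dshift a X' ** B) x)).
have eX : expr X = [:: 0; (size c).+2]%N.
  by rewrite /X expr_comp !expr_dshift /= /shw /= addn0.
have eX' : expr X' = [:: (size c).+2; 0]%N.
  by rewrite /X' expr_comp !expr_dshift /= /shw /= addn0.
have uX : undecorated X by rewrite /X undec_comp !undec_dshift.
have uX' : undecorated X' by rewrite /X' undec_comp !undec_dshift.
clearbody X X'; split.
  rewrite /low !expr_comp !expr_dshift eX eX' !shw_cat !inword_cat !wt_cat.
  by rewrite /inword /wt /=; congr (_ && _); [rewrite !andbT andbA [in RHS]andbA; congr (_ && _); congr (_ && _); rewrite andbC|lia].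
rewrite /low !expr_comp (expr_dshift a X) eX !shw_cat !inword_cat !wt_cat.
move=> /andP[/and3P[iT iL iB] hM].
rewrite !sem_comp //; congr (sem s p T _); rewrite !sem_dshift //.
congr (_ *: _); rewrite (sem_undec s _ _ uX) (sem_undec s _ _ uX') eX eX'; set y := _ *: sem s p B x.
rewrite /shw /= addn0; move: iL hM; rewrite /shw /inword /wt /= => iL hM.
have hy : Fl (m + wd B) y by apply: (pact_Z hP); apply: Fl_sem.
apply: (pact_far hP _ _ hy); [lia|case/and3P: iL; lia|].
by rewrite /wt /shw; move: hM; lia.
Qed.

(** A step never raises the weight, and the relation that it uses is known at the
    weight of the diagram. *)
Lemma low_step v w (d : diag v w) Z : step d Z -> low d ->
  sem s p d x = semL s p Z x /\ all (fun t => low t.2) Z.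
Proof.
rewrite /low; case=> {d Z}.
- move=> _ _ [a u u' T L Z B hL].
  have [k [eL hZ]] := crossrule_words hL.
  rewrite !expr_comp expr_dshift eL !shw_cat shw_shw !inword_cat !wt_cat.
  rewrite inword_shw_lhs => /andP[/and3P[iT iL iB] hM]; split.
    apply: cross_sound => // k'; rewrite eL => ek.
    have -> : k' = k by case: (k) (k') ek => -[].
    by apply: (pact_rel hP iL (Fl_sem iB)); lia.
  apply: (@all_comp _ _ _ _ _ _ _ _ _ (fun e => inword n (shw p e) && (m + wt n (shw p e) < M)%N)).
  rewrite /Defs.lshift all_map; apply: sub_all hZ => t /= /(rhs_lt iL)/andP[i1 l1].
  rewrite expr_dshift !shw_cat shw_shw !inword_cat !wt_cat iT i1 iB /=; lia.
- move=> u u' T d f Z B _ hd.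
  have [c [ed hZ]] := dotrule_cdiag hd.
  move=> hl; split.
    by rewrite semL_comp // -(dot_sound hs hd (sem_top hs _ _ _)) ed !sem_comp //= sem_top.
  apply: (@all_comp _ _ _ _ _ _ _ _ _ (fun e => inword n (shw p e) && (m + wt n (shw p e) < M)%N)).
  apply: sub_all hZ => t; move: hl.
  rewrite !expr_comp !shw_cat !inword_cat !wt_cat => /andP[/and3P[iT iL iB] hM].
  have w0 : wt n (shw p [::]) = 0%N by [].
  by case/orP => /eqP ->; rewrite ?w0 ?iL iT iB; lia.
- move=> u T f g B hl; rewrite /= andbT semL1 //; split; last first.
    by move: hl; rewrite !expr_comp.
  rewrite !(sem_comp hs) /= scalerA; congr (sem s p T (_ *: _)).
  by rewrite -[LHS]/(padp p f * padp p g : K) -padpM.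
- move=> u T B hl; rewrite /= andbT semL1 //; split; last first.
    by move: hl; rewrite !expr_comp.
  by rewrite !(sem_comp hs) /= (sem_top hs).
- move=> d d' hf; rewrite -/(low d) => hl; have [h1 h2] := far_low hf.
  by split; [rewrite semL1; exact: h2 | rewrite /= andbT -/(low d') -h1].
move=> d d' hf; rewrite -/(low d') => hl; have [h1 h2] := far_low hf.
rewrite -h1 in hl.
by split; [rewrite semL1 -h2 | rewrite /= andbT].
Qed.

End Sound.
End Joinable.

(** * Resolvable overlaps as identities of operators *)

Section Overlaps.
Variables (kk : comPzRingType) (H : heckeData kk).
Local Notation Rw := (dots (@dotalg kk H)).
Local Notation crossing := (@crossing kk H).
Local Notation diag := (@diag kk H).
Local Notation "x ** y" := (dcomp x y)
  (at level 40, y at level 40, right associativity).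
Hypothesis hH : dot_axioms H.
Local Notation D := (dotsys hH).

Lemma mv_padp p v w (c : crossing v w) (f : Rw v) :
  @mv D (p + height c) (padp p f : D) = padp p (cmap (phi H) c f).
Proof.
rewrite addnC -[padp p f]/(@shn D p (pad f)) mv_shn mvE /mvK famact_pad //.
exact: phi_linear.
Qed.

Lemma mvw_padp1 p v w (d : diag v w) : undecorated d ->
  @mvw D (shw p (expr d)) (padp p (1 : Rw v) : D) = padp p (1 : Rw w).
Proof.
elim: d => //= u u' c d ih /ih e.
by rewrite -/(mvw _ _) e; have := mv_padp p c 1; rewrite cphi1.
Qed.

Lemma padp1_idem p v : @idem D (padp p (1 : Rw v)).
Proof.
have hP w : padp p (1 : Rw v) w = 1 \/ padp p (1 : Rw v) w = 0.
  rewrite /padp; elim: p w => [|p ih] w /=.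
    have [[b ->]|h] := prefixP' v w; last by right; rewrite pad_neq.
    by left; rewrite pad_cat tcat1.
  case: w => [|k w] /=; first exact: (ih [::]).
  case: (ih w) => ->; first by left.
  by right; exact: (additive0 (fun x y => @tpureDr kk (dotalg k) (Rw w) 1 x y)).
exists (fun w => `[< padp p (1 : Rw v) w = 1 >]); apply: dotfamP => w.
rewrite /ind; case: asboolP => //; by case: (hP w).
Qed.

Section Run.
Variables (V : lmodType D) (n M m p : nat) (s : nat -> V -> V) (Fl : nat -> V -> Prop).
Hypothesis hP : pact n s Fl M.
Variable x : V.
Hypothesis hx : Fl m x.
Let hs : twisted s := pact_semi hP.

Lemma run_undec v w (d : diag v w) y : undecorated d ->
  sem s p d y = (padp p (1 : Rw w) : D) *: run s (shw p (expr d)) y.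
Proof.
by move=> hd; rewrite sem_undec // run_idem ?mvw_padp1 //; apply: padp1_idem.
Qed.

Lemma rule_run v w (L : diag v w) Z y : crossrule L Z -> exists k,
  [/\ expr L = lhs k, undecorated L &
   semL s p Z ((padp p (1 : Rw v) : D) *: y) =
   (padp p (1 : Rw w) : D) *: rhs_op s k p y].
Proof.
move=> hL; have [|k [eL uL e _]] :=
  rule_sem hs (q := p) (y := (padp p (1 : Rw v) : D) *: y) hL.
- by exact: padp1M.
exists k; split=> //; rewrite -e rhs_op_idem -?eL ?mvw_padp1 //; last exact: padp1_idem.
exact: padp1M.
Qed.

Lemma side_run v u u' w (T : diag u' w) (L : diag u u') Z (B : diag v u) :
  crossrule L Z -> undecorated T -> undecorated B -> exists k,
  [/\ expr L = lhs k, undecorated L &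
   semL s p (lcomp T Z B) x = (padp p (1 : Rw w) : D) *:
     run s (shw p (expr T)) (rhs_op s k p (run s (shw p (expr B)) x))].
Proof.
move=> hL uT uB; rewrite (semL_comp hs) (run_undec _ uB).
have [k [eL uL ->]] := rule_run (run s (shw p (expr B)) x) hL.
by exists k; split=> //; rewrite sem_bot ?run_undec.
Qed.

Lemma low_side v u u' w (T : diag u' w) (L : diag u u') Z (B : diag v u) :
  crossrule L Z -> inword n (shw p (expr (T ** L ** B))) ->
  (m + wt n (shw p (expr (T ** L ** B))) <= M)%N ->
  all (fun t => low n M m p t.2) (lcomp T Z B).
Proof.
move=> hL; have [k [eL hZ]] := crossrule_words hL.
rewrite !expr_comp eL !shw_cat !inword_cat !wt_cat inword_shw_lhs => /and3P[iT iL iB] hM.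
apply: (@all_comp _ _ _ _ _ _ _ _ _ (fun e => inword n (shw p e) && (m + wt n (shw p e) < M)%N)).
apply: sub_all hZ => t /= /(@rhs_lt _ _ hH _ _ _ _ iL)/andP[i1 l1].
rewrite !shw_cat !inword_cat !wt_cat iT i1 iB /=; lia.
Qed.

(** A resolvable ambiguity of weight at most M is an identity of operators: after
    the first step on either side only diagrams of weight less than M occur. *)
Lemma resolvable_run v w u1 u1' u2 u2' (T1 : diag u1' w) (L1 : diag u1 u1')
    (B1 : diag v u1) (T2 : diag u2' w) (L2 : diag u2 u2') (B2 : diag v u2) k1 k2 :
  resolvable T1 L1 B1 T2 L2 B2 -> expr L1 = lhs k1 -> expr L2 = lhs k2 ->
  undecorated T1 -> undecorated B1 -> undecorated T2 -> undecorated B2 ->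
  inword n (shw p (expr (T1 ** L1 ** B1))) ->
  (m + wt n (shw p (expr (T1 ** L1 ** B1))) <= M)%N ->
  inword n (shw p (expr (T2 ** L2 ** B2))) ->
  (m + wt n (shw p (expr (T2 ** L2 ** B2))) <= M)%N ->
  (padp p (1 : Rw w) : D) *:
     run s (shw p (expr T1)) (rhs_op s k1 p (run s (shw p (expr B1)) x)) =
  (padp p (1 : Rw w) : D) *:
     run s (shw p (expr T2)) (rhs_op s k2 p (run s (shw p (expr B2)) x)).
Proof.
case=> Z1 [Z2 [h1 h2 hj]] e1 e2 uT1 uB1 uT2 uB2 i1 l1 i2 l2.
have lhs_inj k k' : lhs k = lhs k' -> k = k' by case: k k' => -[].
have [k [ek _]] := side_run h1 uT1 uB1.
have [k' [ek' _]] := side_run h2 uT2 uB2.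
rewrite e1 in ek; rewrite e2 in ek'; rewrite -(lhs_inj _ _ ek) -(lhs_inj _ _ ek') => <- <-.
apply: (joinable_sound hP (ok := @low _ H n M m p v w) _ _ hj).
- by move=> d Z hd hl; exact: (low_step hP hx hd hl).
- by move=> d; rewrite /low expr_undot.
- exact: low_side h1 i1 l1.
exact: low_side h2 i2 l2.
Qed.
End Run.
End Overlaps.

Section Overlaps.
Variables (kk : comPzRingType) (H : heckeData kk).
Local Notation I := (color H).
Local Notation Rw := (dots (@dotalg kk H)).
Local Notation K := (dotfam H).
Hypothesis hH : dot_axioms H.
Local Notation D := (dotsys hH).

Lemma mvPw_split p j e P (w : seq I) : mvPw (shw p (j :: e)) P w ->
  exists a w', [/\ w = a ++ w', size a = p & mvPw (j :: e) (fun u => P (a ++ u)) w'].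
Proof.
elim: p P w => [|p ih] P [|k w].
- by rewrite /shw map_id_in // => h; exists [::], [::].
- by rewrite /shw map_id_in // => h; exists [::], (k :: w).
- by [].
rewrite mvPw_S => /ih[a [w' [-> <- h]]].
by exists (k :: a), w'.
Qed.

Lemma mvw1 e : @mvw D e 1 = @ind kk H (mvPw e predT).
Proof. by rewrite -(mvKw_ind hH) -(ind1 H). Qed.

Section Words.
Variables (T : finType).
Local Notation V := {ffun T -> D^o}.

Lemma ffunZ (f : D) (x : V) c : (f *: x) c = f * x c :> D.
Proof. by rewrite ffunE. Qed.

(** Ambiguities are resolved for given colors, and so give equations multiplied by
    the idempotents [padp p 1].  These equations suffice, because both vectors
    vanish at the colorings for which the words are not permissible. *)
Lemma eq_words p i1 e1 i2 e2 (y1 y2 : V) :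
  @mvw D (shw p (i1 :: e1)) 1 *: y1 = y1 ->
  @mvw D (shw p (i2 :: e2)) 1 *: y2 = y2 ->
  (forall w, mvPw (i1 :: e1) predT w \/ mvPw (i2 :: e2) predT w ->
    exists u b, w = u ++ b /\
      (padp p (1 : Rw u) : D) *: y1 = (padp p (1 : Rw u) : D) *: y2) ->
  y1 = y2.
Proof.
move=> h1 h2 h; apply/ffunP => c; apply: dotfamP => w.
have sup (y : V) i e : @mvw D (shw p (i :: e)) 1 *: y = y ->
    mvPw (shw p (i :: e)) predT w = false -> (y c : K) w = 0.
  move=> <- hw; rewrite ffunZ mvw1 -[LHS]/((ind _ * (y c : K) : K) w) famM.
  by rewrite /ind hw mul0r.
have on i e : mvPw (shw p (i :: e)) predT w ->
    (forall w', mvPw (i :: e) predT w' -> exists u b, w' = u ++ b /\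
      (padp p (1 : Rw u) : D) *: y1 = (padp p (1 : Rw u) : D) *: y2) ->
    (y1 c : K) w = (y2 c : K) w.
  move=> /mvPw_split[a [w' [-> ha hw']]] /(_ _ hw')[u [b [-> e12]]].
  move: (congr1 (fun y : V => (y c : K) (a ++ u ++ b)) e12); rewrite !ffunZ.
  rewrite -[X in X = _ -> _]/((padp p (1 : Rw u) * (y1 c : K) : K) (a ++ u ++ b)).
  rewrite -[X in _ = X -> _]/((padp p (1 : Rw u) * (y2 c : K) : K) (a ++ u ++ b)).
  by rewrite !famM padp1 // !mul1r.
case hw1: (mvPw (shw p (i1 :: e1)) predT w).
  by apply: on hw1 _ => w' hw'; apply: h; left.
case hw2: (mvPw (shw p (i2 :: e2)) predT w).
  by apply: on hw2 _ => w' hw'; apply: h; right.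
by rewrite (sup _ _ _ h1) // (sup _ _ _ h2).
Qed.
End Words.

Let id1 : @idem D 1 := @idem1 D.

Section Support.
Variables (V : lmodType D) (s : nat -> V -> V).
Hypothesis hs : twisted s.

Definition supp (e : word) (y : V) := @mvw D e 1 *: y = y.
Lemma supp_nil y : supp [::] y.
Proof. exact: scale1r. Qed.
Lemma supp_s j e y : supp e y -> supp (j :: e) (s j y).
Proof.
by rewrite /supp => h; rewrite -[in RHS]h s_idem //; apply: idem_mvw.
Qed.
Lemma supp_rhs q j e y : supp e y -> supp (shw j (lhs q) ++ e) (rhs_op s q j y).
Proof.
by rewrite /supp => h; rewrite -[in RHS]h rhs_op_idem ?mvw_cat //; apply: idem_mvw.
Qed.
End Support.

Ltac shw_simpl := rewrite /shw /= ?addn0 ?addn1 ?addn2.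
Ltac find_color := first [by case | case: ifP => ? //=; last by case].
Ltac overlap_goal hM := rewrite /= ?addn0 ?addn1 ?addn2; apply => //;
  rewrite /inword /wt /=; move: hM; rewrite /wt /=; lia.

Lemma sss_resolves : overlap_sss H ->
  forall (T : finType) n (s : nat -> {ffun T -> D^o} -> {ffun T -> D^o})
      Fl M j m x, pact n s Fl M -> Fl m x -> (j + 1 < n)%N ->
    (m + wt n (shw j [:: 0; 0; 0]%N) <= M)%N ->
    rhs_op s false j (s j x) = s j (rhs_op s false j x).
Proof.
move=> hO T n s Fl M p m x hP hx hj hM; have hs := pact_semi hP.
apply: (@eq_words T p 0%N [:: 0; 0]%N 0%N [:: 0; 0]%N).
- by have := supp_rhs hs false p (supp_s hs p (supp_nil x)); shw_simpl.
- by have := supp_s hs p (supp_rhs hs false p (supp_nil x)); shw_simpl.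
move=> [|u [|v b]]; rewrite /= /mvP /=; do ?find_color.
move=> _; exists [:: u; v], b; split=> //.
have puv : permitted u v by []. have pvu : permitted v u by [].
have := @resolvable_run _ _ hH _ n M m p s Fl hP x hx _ _ _ _ _ _ _ _ _ _ _ _
  false false (hO v u pvu puv).
overlap_goal hM.
Qed.

Lemma ssts_resolves : overlap_ssts H ->
  forall (T : finType) n (s : nat -> {ffun T -> D^o} -> {ffun T -> D^o})
      Fl M j m x, pact n s Fl M -> Fl m x -> (j + 2 < n)%N ->
    (m + wt n (shw j [:: 0; 0; 1; 0]%N) <= M)%N ->
    rhs_op s false j (s j.+1 (s j x)) = s j (rhs_op s true j x).
Proof.
move=> hO T n s Fl M p m x hP hx hj hM; have hs := pact_semi hP.
apply: (@eq_words T p 0%N [:: 0; 1; 0]%N 0%N [:: 0; 1; 0]%N).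
- by have := supp_rhs hs false p (supp_s hs p.+1 (supp_s hs p (supp_nil x))); shw_simpl.
- by have := supp_s hs p (supp_rhs hs true p (supp_nil x)); shw_simpl.
move=> [|u [|v [|w b]]]; rewrite /= /mvP /=; do ?find_color.
move=> _; exists [:: u; v; w], b; split=> //.
have pwu : permitted w u by []. have pwv : permitted w v by [].
have puv : permitted u v by []. have pvu : permitted v u by [].
have := @resolvable_run _ _ hH _ n M m p s Fl hP x hx _ _ _ _ _ _ _ _ _ _ _ _
  false true (hO w u v pwu pwv puv pvu).
overlap_goal hM.
Qed.

Lemma stss_resolves : overlap_stss H ->
  forall (T : finType) n (s : nat -> {ffun T -> D^o} -> {ffun T -> D^o})
      Fl M j m x, pact n s Fl M -> Fl m x -> (j + 2 < n)%N ->
    (m + wt n (shw j [:: 0; 1; 0; 0]%N) <= M)%N ->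
    rhs_op s true j (s j x) = s j (s j.+1 (rhs_op s false j x)).
Proof.
move=> hO T n s Fl M p m x hP hx hj hM; have hs := pact_semi hP.
apply: (@eq_words T p 0%N [:: 1; 0; 0]%N 0%N [:: 1; 0; 0]%N).
- by have := supp_rhs hs true p (supp_s hs p (supp_nil x)); shw_simpl.
- by have := supp_s hs p (supp_s hs p.+1 (supp_rhs hs false p (supp_nil x))); shw_simpl.
move=> [|u [|v [|w b]]]; rewrite /= /mvP /=; do ?find_color.
move=> _; exists [:: u; v; w], b; split=> //.
have pvw : permitted v w by []. have pwv : permitted w v by [].
have pvu : permitted v u by []. have pwu : permitted w u by [].
have := @resolvable_run _ _ hH _ n M m p s Fl hP x hx _ _ _ _ _ _ _ _ _ _ _ _
  true false (hO v w u pvw pwv pvu pwu).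
overlap_goal hM.
Qed.

Lemma ststs_resolves : overlap_ststs H ->
  forall (T : finType) n (s : nat -> {ffun T -> D^o} -> {ffun T -> D^o})
      Fl M j m x, pact n s Fl M -> Fl m x -> (j + 2 < n)%N ->
    (m + wt n (shw j [:: 0; 1; 0; 1; 0]%N) <= M)%N ->
    rhs_op s true j (s j.+1 (s j x)) = s j (s j.+1 (rhs_op s true j x)).
Proof.
move=> hO T n s Fl M p m x hP hx hj hM; have hs := pact_semi hP.
apply: (@eq_words T p 0%N [:: 1; 0; 1; 0]%N 0%N [:: 1; 0; 1; 0]%N).
- by have := supp_rhs hs true p (supp_s hs p.+1 (supp_s hs p (supp_nil x))); shw_simpl.
- by have := supp_s hs p (supp_s hs p.+1 (supp_rhs hs true p (supp_nil x))); shw_simpl.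
move=> [|u [|v [|w b]]]; rewrite /= /mvP /=; do ?find_color.
move=> _; exists [:: u; v; w], b; split=> //.
have puw : permitted u w by []. have puv : permitted u v by [].
have pwv : permitted w v by []. have pwu : permitted w u by [].
have pvu : permitted v u by [].
have := @resolvable_run _ _ hH _ n M m p s Fl hP x hx _ _ _ _ _ _ _ _ _ _ _ _
  true true (hO u w v puw puv pwv pwu pvu).
overlap_goal hM.
Qed.

Lemma stsuts_resolves : overlap_stsuts H ->
  forall (T : finType) n (s : nat -> {ffun T -> D^o} -> {ffun T -> D^o})
      Fl M j m x, pact n s Fl M -> Fl m x -> (j + 3 < n)%N ->
    (m + wt n (shw j [:: 0; 1; 0; 2; 1; 0]%N) <= M)%N ->
    rhs_op s true j (s j.+2 (s j.+1 (s j x))) =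
    s j (s j.+1 (s j.+2 (rhs_op s true j x))).
Proof.
move=> hO T n s Fl M p m x hP hx hj hM; have hs := pact_semi hP.
apply: (@eq_words T p 0%N [:: 1; 0; 2; 1; 0]%N 0%N [:: 1; 2; 0; 1; 0]%N).
- by have := supp_rhs hs true p (supp_s hs p.+2 (supp_s hs p.+1 (supp_s hs p (supp_nil x)))); shw_simpl.
- by have := supp_s hs p (supp_s hs p.+1 (supp_s hs p.+2 (supp_rhs hs true p (supp_nil x)))); shw_simpl.
move=> [|u [|v [|w [|t b]]]]; rewrite /= /mvP /=;
  try by case; do ?(case: ifP => ? //=).
move=> hp; exists [:: u; v; w; t], b; split=> //.
have [ptw ptv ptu] : [/\ permitted t w, permitted t v & permitted t u].
  by case: hp; do ?(case: ifP => ? //=).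
have [pwv pwu pvu] : [/\ permitted w v, permitted w u & permitted v u].
  by case: hp; do ?(case: ifP => ? //=).
have := @resolvable_run _ _ hH _ n M m p s Fl hP x hx _ _ _ _ _ _ _ _ _ _ _ _
  true true (hO t w v u ptw ptv ptu pwv pwu pvu).
overlap_goal hM.
Qed.

End Overlaps.

(** * Dots below the left-hand side of a relation *)

Ltac color_case := case: ifP => //= ?.

Section Dots.
Variables (kk : comPzRingType) (H : heckeData kk).
Local Notation I := (color H).
Local Notation Rw := (dots (@dotalg kk H)).
Local Notation crossing := (@crossing kk H).
Local Notation diag := (@diag kk H).
Local Notation K := (dotfam H).
Local Notation "x ** y" := (dcomp x y)
  (at level 40, y at level 40, right associativity).
Hypothesis hH : dot_axioms H.
Local Notation D := (dotsys hH).

Lemma dotstep_step v w (d : diag v w) Z : dotstep d Z -> exists u u' (T : diag u' w)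
    (c : crossing u u') f Z0 (B : diag v u),
  [/\ d = T ** cdiag c ** dot f ** B, Z = lcomp T Z0 B, dotrule (cdiag c) f Z0
    & all (fun t => (expr t.2 == expr (cdiag c)) || (expr t.2 == [::])) Z0].
Proof.
case=> u u' T s f Z0 B h; have [c [e hZ]] := dotrule_cdiag h.
by rewrite e in h hZ *; exists u, u', T, c, f, Z0, B.
Qed.

Lemma left_comp v w u u' (T : diag u' w) (L : diag u u') (B : diag v u) :
  undecorated L -> expr L != [::] -> left_diag (T ** L ** B) -> undecorated B.
Proof.
have h u1 (c : crossing u1 u') (L' : diag u u1) (T' : diag u' w) :
    left_diag (T' ** (cdiag c ** L') ** B) -> undecorated B.
  by move=> /left_cross; rewrite undec_comp => /andP[].
by case: L T h => //= u1 u2 c L' T h _ _; apply: (h _ c L').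
Qed.
Lemma far_expr v w (d d' : diag v w) : far d d' -> exists e1 e2 i j,
  [/\ (i.+1 < j)%N, expr d = e1 ++ [:: i; j] ++ e2 & expr d' = e1 ++ [:: j; i] ++ e2].
Proof.
case=> a x y c z u e pxy pzu T B s.
exists (expr T), (expr B), (size a), (size a + (size c).+2)%N.
rewrite /s !expr_comp !expr_dshift !expr_comp !expr_dshift /= /shw /= !addn0.
by split=> //; lia.
Qed.
Lemma lhs_no_far (k : bool) e1 e2 i j :
  farl i j -> e1 ++ [:: i; j] ++ e2 = lhs k -> False.
Proof.
rewrite /farl => hij he; have := congr1 size he; rewrite !size_cat /=.
by case: k he; case: e1 => [|a [|b [|c e1]]] //= [] *; subst; lia.
Qed.

Lemma swapw_crossing v w (c : crossing v w) a b :
  swapw (size a + height c) (a ++ w ++ b) = Some (a ++ v ++ b).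
Proof.
elim: a => [|k a ih] /=; last first.
  by case: (a ++ w ++ b) ih => [|x w1] ->.
elim: c => {v w} [i j b' pij|k v w c ih] /=; first by rewrite pij.
by rewrite ih; case: (w ++ b) ih.
Qed.
Lemma mvPw_diag v w (d : diag v w) a b : undecorated d ->
  mvPw (shw (size a) (expr d)) (pred1 (a ++ v ++ b)) (a ++ w ++ b).
Proof.
by elim: d => [|//|u u' c d ih] /=; rewrite ?eqxx // /mvP swapw_crossing.
Qed.

Section Twist.
Variables (V : lmodType D) (s : nat -> V -> V).
Hypothesis hs : twisted s.

Lemma dotstep_sound p v w (d : diag v w) Z x : dotstep d Z ->
  sem s p d x = semL s p Z x.
Proof.
case/dotstep_step => u [u' [T [c [f [Z0 [B [-> -> h _]]]]]]].
rewrite (semL_comp hs) -(dot_sound hs h (sem_top hs _ _ _)) !(sem_comp hs).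
by rewrite [sem s p (dot f) _]/= (sem_top hs).
Qed.

Lemma run_inert e (f : D) y : {in e, forall i, inert i f} ->
  run s e (f *: y) = f *: run s e y.
Proof.
elim: e => //= j e ih h; rewrite ih; last by move=> i ie; apply: h; rewrite inE ie orbT.
by rewrite s_inert //; apply: h; rewrite inE eqxx.
Qed.
Lemma rhs_inert (q : bool) p (f : D) y : (forall i, (p <= i <= p + q)%N -> inert i f) ->
  rhs_op s q p (f *: y) = f *: rhs_op s q p y.
Proof.
move=> h; rewrite /rhs_op scaler_sumr !big_seq; apply: eq_bigr => r rq.
rewrite run_inert ?scalerA 1?mulrC // => i /mapP[j jr ->].
by apply: h; have [/allP/(_ _ jr) /= hj _] := rhs_word rq; case: (q) hj => /=; lia.
Qed.
End Twist.

Lemma padpM1 (V : lmodType D) p v (f : Rw v) (y : V) :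
  (padp p f : D) *: ((padp p (1 : Rw v) : D) *: y) = (padp p f : D) *: y.
Proof. by rewrite scalerA mulrC -scalerA padp1M. Qed.

Section Run.
Variables (V : lmodType D) (n M m p : nat) (s : nat -> V -> V) (Fl : nat -> V -> Prop).
Hypothesis hP : pact n s Fl M.
Variable x : V.
Hypothesis hx : Fl m x.
Let hs : twisted s := pact_semi hP.
Variable k : bool.
Hypothesis hk : (p + k.+1 < n)%N.
Hypothesis hM : (m + wt n (shw p (lhs k)) <= M)%N.
Hypothesis hrel : run s (shw p (lhs k)) x = rhs_op s k p x.

(** The diagrams that occur when a dot moves up through the left-hand side of a
    relation: those of small weight, and the left-hand side itself with dots at
    the top.  The relation at the latter is the hypothesis [hrel]. *)
Definition lhs_low v w (d : diag v w) : bool :=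
  low n M m p d || left_diag d && (expr d == lhs k).

Lemma lhs_in_lhs e1 e2 j k' : e1 ++ shw j (lhs k') ++ e2 = lhs k ->
  [/\ e1 = [::], e2 = [::], k' = k & j = 0%N].
Proof.
move=> e; have := congr1 size e; rewrite !size_cat.
case: k k' e => -[]; case: e1 => [|a [|b [|c e1]]] //=;
  case: e2 => [|a' [|b' [|c' e2]]] //= [] *; try lia;
  by split=> //; lia.
Qed.

Lemma lhs_low_step v w (d : diag v w) Z : step d Z -> lhs_low d ->
  sem s p d x = semL s p Z x /\ all (fun t => lhs_low t.2) Z.
Proof.
move=> hd; have lowW (r : seq _) : all (fun t => low n M m p t.2) r ->
    all (fun t : kk * diag v w => lhs_low t.2) r.
  by apply: sub_all => t ht; rewrite /lhs_low ht.
case/orP => [hl|/andP[hl /eqP he]].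
  by have [-> /lowW] := low_step hP hx hd hl.
case: hd hl he => {d Z}.
- move=> _ _ [a u u' T L Z B hL] hl.
  have [k' [eL uL]] := crossrule_kind hL; have [k'' [eL' hZ]] := crossrule_words hL.
  rewrite !expr_comp expr_dshift eL => /lhs_in_lhs[eT eB ek /eqP].
  rewrite size_eq0 => /eqP ea; have ek'' : k'' = k by move: eL'; rewrite eL ek; case: (k'') (k) => -[].
  subst k' a k''; rewrite /= in hl *.
  have uB : undecorated B by apply: left_comp hl => //; rewrite eL; case: (k).
  split.
    apply: (@cross_sound _ _ hH V s hs p v w [::] u u' T L Z B x hL) => k2.
    rewrite eL => ek; have {ek k2} -> : k2 = k by case: (k2) (k) ek => -[].
    rewrite /= addn0 sem_undec // eB /=.
    by rewrite run_idem ?rhs_op_idem ?hrel //; apply: padp1_idem.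
  apply: lowW; rewrite /lcomp /Defs.lshift !all_map.
  apply: sub_all hZ => t /= /(@rhs_lt _ _ hH _ p k _ hk)/andP[i1 l1].
  rewrite /low !expr_comp eT eB cats0 /= i1 /=; lia.
- move=> u u' T s0 f Z B _ /dotrule_cdiag[c [-> _]] /left_cross.
  by rewrite undec_comp.
- move=> u T f g B hl he; have /andP[_] := left_dot (1 : Rw u) hl.
  move=> /(left_dot (f * g))/andP[hl' _]; rewrite semL1 /= andbT /lhs_low hl'.
  move: he; rewrite !expr_comp /= => ->; rewrite eqxx orbT; split=> //.
  rewrite !(sem_comp hs) /= scalerA; congr (sem s p T (_ *: _)).
  by rewrite -[LHS]/(padp p f * padp p g : K) -padpM.
- move=> u T B hl he; have /andP[_ hl'] := left_dot (1 : Rw u) hl.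
  rewrite semL1 /= andbT /lhs_low hl'.
  move: he; rewrite !expr_comp /= => ->; rewrite eqxx orbT; split=> //.
  by rewrite !(sem_comp hs) /= (sem_top hs).
- move=> d d' /far_expr[e1 [e2 [i [j [hij e _]]]]] _; rewrite e => /lhs_no_far[].
  by rewrite /farl hij.
move=> d d' /far_expr[e1 [e2 [i [j [hij _ e]]]]] _; rewrite e => /lhs_no_far[].
by rewrite /farl hij orbT.
Qed.

Lemma dot_resolvable_run v w (L : diag v w) (f : Rw v) :
  dot_resolvable L f -> expr L = lhs k -> undecorated L ->
  (padp p (1 : Rw w) : D) *: run s (shw p (lhs k)) ((padp p f : D) *: x) =
  (padp p (1 : Rw w) : D) *: rhs_op s k p ((padp p f : D) *: x).
Proof.
case=> Z [Z' [hL hr hl hj]] eL uL.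
pose P e := (e == lhs k) ||
  (inword n (shw p e) && (wt n (shw p e) < wt n (shw p (lhs k)))%N).
have P_le e : P e -> inword n (shw p e) && (wt n (shw p e) <= wt n (shw p (lhs k)))%N.
  by case/orP => [/eqP->|/andP[-> /ltnW]] //; rewrite leqnn andbT inword_shw_lhs.
pose ok (d : diag v w) := P (expr d).
have okstep d Y : dotstep d Y -> ok d ->
    sem s p d x = semL s p Y x /\ all (fun t => ok t.2) Y.
  move=> hd o; split; first exact: (dotstep_sound hs).
  case/dotstep_step: hd o => u [u' [T [c [g [Y0 [B [-> -> _ hY]]]]]]] o.
  apply: (@all_comp _ _ _ _ _ _ _ _ _ P); apply: sub_all hY => t.
  move: o; rewrite /ok !expr_comp /= => o /orP[]/eqP-> //=.
  apply/orP; right; move: (P_le _ o).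
  rewrite !shw_cat !inword_cat !wt_cat /= wt_cons.
  case/andP=> /and3P[-> hc ->] /=.
  by move: hc; lia.
have [|eZ oZ] := reduces_sound hP okstep hr.
  by rewrite /= andbT /ok expr_comp /= cats0 eL /P eqxx.
transitivity (sem s p (L ** dot f) x).
  by rewrite (sem_comp hs) (@run_undec _ _ hH V n M p s Fl hP) // eL /= padpM1.
rewrite -(semL1 _ p (L ** dot f)) eZ.
transitivity (semL s p (lcomp (dnil w) Z (dot f)) x); last first.
  rewrite (semL_comp hs) /= padpM1 -[in LHS](padp1M p f).
  have [k' [eL' _ ->]] := @rule_run _ _ hH _ n M p s Fl hP v w L Z ((padp p f : D) *: x) hL.
  have -> : k' = k by move: eL'; rewrite eL; case: (k') (k) => -[].
  by rewrite padp1M.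
symmetry; apply: (joinable_sound hP (ok := @lhs_low v w) _ _ hj).
- by move=> d Y; apply: lhs_low_step.
- by move=> d; rewrite /lhs_low /low /left_diag undotK expr_undot.
- rewrite /lcomp all_map; have [k' [eL' hZ]] := crossrule_words hL.
  have ek' : k' = k by move: eL'; rewrite eL; case: (k') (k) => -[].
  subst k'; apply: sub_all hZ => t /= /(@rhs_lt _ _ hH _ p k _ hk)/andP[i1 l1].
  by rewrite /lhs_low /low expr_comp /= cats0 i1 /=; apply/orP; left; lia.
have : all (predI (fun t => ok t.2) (fun t => undecorated (undot t.2))) Z'.
  by rewrite all_predI oZ.
apply: sub_all => t /andP[/= /orP[/eqP e|/andP[i1 l1]] ht]; rewrite /lhs_low /low.
  by rewrite e eqxx andbT /left_diag ht orbT.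
by rewrite i1 /=; apply/orP; left; lia.
Qed.
End Run.

(** Arbitrary dots f are treated coloring by coloring: there f is a sum of
    products of dots on the strands of the relation, covered by the ambiguity, and
    of dots on the other strands, which commute with everything. *)
Lemma dots_resolves : ambiguity_ssf H -> ambiguity_stsf H ->
  forall (T : finType) n (s : nat -> {ffun T -> D^o} -> {ffun T -> D^o})
      Fl M (k : bool) p m x f, pact n s Fl M -> Fl m x -> (p + k.+1 < n)%N ->
    (m + wt n (shw p (lhs k)) <= M)%N ->
    run s (shw p (lhs k)) x = rhs_op s k p x ->
    run s (shw p (lhs k)) (f *: x) = rhs_op s k p (f *: x).
Proof.
move=> h2 h3 T n s Fl M k p m x f hP hx hk hM hrel; have hs := pact_semi hP.
pose y1 (g : D) : {ffun T -> D^o} := run s (shw p (lhs k)) (g *: x).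
pose y2 (g : D) : {ffun T -> D^o} := rhs_op s k p (g *: x).
have y1D g g' : y1 (g + g') = y1 g + y1 g' by rewrite /y1 scalerDl runD.
have y2D g g' : y2 (g + g') = y2 g + y2 g' by rewrite /y2 scalerDl rhs_opD.
rewrite -/(y1 f) -/(y2 f).
have y1Z (g g' : D) : (forall i, (p <= i <= p + k)%N -> inert i g) ->
    y1 (g * g') = g *: y1 g'.
  move=> hg; rewrite /y1 -scalerA run_inert // => i /mapP[j jk ->].
  by apply: hg; case: (k) jk; rewrite !inE; lia.
have y2Z (g g' : D) : (forall i, (p <= i <= p + k)%N -> inert i g) ->
    y2 (g * g') = g *: y2 g'.
  by move=> hg; rewrite /y2 -scalerA rhs_inert.
have y1u (u g : D) : idem u -> y1 (u * g) = mvw (shw p (lhs k)) u *: y1 g.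
  by move=> hu; rewrite /y1 -scalerA run_idem.
have y2u (u g : D) : idem u -> y2 (u * g) = mvw (shw p (lhs k)) u *: y2 g.
  by move=> hu; rewrite /y2 -scalerA rhs_op_idem.
have typed v w (L : diag v w) (h : Rw v) : dot_resolvable L h ->
    expr L = lhs k -> undecorated L ->
    (padp p (1 : Rw w) : D) *: y1 (padp p h) = (padp p (1 : Rw w) : D) *: y2 (padp p h).
  by move=> hr eL uL; apply: (dot_resolvable_run hP hx hk hM hrel hr eL uL).
clearbody y1 y2.
(* decorations on the other strands commute with everything *)
have wide v w (L : diag v w) (a b : seq I) (r : Rw (a ++ v ++ b)) :
    size a = p -> size v = k.+2 -> (forall h, dot_resolvable L h) ->
    expr L = lhs k -> undecorated L ->
    (padp p (1 : Rw w) : D) *: y1 (delta r) = (padp p (1 : Rw w) : D) *: y2 (delta r).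
  move=> ha hv hr eL uL.
  have y10 : y1 0 = 0 by exact: additive0 y1D.
  have y20 : y2 0 = 0 by exact: additive0 y2D.
  elim/(@gen_ind kk I (@dotalg kk H) a (v ++ b)): r => [|r r' e e'|g r].
  - by rewrite delta0 y10 y20.
  - by rewrite deltaD y1D y2D !scalerDr e e'.
  elim/(@gen_ind kk I (@dotalg kk H) v b): r => [|r r' e e'|h t].
  - by rewrite tcat0r delta0 y10 y20.
  - by rewrite tcatDr deltaD y1D y2D !scalerDr e e'.
  have e : delta (tcat g (tcat h t)) =
      (pad g * shn (p + k.+2) (delta t : D)) * padp p h :> D.
    rewrite !delta_cat ha hv -[RHS]mulrA; congr (_ * _).
    by rewrite shKn_M mulrC /shn iterD.
  have hi i : (p <= i <= p + k)%N -> inert i (pad g * shn (p + k.+2) (delta t : D) : D).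
    by move=> hip; apply: inertM; [apply: inert_pad|apply: inert_sh2]; lia.
  rewrite e y1Z // y2Z // !scalerA ![padp p 1 * _]mulrC -!scalerA.
  by rewrite (typed _ _ L).
have key w : mvPw (lhs k) predT w -> exists v u b (L : diag v u), 
    [/\ w = u ++ b, size v = k.+2, forall h, dot_resolvable L h, expr L = lhs k &
     undecorated L].
  clear -h2 h3; case: k => /=.
    case: w => [|u [|v [|w b]]]; rewrite /= /mvP //=; do ?color_case.
    move=> _; have pwu : permitted w u by []. have pwv : permitted w v by [].
    have pvu : permitted v u by [].
    exists [:: w; v; u], [:: u; v; w], b, (sts [::] pwv pwu pvu); split=> // h; exact: h3.
  case: w => [|u [|v b]]; rewrite /= /mvP //=; do ?color_case.
  move=> _; have puv : permitted u v by []. have pvu : permitted v u by [].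
  exists [:: u; v], [:: u; v], b, (ss [::] puv pvu); split=> // h; exact: h2.
apply/ffunP => c; apply: dotfamP => w.
case hw: (mvPw (shw p (lhs k)) predT w); last first.
  have sup (y : D -> {ffun T -> D^o}) : y f = mvw (shw p (lhs k)) 1 *: y f ->
      (y f c : K) w = 0.
    move=> ->; rewrite ffunZ (mvw1 hH) -[LHS]/((ind _ * (y f c : K) : K) w) famM.
    by rewrite /ind hw mul0r.
  by rewrite !sup // -?y1u -?y2u ?mul1r //; apply: idem1.
have [j [e ek]] : exists j e, lhs k = j :: e by case: (k); [exists 0%N, [:: 1; 0]%N|exists 0%N, [:: 0]%N].
move: hw; rewrite ek => /mvPw_split[a [w' [ew ha]]]; rewrite -ek => /key.
case=> v [u [b [L [eu hv hr eL uL]]]]; subst w w'.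
have := wide v u L a b (f (a ++ v ++ b)) ha hv hr eL uL.
rewrite -delta_fam.
have hu : @idem D (delta (1 : Rw (a ++ v ++ b))) by exists (pred1 (a ++ v ++ b)); apply: delta1.
rewrite y1u // y2u //.
have one (z : D) :
    ((padp p (1 : Rw u) : D) * ((mvw (shw p (lhs k)) (delta (1 : Rw (a ++ v ++ b)) : D) : D) * z) : K)
      (a ++ u ++ b) = (z : K) (a ++ u ++ b).
  have -> : mvw (shw p (lhs k)) (delta (1 : Rw (a ++ v ++ b)) : D) =
      ind (mvPw (shw p (lhs k)) (pred1 (a ++ v ++ b))) :> K.
    by rewrite delta1 -(mvKw_ind hH).
  rewrite [LHS]famM [X in _ * X]famM padp1 // mul1r.
  by rewrite -eL -ha /ind mvPw_diag // mul1r.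
move/(congr1 (fun y : {ffun T -> D^o} => (y c : K) (a ++ u ++ b))).
by rewrite !ffunZ !one.
Qed.

End Dots.

(** * Multiplicativity of phi and the Leibniz rule *)

Section Toy.
Variables (kk : comPzRingType) (H : heckeData kk).
Local Notation I := (color H).
Local Notation Rw := (dots (@dotalg kk H)).
Local Notation crossing := (@crossing kk H).
Local Notation diag := (@diag kk H).
Local Notation lincomb := (@lincomb kk H).
Local Notation "x ** y" := (dcomp x y)
  (at level 40, y at level 40, right associativity).

(** Diagrams with at most one crossing, and at most one dot below it, are
    evaluated to the coefficients of the crossing and of the identity.  As the
    dot 1 is erased and never moved, it passes through the crossing unchanged
    here, whatever phi 1 and del 1 are.  The two sides of the ambiguity sfg only
    reduce to such diagrams, whence the axioms for phi and del. *)
Definition below v w u (c : crossing u w) (d : diag v u) : Rw w * Rw w :=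
  match d in @Defs.diag _ _ _ u0 return crossing u0 w -> Rw w * Rw w with
  | dnil => fun _ => (1, 0)
  | ddot u1 g _ => fun c0 => if g == 1 then (1, 0) else
      (cmap (phi H) c0 g, cmap (@del2 kk H) c0 g)
  | _ => fun _ => 0
  end c.
Definition thin v u (d : diag v u) : bool :=
  match d with
  | dnil => true
  | ddot _ _ d' => if d' is dnil then true else false
  | _ => false
  end.

Fixpoint toy v w (d : diag v w) : Rw w * Rw w :=
  match d with
  | dnil => (0, 1)
  | ddot _ f d' => (f * (toy d').1, f * (toy d').2)
  | dcross _ _ c d' => below c d'
  end.
Fixpoint tame v w (d : diag v w) : bool :=
  match d with
  | dnil => true
  | ddot _ _ d' => tame d'
  | dcross _ _ _ d' => thin d'
  end.
Definition toyact w (f : Rw w) (y : Rw w * Rw w) : Rw w * Rw w :=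
  (f * y.1, f * y.2).
Local Notation toyL := (evalL (@toyact _) (@toy _ _)).

Lemma thin_expr v u (d : diag v u) : thin d -> expr d = [::].
Proof. by case: d => //= u' f []. Qed.
Lemma tame_expr v w (d : diag v w) : tame d -> (size (expr d) <= 1)%N.
Proof. by elim: d => //= u u' c d _ /thin_expr ->. Qed.

Lemma toy_top v w (d : diag v w) : toy d = toyact (topdots d) (toy (undot d)).
Proof.
rewrite /toyact; elim: d => [|u f d ih|u u' c d ih] /=.
- by rewrite !mul1r.
- by rewrite ih /= !mulrA.
by rewrite !mul1r; case: (below c d).
Qed.

Lemma toyactDl w (a b : Rw w) y : toyact (a + b) y = toyact a y + toyact b y.
Proof. by rewrite /toyact !mulrDl. Qed.
Lemma toyactDr w (a : Rw w) y z : toyact a (y + z) = toyact a y + toyact a z.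
Proof. by rewrite /toyact !mulrDr. Qed.
Lemma toyact0 w (a : Rw w) : toyact a 0 = 0.
Proof. by rewrite /toyact !mulr0. Qed.
Lemma toyactM w (a b : Rw w) y : toyact a (toyact b y) = toyact (a * b) y.
Proof. by rewrite /toyact /= !mulrA. Qed.

Lemma toy_dots v w u (T : diag u w) (d : diag v u) (Z : lincomb v u) :
  expr T = [::] -> tame d -> toy d = toyL Z -> all (fun t => tame t.2) Z ->
  toy (T ** d) = toyL [seq (t.1, T ** t.2) | t <- Z] /\
  all (fun t => tame t.2) [seq (t.1, T ** t.2) | t <- Z].
Proof.
move=> + hd e oZ; elim: T d Z hd e oZ => [|u' f T ih|] //= d Z hd e oZ eT.
  rewrite e all_map; split=> //; rewrite [RHS]big_map.
  by apply: eq_bigr.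
have [-> h2] := ih d Z hd e oZ eT; split; last by move: h2; rewrite !all_map.
rewrite /evalL !big_map.
rewrite -[LHS]/(toyact f _) (big_morph (toyact f) (toyactDr f) (toyact0 f)).
by apply: eq_bigr => t _; rewrite /toyact /= !(mulrCA f).
Qed.

Lemma tame_cross v w u u' (T : diag u' w) (c : crossing u u') (d : diag v u) :
  tame (T ** cdiag c ** d) -> expr T = [::] /\ thin d.
Proof.
by elim: T => //= u1 u2 c' T _; case: T c' => [|u3 h T|] //= c'; case: T h c'.
Qed.
Lemma tame_dots v w u (T : diag u w) f g (B : diag v u) :
  tame (T ** dot f ** dot g ** B) -> expr T = [::].
Proof. by elim: T => //= u1 u2 c' T _; case: T c' => [|u3 h T|] //= c'; case: T h c'. Qed.
Lemma tame_comp v w u (T : diag u w) (B : diag v u) :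
  expr T = [::] -> tame (T ** B) = tame B.
Proof. by elim: T. Qed.
Lemma toyL1 v w (d : diag v w) : toyL [:: (1, d)] = toy d.
Proof. by apply: evalL1; [apply: toyactM | apply: toy_top]. Qed.
Lemma toy_unit v w u (T : diag u w) (B : diag v u) : tame (T ** dot 1 ** B) ->
  toy (T ** dot 1 ** B) = toy (T ** B) /\ tame (T ** B).
Proof.
elim: T => [|u1 f T ih|u1 u2 c T _] /=; rewrite ?mul1r.
- by case: (toy B).
- by move=> /ih[-> ->].
case: T c => [|? f T|//] /= c; last by case: T f c.
by case: B c => //= c; rewrite eqxx.
Qed.

Lemma dotrule_toy v w (d : diag v w) f Z : dotrule d f Z -> f <> 1 ->
  toy (d ** dot f) = toyL Z /\ all (fun t => tame t.2) Z.
Proof.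
move=> hs /eqP/negbTE f1; case: hs f1 => {v w d f Z} [a i b c f|a i j b c f ij] f1.
  rewrite -[cross b c]/(cdiag (crossing0 b c)) dshift_cdiag /= f1; split=> //.
  rewrite /evalL !big_cons big_nil addr0 /= !rmorph1.
  rewrite !cmap_shift; try exact: phi_linear; try exact: del2_klin.
  rewrite (_ : @del2 kk H i i = del H i); last by apply: funext; apply: del2_id.
  by rewrite /toyact /= !mul1r !mulr1 !mulr0; congr (_, _); rewrite /= ?addr0 ?add0r.
rewrite -[cross b c]/(cdiag (crossing0 b c)) dshift_cdiag /= f1; split=> //.
rewrite /evalL big_seq1 rmorph1 cmap_shift; try exact: phi_linear.
rewrite cdel_neq //; last by rewrite eqseq_cat // eqxx /= eqseq_cons (negbTE ij).
by rewrite /toyact /= !mul1r mulr1 mulr0.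
Qed.

Lemma toy_step v w (d : diag v w) Z : step d Z -> tame d ->
  toy d = toyL Z /\ all (fun t => tame t.2) Z.
Proof.
case=> {d Z}.
- move=> _ _ [a u u' T L Z B hL] /tame_expr.
  have [k [eL _]] := crossrule_kind hL.
  by rewrite !expr_comp expr_dshift eL !size_cat; case: (k) => /=; lia.
- move=> u u' T s f Z B f1 hs ht.
  have [c [es _]] := dotrule_cdiag hs; rewrite es in ht.
  have [eT {}ht] := tame_cross ht.
  clear c es; case: B s f Z f1 hs ht => [|//|//] s f Z f1 hs _.
  have [e oZ] := dotrule_toy hs f1.
  have os : tame (s ** dot f) by have [c [-> _]] := dotrule_cdiag hs.
  have -> : lcomp T Z (dnil v) = [seq (t.1, T ** t.2) | t <- Z].
    by apply: eq_map => t; rewrite dcomp1.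
  exact: (toy_dots eT os e oZ).
- move=> u T f g B ht; have eT := tame_dots ht.
  have hB : tame B by move: ht; rewrite tame_comp.
  apply: (@toy_dots _ _ _ T (dot f ** dot g ** B) [:: (1, dot (f * g) ** B)]) => //=.
    by rewrite toyL1 /= !mulrA.
  by rewrite hB.
- move=> u T B /toy_unit[-> ht]; rewrite /= ht; split=> //.
  by rewrite toyL1.
- move=> d d' /far_expr[e1 [e2 [i [j [_ e _]]]]] /tame_expr.
  by rewrite e !size_cat /=; lia.
move=> d d' /far_expr[e1 [e2 [i [j [_ _ e]]]]] /tame_expr.
by rewrite e !size_cat /=; lia.
Qed.

Lemma toy_joinable v w (X Y : lincomb v w) : joinable X Y ->
  all (fun t => tame t.2) X -> all (fun t => tame t.2) Y -> toyL X = toyL Y.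
Proof.
apply: (@eval_joinable _ _ v w _ (@toyact w) (@toy v w) (@tame v w)).
- exact: toyactDl.
- exact: toyactDr.
- exact: toyactM.
- exact: toy_top.
- exact: toy_step.
by elim.
Qed.

Lemma tcat2_1 x y (f : Rw [:: x; y]) : tcat f (1 : Rw [::]) = f.
Proof.
elim/tens_ind: f => [|f g ef eg|r f]; first exact: (@tcat0l _ _ _ [:: x; y] [::]).
  have := @tcatDl kk I (@dotalg kk H) [:: x; y] [::] f g 1; rewrite ef eg; exact.
rewrite tcat_pure; congr tpure; elim/tens_ind: f => [|f g ef eg|r' c].
- exact: (@tcat0l _ _ _ [:: y] [::]).
- by have := @tcatDl kk I (@dotalg kk H) [:: y] [::] f g 1; rewrite ef eg; exact.
by rewrite tcat_pure /= mulr1.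
Qed.
Lemma cmap_height (phi2 : forall i j : I, Rw [:: i; j] -> Rw [:: j; i]) v w (c c' : crossing v w) f : height c = height c' ->
  cmap phi2 c f = cmap phi2 c' f.
Proof.
have famE := famactE phi2.
move=> e; have := famE _ _ c (delta f); rewrite e famE !delta_id.
by move->.
Qed.
Lemma cmap_cross0 (phi2 : forall i j : I, Rw [:: i; j] -> Rw [:: j; i]) x y (p : permitted x y) f :
  (forall i j, klinear (phi2 i j)) ->
  cmap phi2 (crossing0 [::] p) f = phi2 x y f.
Proof.
move=> hphi; have := cmap_crossing0 hphi p f (1 : Rw [::]).
by rewrite !tcat2_1.
Qed.

Lemma dotrule_below v w (d : diag v w) f Z g : dotrule d f Z ->
  exists c : crossing v w, [/\ d = cdiag c,
  all (fun t => tame t.2) (lcomp (dnil _) Z (dot g)) &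
  toyL (lcomp (dnil _) Z (dot g)) =
  (cmap (phi H) c f * (below c (dot g)).1,
   cmap (phi H) c f * (below c (dot g)).2 + cmap (@del2 kk H) c f * castw w g)].
Proof.
move=> hd; case: hd g => {v w d f Z} [a i b c f|a i j b c f ij] g.
  exists (cshift a (crossing0 b c)); rewrite -dshift_cdiag -[cross b c]/(cdiag (crossing0 b c)) dshift_cdiag; split=> //.
  rewrite /evalL !big_cons big_nil addr0 !rmorph1.
  rewrite !cmap_shift; try exact: phi_linear; try exact: del2_klin.
  rewrite (_ : @del2 kk H i i = del H i); last by apply: funext; apply: del2_id.
  rewrite castw_id /toyact /=.
  by rewrite !mul1r !mulr1 !mulr0; congr (_, _); rewrite /= ?addr0 ?add0r.
exists (cshift a (crossing0 b c)); rewrite -dshift_cdiag -[cross b c]/(cdiag (crossing0 b c)) dshift_cdiag; split=> //.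
rewrite /evalL big_seq1 rmorph1 cdel_neq; last first.
  by rewrite eqseq_cat // eqxx /= eqseq_cons (negbTE ij).
rewrite !cmap_shift; try exact: phi_linear.
by rewrite /toyact /= !mul1r mul0r addr0.
Qed.

Lemma sfg_axioms : ambiguity_sfg H -> dot_axioms H.
Proof.
move=> hO.
pose phi' x y (g : Rw [:: x; y]) := if g == 1 then 1 else phi H x y g.
pose del' x y (g : Rw [:: x; y]) := if g == 1 then 0 else @del2 kk H x y g.
have belowE x y (p : permitted x y) g :
    below (crossing0 [::] p) (dot g) = (phi' x y g, del' x y g).
  rewrite -[LHS]/(if g == 1 then (1, 0) else (cmap (phi H) (crossing0 [::] p) g,
    cmap (@del2 kk H) (crossing0 [::] p) g)) /phi' /del'; case: eqP => // _.
  by rewrite !cmap_cross0 //; [apply: del2_klin|apply: phi_linear].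
have key x y (p : permitted x y) f g :
    phi' x y (f * g) = phi H x y f * phi' x y g /\
    del' x y (f * g) = phi H x y f * del' x y g + @del2 kk H x y f * castw [:: y; x] g.
  have [Z hZ hj] := hO x y p f g.
  have [c [ec ht e1]] := dotrule_below g hZ.
  have e : toyL [:: (1, cross [::] p ** dot (f * g))] = toyL (lcomp (dnil _) Z (dot g)).
    exact: toy_joinable.
  move: e; rewrite e1.
  have hc : height c = height (crossing0 [::] p).
    by have := congr1 (@expr _ _ _ _) ec; case.
  have e2 (phi2 : forall i j : I, Rw [:: i; j] -> Rw [:: j; i]) h :
      (forall i j, klinear (phi2 i j)) -> cmap phi2 c h = phi2 x y h.
    by move=> hphi; rewrite (cmap_height _ _ hc) cmap_cross0.
  have -> : below c (dot g) = (phi' x y g, del' x y g).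
    rewrite -belowE.
    rewrite -[LHS]/(if g == 1 then (1, 0) else (cmap (phi H) c g, cmap (@del2 kk H) c g)).
    rewrite -[RHS]/(if g == 1 then (1, 0) else (cmap (phi H) (crossing0 [::] p) g,
    cmap (@del2 kk H) (crossing0 [::] p) g)).
    by rewrite !(cmap_height _ _ hc).
  rewrite !e2; try exact: phi_linear; try exact: del2_klin.
  by rewrite toyL1 [toy _]belowE => -[-> ->].
have phi1 x y (p : permitted x y) : phi H x y 1 = 1.
  by have [] := key x y p 1 1; rewrite /phi' mulr1 eqxx mulr1.
have del1 x y (p : permitted x y) : @del2 kk H x y 1 = 0.
  have [_] := key x y p 1 1; rewrite /del' mulr1 eqxx mulr0 add0r.
  have [exy|ne] := eqVneq x y; last by rewrite del2_neq.
  by subst y; rewrite castw_id mulr1.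
have phi'E x y (p : permitted x y) g : phi' x y g = phi H x y g.
  by rewrite /phi'; case: eqP => // ->; rewrite phi1.
have del'E x y (p : permitted x y) g : del' x y g = @del2 kk H x y g.
  by rewrite /del'; case: eqP => // ->; rewrite del1.
split=> [i j p f g|i j p|i p f g|i p].
- by have [] := key i j p f g; rewrite !phi'E.
- exact: phi1.
- by have [_] := key i i p f g; rewrite !del'E // !del2_id castw_id.
by rewrite -del2_id del1.
Qed.

End Toy.

(** * Action of the category *)

Section HomSound.
Variables (kk : comPzRingType) (H : heckeData kk).
Local Notation I := (color H).
Local Notation Rw := (dots (@dotalg kk H)).
Local Notation diag := (@diag kk H).
Local Notation lincomb := (@lincomb kk H).
Local Notation K := (dotfam H).
Hypothesis hH : dot_axioms H.
Local Notation D := (dotsys hH).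

Lemma resolves_dotsys :
  [/\ overlap_sss H, overlap_ssts H, overlap_stss H, overlap_ststs H
    & overlap_stsuts H] -> ambiguity_ssf H -> ambiguity_stsf H -> resolves D.
Proof.
case=> h1 h2 h3 h4 h5 h6 h7; split.
- exact: sss_resolves.
- exact: ssts_resolves.
- exact: stss_resolves.
- exact: ststs_resolves.
- exact: stsuts_resolves.
exact: dots_resolves.
Qed.

Variables (V : lmodType D) (n m : nat) (s : nat -> V -> V) (Fl : nat -> V -> Prop).
Hypothesis hP : forall M, pact n s Fl M.
Variable x : V.
Hypothesis hx : Fl m x.
Let hs : twisted s := pact_semi (hP 0).

Lemma low_all v w (d : diag v w) : size v = n ->
  low n (m + wt n (shw 0 (expr d))).+1 m 0 d.
Proof.
move=> hv; rewrite /low ltnSn andbT /shw map_id -hv.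
exact: expr_inword.
Qed.

Lemma slide_sound p a i j b (pij : permitted i j) (g : Rw a) (h : Rw b) (y : V) :
  (padp p (1 : Rw (a ++ i :: j :: b)) : D) *: y = y ->
  sem s p (dshift a (cross b pij))
    (sem s p (dot (tcat g (tcat (1 : Rw [:: i; j]) h) : Rw (a ++ i :: j :: b))) y) =
  sem s p (dot (tcat g (tcat (1 : Rw [:: j; i]) h) : Rw (a ++ j :: i :: b)))
    (sem s p (dshift a (cross b pij)) y).
Proof.
move=> hy; rewrite -[cross b pij]/(cdiag (crossing0 b pij)) dshift_cdiag /=.
rewrite !hy padp1M s_padp // !cmap_shift; try exact: phi_linear; try exact: del2_klin.
have e1 := @textE kk I (@dotalg kk H) a b [:: i; j] [:: j; i] (phi H i j) g 1 h (phi_linear i j).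
have e2 := @textE kk I (@dotalg kk H) a b [:: i; j] [:: j; i] (@del2 kk H i j) g 1 h (@del2_klin _ _ i j).
rewrite e1 e2 (phi_one hH) //.
have -> : @del2 kk H i j 1 = 0.
  have [e|ne] := eqVneq i j; last by rewrite del2_neq.
  by subst j; rewrite del2_id (del_one hH).
rewrite (@tcat0l _ _ _ [:: j; i] b) tcat0r padp0 scale0r addr0; congr (_ *: _).
by rewrite -s_padp1 // hy.
Qed.

(** Each generator of the congruence is a reduction step, or a consequence of the
    linearity of the action and of phi 1 = 1 and del 1 = 0. *)
Lemma hom_sound v w (X Y : lincomb v w) : size v = n -> hom_eq X Y ->
  semL s 0 X x = semL s 0 Y x.
Proof.
move=> hv; elim=> {X Y}.
- by [].
- by move=> X Y _ ->.
- by move=> X Y Z _ -> _ ->.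
- by move=> X X' Y Y' _ e _ e'; rewrite !semL_cat e e'.
- by move=> X Y; rewrite !semL_cat addrC.
- by move=> c X Y _ e; rewrite !semL_scale e.
- move=> d; rewrite /semL big_seq1 big_nil /=.
  rewrite (_ : @scalK kk H 0 = 0 :> D) ?scale0r //.
  by apply: dotfamP => u; rewrite /scalK rmorph0.
- move=> c c' d; rewrite /semL !big_cons !big_nil !addr0 /= -scalerDl; congr (_ *: _).
  by apply: dotfamP => u; rewrite famD /scalK rmorphD.
- move=> u T f g B; rewrite -[X in _ = semL _ _ X _]cat1s semL_cat !semL1 !sem_dot //.
  by rewrite padpD scalerDl (semD hs).
- move=> u T f g B; rewrite !semL1 /= !(sem_comp hs) /= scalerA; congr (sem s 0 T (_ *: _)).
  by rewrite -[LHS]/(padp 0 f * padp 0 g : K) -padpM.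
- move=> u T c B; rewrite semL1 /semL big_seq1 /= sem_dot // (sem_comp hs).
  rewrite -(semZ hs) -[scal _ c]mulr1 padp_scal -[_ *: _]scalerA (sem_top hs).
  by [].
- move=> d d' hf; rewrite !semL1.
  have [_ h] := far_low 0 (hP (m + wt n (shw 0 (expr d))).+1) hx hf.
  exact: h (low_all d hv).
- move=> a i j b pij g h T B; rewrite !semL1 !(sem_comp hs); congr (sem s 0 T _).
  set y := sem s 0 B x; move: (sem_top hs 0 B x); rewrite -/y => hy.
  exact: slide_sound.
- move=> d Z hc; rewrite semL1.
  by have [] := low_step (hP _) hx (step_cross hc) (low_all d hv).
by move=> d Z hd; rewrite semL1; exact: (dotstep_sound hs).
Qed.
End HomSound.

Local Close Scope ring_scope.
(** * Normal forms of words *)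

Inductive fareq : word -> word -> Prop :=
| fareq_refl e : fareq e e
| fareq_swap e1 e2 i j e' : farl i j ->
    fareq (e1 ++ [:: j; i] ++ e2) e' -> fareq (e1 ++ [:: i; j] ++ e2) e'.

Lemma fareq_trans e1 e2 e3 : fareq e1 e2 -> fareq e2 e3 -> fareq e1 e3.
Proof. by elim=> // *; apply: fareq_swap; auto. Qed.
Lemma fareq_cat2l e e1 e2 : fareq e1 e2 -> fareq (e ++ e1) (e ++ e2).
Proof.
elim=> [*|e1' e2' i j e' h _ ih]; first exact: fareq_refl.
by rewrite catA; apply: fareq_swap h _; rewrite -catA.
Qed.
Lemma fareq_S e1 e2 : fareq e1 e2 -> fareq (map S e1) (map S e2).
Proof.
elim=> [*|e1' e2' i j e' h _ ih]; first exact: fareq_refl.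
rewrite map_cat /=; apply: (@fareq_swap _ _ i.+1 j.+1); first exact: h.
by move: ih; rewrite map_cat.
Qed.
Lemma fareq_move j e1 e2 : all (farl j) e1 -> fareq (j :: e1 ++ e2) (e1 ++ j :: e2).
Proof.
elim: e1 => [|i e1 ih] /=; first by move=> _; apply: fareq_refl.
move=> /andP[h /ih he]; apply: (@fareq_swap [::] (e1 ++ e2)) h _.
exact: (fareq_cat2l [:: i]).
Qed.
Lemma fareq_inword n e e' : fareq e e' -> inword n e = inword n e'.
Proof.
elim=> // e1 e2 i j {}e' _ _ <-; rewrite !inword_cat /=.
by congr (_ && _); rewrite andbCA.
Qed.
Lemma fareq_perm e e' : fareq e e' -> perm_eq e e'.
Proof.
elim=> // e1 e2 i j {}e' _ _ h; apply: perm_trans h.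
by rewrite perm_cat2l; apply/seq.permP => a /=; rewrite addnCA.
Qed.

Definition isnf (n : nat) (e : word) : bool := [exists c : code n, nf c == e].
Definition shape (n : nat) (e : word) : Prop :=
  isnf n e \/ exists k e1 j e2, e = e1 ++ shw j (lhs k) ++ e2.
Definition shaped n e := exists2 e', fareq e e' & shape n e'.

Lemma shaped_far n e e' : fareq e e' -> shaped n e' -> shaped n e.
Proof. by move=> h [e'' h' s]; exists e'' => //; apply: fareq_trans h'. Qed.

(** The cases are those of the definition of the operators. *)
Lemma shaped_ins n j (c : code n) : j.+1 < n -> shaped n (j :: nf c).
Proof.
elim: n j c => [//|m ih] j [k c] hj /=.
have kS : k < m.+1 by [].
have [hk|hk|ek] := ltngtP k j; last first.
- subst j; exists (nf ((Ordinal (hj : k.+1 < m.+1), c) : code m.+1)).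
    by rewrite /= dnS //; apply: fareq_refl.
  by left; apply/existsP; exists ((Ordinal (hj : k.+1 < m.+1), c) : code m.+1).
- have [ek|hk'] := eqVneq (k : nat) j.+1.
    exists (j :: dn k 0 ++ map S (nf c)); first exact: fareq_refl.
    right; exists false, [::], j, (dn j 0 ++ map S (nf c)).
    by rewrite ek dnS //= /shw /= addn0.
  have h2 : j.+2 <= k by move: hk hk' => /=; lia.
  exists (dn k j.+2 ++ [:: j; j.+1; j] ++ dn j 0 ++ map S (nf c)).
    rewrite (@dn_cat k j.+2 0) // !dnS // -!catA; apply: fareq_move.
    by apply/allP => i; rewrite mem_dn /farl; lia.
  right; exists true, (dn k j.+2), j, (dn j 0 ++ map S (nf c)).
  by rewrite /shw /= addn0 addn1.
have [j' ej] : exists j', j = j'.+1 by exists j.-1; lia.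
subst j; have [e he hs] := ih j' c hj.
have hf : fareq (j'.+1 :: dn k 0 ++ map S (nf c)) (dn k 0 ++ map S e).
  apply: fareq_trans (fareq_move _ _) _.
    by apply/allP => i; rewrite mem_dn /farl; move: hk => /=; lia.
  apply: fareq_cat2l; exact: (fareq_S he).
exists (dn k 0 ++ map S e); first exact: hf.
case: hs => [/existsP[c' /eqP<-]|[q [e1 [i [e2 ->]]]]].
  by left; apply/existsP; exists ((k, c') : code m.+1).
right; exists q, (dn k 0 ++ map S e1), i.+1, (map S e2).
rewrite !map_cat !catA; congr (_ ++ _); congr (_ ++ _).
by rewrite /shw -!map_comp; apply: eq_map.
Qed.

(** Letters are added one by one on top of a normal form. *)
Lemma word_shaped n e : inword n e -> shaped n e.
Proof.
elim: e => [_|j e ih /= /andP[hj /ih[e' h s]]].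
  exists [::]; first exact: fareq_refl.
  by left; apply/existsP; exists (code1 n); rewrite nf1.
apply: shaped_far (fareq_cat2l [:: j] h) _.
case: s => [/existsP[c /eqP<-]|[k [e1 [i [e2 ->]]]]]; first exact: shaped_ins.
by exists (j :: e1 ++ shw i (lhs k) ++ e2); [apply: fareq_refl|right; exists k, (j :: e1), i, e2].
Qed.

Definition swp (j i : nat) : nat :=
  if i == j then j.+1 else if i == j.+1 then j else i.
(** The permutation of a word as a map of numbers, independent of the number of
    strands. *)
Definition pfun (e : word) (i : nat) : nat := foldr swp i e.

Lemma swpK j : involutive (swp j).
Proof. by move=> i; rewrite /swp; do ?case: eqP; lia. Qed.
Lemma swp_lt n j i : j.+1 < n -> i < n -> swp j i < n.
Proof. by rewrite /swp; do ?case: eqP; lia. Qed.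
Lemma pfun_cat e1 e2 i : pfun (e1 ++ e2) i = pfun e1 (pfun e2 i).
Proof. by rewrite /pfun foldr_cat. Qed.
Lemma pfun_lt n e i : inword n e -> i < n -> pfun e i < n.
Proof. by move=> + hi; elim: e => //= j e ih /andP[hj /ih]; apply: swp_lt. Qed.
Lemma pfun_inj e : injective (pfun e).
Proof. by elim: e => //= j e ih i i' /(can_inj (swpK j)) /ih. Qed.
Lemma pfun_S e i : pfun (map S e) i.+1 = (pfun e i).+1.
Proof. by elim: e => //= j e ->; rewrite /swp !eqSS; do ?case: ifP. Qed.
Lemma pfun_S0 e : pfun (map S e) 0 = 0.
Proof. by elim: e => //= j e ->. Qed.
Lemma pfun_dn k : pfun (dn k 0) 0 = k.
Proof. by elim: k => // k ih; rewrite dnS //= ih /swp eqxx. Qed.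
Lemma pfun_far e e' : fareq e e' -> pfun e =1 pfun e'.
Proof.
elim=> // e1 e2 i j {}e' h _ ih x; rewrite -ih !pfun_cat; congr pfun.
move: h; rewrite /= /farl /swp; set y := pfun e2 x.
by do ?case: eqP; lia.
Qed.
Lemma pfun_braid j : pfun [:: j; j.+1; j] =1 pfun [:: j.+1; j; j.+1].
Proof. by move=> i; rewrite /= /swp; do ?case: eqP; lia. Qed.

(** The leftmost strand of the permutation of a code (k, c) ends at k. *)
Lemma nf_inj n (c c' : code n) :
  (forall i, i < n -> pfun (nf c) i = pfun (nf c') i) -> c = c'.
Proof.
elim: n c c' => [[] []|m ih] // [k c] [k' c'] h.
have e : k = k' :> nat.
  by have := h 0 isT; rewrite !pfun_cat !pfun_S0 !pfun_dn.
have ek : k = k' by apply: val_inj.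
subst k'; congr (_, _); apply: ih => i hi.
have := h i.+1 hi; rewrite !pfun_cat => /pfun_inj.
by rewrite !pfun_S => -[].
Qed.

Lemma fareq_wt n e e' : fareq e e' -> wt n e = wt n e'.
Proof. by move=> /fareq_perm h; apply: perm_sumn; apply: perm_map. Qed.
Lemma fareq_size e e' : fareq e e' -> size e = size e'.
Proof. by move=> /fareq_perm; apply: perm_size. Qed.

(** Far moves, braid moves and the removal of repeated letters do not change the
    permutation; they lead to a normal form. *)
Lemma to_nf n e : inword n e -> exists2 c : code n,
  pfun (nf c) =1 pfun e & size (nf c) <= size e.
Proof.
elim: (wt n e).+1 {-2}e (ltnSn (wt n e)) => // M ih {}e; rewrite ltnS => hM he.
have [e' hf] := word_shaped he.
have he' : inword n e' by rewrite -(fareq_inword n hf).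
have hp := pfun_far hf; have hw := fareq_wt n hf; have hz := fareq_size hf.
case=> [/existsP[c /eqP ec]|[k [e1 [j [e2 ee]]]]].
  by exists c; rewrite ec ?hz // => i; rewrite hp.
pose r := if k then [:: j.+1; j; j.+1] else [::].
move: he' hw hz hp; rewrite ee !inword_cat !wt_cat !size_cat => /and3P[h1 h2 h3] hw hz hp.
have hr : wt n r < wt n (shw j (lhs k)) /\ inword n r.
  by move: h2; rewrite /r; case: (k); rewrite /inword /wt /=; lia.
have [||c hc sc] := ih (e1 ++ r ++ e2).
- by apply: leq_trans hM; rewrite hw !wt_cat; lia.
- by rewrite !inword_cat h1 h3 hr.2.
exists c; last by apply: leq_trans sc _; rewrite hz !size_cat /r; case: (k) => /=; lia.
move=> i; rewrite hc hp !pfun_cat; congr pfun; rewrite /r.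
case: (k); rewrite /shw /= ?addn0 ?addn1; last by rewrite swpK.
by have := pfun_braid j (pfun e2 i).
Qed.

(** By [to_nf] a word is at least as long as some normal form of its permutation,
    and there is only one. *)
Lemma nf_shortest n (c : code n) e : inword n e ->
  (forall i, i < n -> pfun e i = pfun (nf c) i) -> size (nf c) <= size e.
Proof.
move=> he h; have [c' hc sc] := to_nf he.
by rewrite (_ : c = c') //; apply: nf_inj => i hi; rewrite -h // hc.
Qed.
Local Open Scope ring_scope.

(** * Left-hand sides inside diagrams *)

Section Typed.
Variables (kk : comPzRingType) (H : heckeData kk).
Local Notation I := (color H).
Local Notation crossing := (@crossing kk H).
Local Notation diag := (@diag kk H).
Local Notation "x ** y" := (dcomp x y)
  (at level 40, y at level 40, right associativity).

Lemma ss_rule (x y : I) b (pxy : permitted x y) (pyx : permitted y x) :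
  exists Z, crossrule (ss b pxy pyx) Z.
Proof.
have [e|ne] := eqVneq x y.
  by subst y; rewrite (bool_irrelevance pyx pxy); eexists; apply: rule_ii.
by eexists; apply: rule_ji; rewrite eq_sym.
Qed.

Definition unit_scalar (c : kk) := exists c', c' * c = 1.

Lemma sts_rule (x y z : I) b (pxy : permitted x y) (pxz : permitted x z)
    (pyz : permitted y z) : exists c Y, [/\ unit_scalar c,
  crossrule (sts b pxy pxz pyz) ((c, tst b pxy pxz pyz) :: Y) &
  all (fun t => size (expr t.2) < 3)%N Y].
Proof.
have U (x' y' z' : I) : unit_scalar (lam x' y' z') by exact: lam_inv.
have [exy|nxy] := eqVneq x y; first subst y.
  have [exz|nxz] := eqVneq x z; first subst z.
    rewrite (bool_irrelevance pxz pxy) (bool_irrelevance pyz pxy).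
    by do 2 eexists; split; [apply: U | apply: rule_iii |].
  rewrite (bool_irrelevance pyz pxz).
  by do 2 eexists; split; [apply: U | apply: rule_iij |].
have [eyz|nyz] := eqVneq y z; first subst z.
  rewrite (bool_irrelevance pxz pxy).
  by do 2 eexists; split; [apply: U | apply: rule_jii; rewrite // eq_sym |].
have [exz|nxz] := eqVneq x z; first subst z.
  by do 2 eexists; split; [apply: U | apply: rule_iji |].
by do 2 eexists; split; [apply: U | apply: rule_ijk |].
Qed.

Lemma undec_split v w (d : diag v w) e1 e2 : undecorated d -> expr d = e1 ++ e2 ->
  exists u (T : diag u w) (B : diag v u),
  [/\ d = T ** B, undecorated T, undecorated B, expr T = e1 & expr B = e2].
Proof.
elim: d e1 => [|//|u u' c d ih] [|j e1] /= hd he.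
- by exists v, (dnil v), (dnil v).
- by [].
- by exists u', (dnil u'), (dcross c d).
case: he => <- /(ih _ hd)[u1 [T [B [-> hT hB eT eB]]]].
by exists u1, (dcross c T), B; split=> //=; rewrite eT.
Qed.

(** Two crossings at the same place, one on top of the other, are the left-hand
    side of a relation; the predicate P replaces an equation between diagrams
    whose words are only propositionally equal. *)
Lemma ss_redex (P : forall u w, diag u w -> Prop) :
  (forall a x y b (pxy : permitted x y) (pyx : permitted y x),
     P _ _ (dshift a (ss b pxy pyx))) ->
  forall u u1 w (c1 : crossing u1 w) (c2 : crossing u u1), height c1 = height c2 ->
  P u w (dcross c1 (cdiag c2)).
Proof.
move=> hP u u1 w c1; elim: c1 P hP u => {u1 w} [i j b p|k u1 w c1 ih] P hP u c2 /=.
  move=> h0; pose Q (w : seq I) u :=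
    match w return crossing u (i :: w) -> Prop with
    | j :: b => fun c => forall p : permitted i j,
        P u (j :: i :: b) (dcross (crossing0 b p) (cdiag c))
    | [::] => fun _ => True
    end.
  have := @crossing_top_0 _ _ u i (j :: b) c2 Q; apply=> // y b' q p'.
  exact: (hP [::]).
move=> h; have h0 : (0 < height c2)%N by rewrite -h.
pose Q u (c : crossing u (k :: u1)) := (height c1).+1 = height c ->
  P u (k :: w) (dcross (crossingS k c1) (cdiag c)).
apply: (crossing_top_S (P := Q)) h0 h => u' c [h].
apply: (ih (fun u w d => P (k :: u) (k :: w) (dshift1 k d))) => // a x y b pxy pyx.
exact: (hP (k :: a)).
Qed.

Lemma sts_redex (P : forall u w, diag u w -> Prop) :
  (forall a x y z b (pxy : permitted x y) (pxz : permitted x z) (pyz : permitted y z),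
     P _ _ (dshift a (sts b pxy pxz pyz))) ->
  forall u u2 u1 w (c1 : crossing u1 w) (c2 : crossing u2 u1) (c3 : crossing u u2),
  height c2 = (height c1).+1 -> height c3 = height c1 ->
  P u w (dcross c1 (dcross c2 (cdiag c3))).
Proof.
move=> hP u u2 u1 w c1; elim: c1 P hP u2 u => {u1 w} [i j b p|k u1 w c1 ih] P hP u2 u c2 c3 /=.
  move=> h2 h3; have h20 : (0 < height c2)%N by rewrite h2.
  pose Q u2 (c2 : crossing u2 (i :: j :: b)) := forall u (c3 : crossing u u2),
    height c2 = 1%N -> height c3 = 0%N ->
    P u (j :: i :: b) (dcross (crossing0 b p) (dcross c2 (cdiag c3))).
  apply: (crossing_top_S (P := Q)) h20 u c3 h2 h3 => u' s u c3 [h2] h3.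
  pose Q2 (b : seq I) u' (s : crossing u' (j :: b)) :=
    forall u (c3 : crossing u (i :: u')), height c3 = 0%N ->
    P u (j :: i :: b) (dcross (crossing0 b p) (dcross (crossingS i s) (cdiag c3))).
  apply: (crossing_top_0 (P := Q2)) h2 u c3 h3 => y b' q u c3 h3.
  pose Q3 (w : seq I) u := match w return crossing u (i :: w) -> Prop with
    | y :: w' => match w' return crossing u (i :: y :: w') -> Prop with
      | j :: b => fun c => forall (p : permitted i j) (q : permitted y j),
          P u (j :: i :: y :: b)
            (dcross (crossing0 (y :: b) p) (dcross (crossingS i (crossing0 b q)) (cdiag c)))
      | [::] => fun _ => True end
    | [::] => fun _ => True
    end.
  have := @crossing_top_0 _ _ u i (y :: j :: b') c3 Q3; apply=> // y' [|j' b3] q' // p' r.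
  exact: (hP [::]).
move=> h2 h3; have h20 : (0 < height c2)%N by rewrite h2.
pose Q u2 (c2 : crossing u2 (k :: u1)) := forall u (c3 : crossing u u2),
  height c2 = (height c1).+2 -> height c3 = (height c1).+1 ->
  P u (k :: w) (dcross (crossingS k c1) (dcross c2 (cdiag c3))).
apply: (crossing_top_S (P := Q)) h20 u c3 h2 h3 => u' s u c3 [h2] h3.
have h30 : (0 < height c3)%N by rewrite h3.
pose Q2 u (c3 : crossing u (k :: u')) := height c3 = (height c1).+1 ->
  P u (k :: w) (dcross (crossingS k c1) (dcross (crossingS k s) (cdiag c3))).
apply: (crossing_top_S (P := Q2)) h30 h3 => u'' s' [h3].
apply: (ih (fun u w d => P (k :: u) (k :: w) (dshift1 k d))) => // a x y z b pxy pxz pyz.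
exact: (hP (k :: a)).
Qed.

End Typed.

(** * Reduction of linear combinations *)

Section Reduction.
Variables (kk : comPzRingType) (H : heckeData kk).
Local Notation I := (color H).
Local Notation Rw := (dots (@dotalg kk H)).
Local Notation crossing := (@crossing kk H).
Local Notation diag := (@diag kk H).
Local Notation lincomb := (@lincomb kk H).
Local Notation "x ** y" := (dcomp x y)
  (at level 40, y at level 40, right associativity).

Lemma far_comp v v' w w' (T : diag w w') (B : diag v' v) (d d' : diag v w) :
  far d d' -> far (T ** d ** B) (T ** d' ** B).
Proof.
case=> a x y c z u e pxy pzu T0 B0 s.
have h X : T ** (T0 ** X ** B0) ** B = (T ** T0) ** X ** (B0 ** B) by rewrite !dcompA.
by rewrite !h; apply: Far.
Qed.

Lemma lcomp_lcomp v v1 v2 w2 w1 w (T : diag w1 w) (T0 : diag w2 w1) (Z : lincomb v2 w2)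
    (B0 : diag v1 v2) (B : diag v v1) :
  lcomp T (lcomp T0 Z B0) B = lcomp (T ** T0) Z (B0 ** B).
Proof. by rewrite /lcomp -map_comp; apply: eq_map => t /=; rewrite !dcompA. Qed.

Lemma step_comp v v' w w' (T : diag w w') (B : diag v' v) (d : diag v w) Z :
  step d Z -> step (T ** d ** B) (lcomp T Z B).
Proof.
case=> {d Z}.
- move=> _ _ [a u u' T0 L Z B0 hL]; rewrite lcomp_lcomp.
  rewrite (_ : T ** _ ** B = (T ** T0) ** dshift a L ** (B0 ** B)); last by rewrite !dcompA.
  by apply: step_cross; apply: CrossStep.
- move=> u u' T0 s f Z B0 f1 hs; rewrite lcomp_lcomp.
  rewrite (_ : T ** _ ** B = (T ** T0) ** s ** dot f ** (B0 ** B)); last by rewrite !dcompA.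
  exact: step_dot.
- move=> u T0 f g B0.
  rewrite (_ : T ** _ ** B = (T ** T0) ** dot f ** dot g ** (B0 ** B)); last by rewrite !dcompA.
  rewrite /lcomp /= (_ : T ** _ ** B = (T ** T0) ** dot (f * g) ** (B0 ** B)); last by rewrite !dcompA.
  exact: step_mul.
- move=> u T0 B0.
  rewrite (_ : T ** _ ** B = (T ** T0) ** dot 1 ** (B0 ** B)); last by rewrite !dcompA.
  rewrite /lcomp /= (_ : T ** _ ** B = (T ** T0) ** (B0 ** B)); last by rewrite !dcompA.
  exact: step_unit.
- by move=> d d' h; apply: step_far; apply: far_comp.
by move=> d d' h; apply: step_far_sym; apply: far_comp.
Qed.

Lemma dotstep_comp v v' w w' (T : diag w w') (B : diag v' v) (d : diag v w) Z :
  dotstep d Z -> dotstep (T ** d ** B) (lcomp T Z B).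
Proof.
case=> u u' T0 s f Z0 B0 hs; rewrite lcomp_lcomp.
rewrite (_ : T ** _ ** B = (T ** T0) ** s ** dot f ** (B0 ** B)); last by rewrite !dcompA.
exact: DotStep.
Qed.

Lemma left_dots v w u (T : diag u w) (d : diag v u) :
  expr T = [::] -> left_diag d -> left_diag (T ** d).
Proof. by elim: T d. Qed.

Lemma dotrule_exists u w (c : crossing u w) (f : Rw u) : exists2 Z,
  dotrule (cdiag c) f Z &
  all (fun t => `[< (exists g, t.2 = ddot g (cdiag c)) \/ expr t.2 = [::] >]) Z.
Proof.
elim/crossing_shift_ind: c f => a i j b p f.
rewrite -dshift_cdiag; have [e|ne] := eqVneq i j.
  subst j; eexists; first exact: dot_ii.
  by rewrite /= andbT; apply/andP; split; apply/asboolP; [left; eexists|right].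
eexists; first exact: dot_ij.
by rewrite /= andbT; apply/asboolP; left; eexists.
Qed.

Definition left_sub v w (e : word) (d : diag v w) : bool :=
  left_diag d && subseq (expr d) e.

(** Dots are moved to the top both by [step], and by [dotstep] for the ambiguities
    with a dot below a relation; [S] stands for either. *)
Section Generic.
Variable S : forall v w, diag v w -> lincomb v w -> Prop.
Hypothesis S_comp : forall v v' w w' (T : diag w w') (B : diag v' v) (d : diag v w) Z,
  S d Z -> S (T ** d ** B) (lcomp T Z B).
Arguments S {v w}.

Section Reduces.
Variables v w : seq I.
Local Notation red := (reduces (@S v w)).
Implicit Types X Y Z : lincomb v w.

Lemma red_refl X : red X X. Proof. exact: rt_refl. Qed.
Lemma red_trans X Y Z : red X Y -> red Y Z -> red X Z.
Proof. exact: rt_trans. Qed.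
Lemma red_ctx X Y Z1 Z2 : red X Y -> red (Z1 ++ X ++ Z2) (Z1 ++ Y ++ Z2).
Proof.
elim=> {X Y} [X Y [{}X c d Y' Z hd]|X|X Y Z _ ih1 _ ih2].
- apply: rt_step; have := @Reduce1 _ _ v w _ (Z1 ++ X) c d (Y' ++ Z2) Z hd.
  by rewrite -!catA.
- exact: rt_refl.
exact: rt_trans ih1 ih2.
Qed.
Lemma lscale1 X : lscale 1 X = X.
Proof. by rewrite /lscale -[RHS]map_id; apply: eq_map => -[c d]; rewrite /= mul1r. Qed.
Lemma lscaleM c c' X : lscale c (lscale c' X) = lscale (c * c') X.
Proof. by rewrite /lscale -map_comp; apply: eq_map => t /=; rewrite mulrA. Qed.
Lemma red_scale c X Y : red X Y -> red (lscale c X) (lscale c Y).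
Proof.
elim=> {X Y} [X Y [{}X c' d Y' Z hd]|X|X Y Z _ ih1 _ ih2].
- rewrite /lscale !map_cat /= -!/(lscale _ _) lscaleM.
  by apply: rt_step; apply: Reduce1.
- exact: rt_refl.
exact: rt_trans ih1 ih2.
Qed.
Lemma red_step d Z : S d Z -> red [:: (1, d)] Z.
Proof.
move=> h; apply: rt_step; have := @Reduce1 _ _ v w _ [::] 1 d [::] Z h.
by rewrite lscale1 cats0.
Qed.

Definition reducible_to (Q : pred (diag v w)) (X : lincomb v w) : Prop :=
  exists2 Y, red X Y & all (fun t => Q t.2) Y.

Lemma red_all Q X : 
  (forall (P : diag v w -> Prop), all (fun t => `[< P t.2 >]) X ->
   (forall d, P d -> reducible_to Q [:: (1, d)]) -> reducible_to Q X).
Proof.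
move=> P; elim: X => [|[c d] X ih] /=; first by exists [::]; [apply: red_refl|].
move=> /andP[/asboolP /= Pd /ih {}ih] h.
have [Y rY qY] := ih h; have [Z rZ qZ] := h d Pd.
exists (lscale c Z ++ Y); last by rewrite all_cat qY andbT /lscale all_map.
apply: (@red_trans _ ([:: (c, d)] ++ Y)).
  by have := red_ctx [:: (c, d)] [::] rY; rewrite !cats0.
have := red_ctx [::] Y (red_scale c rZ).
by rewrite /lscale /= mulr1.
Qed.

End Reduces.

Lemma red_comp v v' w w' (T : diag w w') (B : diag v' v) (X Y : lincomb v w) :
  reduces (@S v w) X Y -> reduces (@S v' w') (lcomp T X B) (lcomp T Y B).
Proof.
elim=> {X Y} [X Y [{}X c d Y' Z hd]|X|X Y Z _ ih1 _ ih2].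
- rewrite /lcomp !map_cat /=.
  have -> : [seq (t.1, T ** t.2 ** B) | t <- lscale c Z] = lscale c (lcomp T Z B).
    by rewrite /lcomp /lscale -!map_comp.
  by apply: rt_step; apply: (Reduce1 (S := @S v' w') _ c _ (S_comp T B hd)).
- exact: rt_refl.
exact: rt_trans ih1 ih2.
Qed.

Lemma red_sub v w (Q Q' : pred (diag v w)) X : (forall d, Q d -> Q' d) ->
  reducible_to Q X -> reducible_to Q' X.
Proof. by move=> h [Y r q]; exists Y => //; apply: sub_all q => t; apply: h. Qed.

Lemma red_each v w (Q Q' : pred (diag v w)) X : reducible_to Q X ->
  (forall d, Q d -> reducible_to Q' [:: (1, d)]) -> reducible_to Q' X.
Proof.
move=> [Y r q] h; have [|Z r' q'] := @red_all v w Q' Y Q _ h.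
  by apply: sub_all q => t ht; apply/asboolP.
by exists Z => //; apply: red_trans r r'.
Qed.

Lemma red_dot v w (Q Q' : pred (diag v w)) (f : Rw w) d :
  (forall d, Q d -> Q' (ddot f d)) ->
  reducible_to Q [:: (1, d)] -> reducible_to Q' [:: (1, ddot f d)].
Proof.
move=> h [Y r q]; exists (lcomp (dot f) Y (dnil v)).
  by have := red_comp (dot f) (dnil v) r; rewrite /lcomp /= dcomp1.
rewrite /lcomp all_map; apply: sub_all q => t /=; rewrite dcomp1.
exact: h.
Qed.

Hypothesis S_push : forall v u w (c : crossing u w) (f : Rw u) (d : diag v u),
  left_diag d -> exists2 Z, S (dcross c (ddot f d)) Z &
  all (fun t => `[< [\/ exists g, t.2 = ddot g (dcross c d), t.2 = dcross c d |
                       left_sub (height c :: expr d) t.2] >]) Z.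

Lemma left_cross_red v u w (c : crossing u w) (d : diag v u) : left_diag d ->
  reducible_to (left_sub (height c :: expr d)) [:: (1, dcross c d)].
Proof.
elim: d w c => [|u' f d ih|u1 u' c' d ih] w c hd.
- by exists [:: (1, cdiag c)]; [apply: red_refl|rewrite /= /left_sub /= eqxx].
- have [Z hZ sZ] := @S_push v u' w c f d hd.
  have [Y r q] : reducible_to (left_sub (height c :: expr d)) Z.
    apply: (@red_all v w _ _ (fun t => [\/ exists g, t = ddot g (dcross c d), t = dcross c d |
                       left_sub (height c :: expr d) t])).
      by [].
    move=> t [[g ->]|->|ht]; last by exists [:: (1, t)]; [apply: red_refl|rewrite /= ht].
      by apply: red_dot (ih _ c hd).
    exact: ih.
  by exists Y => //; apply: red_trans r; apply: red_step.
exists [:: (1, dcross c (dcross c' d))]; first exact: red_refl.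
by rewrite [all _ _]andbT /left_sub subseq_refl andbT.
Qed.

(** A dot that passes a crossing leaves the crossing in place or removes it, so
    that only subwords arise. *)
Lemma left_red v w (d : diag v w) :
  reducible_to (left_sub (expr d)) [:: (1, d)].
Proof.
elim: d => [|u f d ih|u u' c d [Y r q]].
- by exists [:: (1, dnil v)]; [apply: red_refl|].
- by apply: red_dot ih.
apply: (red_each (Q := fun t => `[< exists2 d', left_sub (expr d) d' & t = dcross c d' >])).
  exists (lcomp (cdiag c) Y (dnil v)).
    by have := red_comp (cdiag c) (dnil v) r; rewrite /lcomp /= dcomp1.
  rewrite /lcomp all_map; apply: sub_all q => t ht; apply/asboolP; exists t.2 => //=.
  by rewrite dcomp1.
move=> _ /asboolP[d' /andP[hl hs] ->]; apply: red_sub (left_cross_red c hl) => t.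
rewrite /left_sub => /andP[-> h]; apply: subseq_trans h _.
by rewrite /= eqxx.
Qed.

End Generic.

Lemma isotopic_red v w (d d' : diag v w) : isotopic d d' ->
  reduces (@step _ _ v w) [:: (1, d)] [:: (1, d')].
Proof.
move=> h; pose red := reduces (@step _ _ v w).
suff [] : red [:: (1, d)] [:: (1, d')] /\ red [:: (1, d')] [:: (1, d)] by [].
elim: h => {d d'} [d d' h|d|d d' _ []//|d d' d'' _ [h1 h2] _ [h3 h4]].
- by split; apply: red_step; [apply: step_far|apply: step_far_sym].
- by split; apply: red_refl.
by split; [apply: red_trans h1 h3|apply: red_trans h4 h2].
Qed.

Lemma dotstep_push v u w (c : crossing u w) (f : Rw u) (d : diag v u) :
  left_diag d -> exists2 Z, dotstep (dcross c (ddot f d)) Z &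
  all (fun t => `[< [\/ exists g, t.2 = ddot g (dcross c d), t.2 = dcross c d |
                       left_sub (height c :: expr d) t.2] >]) Z.
Proof.
move=> hd; have [Z hZ sZ] := dotrule_exists c f.
exists (lcomp (dnil w) Z d); first exact: (@DotStep _ _ v w u w (dnil w) (cdiag c) f Z d).
rewrite /lcomp all_map; apply: sub_all sZ => t /asboolP[[g e]|e]; apply/asboolP.
  by apply: Or31; exists g; rewrite /= e.
apply: Or33; rewrite /left_sub /= left_dots // expr_comp e /=; exact: (subseq_cons (expr d)).
Qed.
Lemma step_push v u w (c : crossing u w) (f : Rw u) (d : diag v u) :
  left_diag d -> exists2 Z, step (dcross c (ddot f d)) Z &
  all (fun t => `[< [\/ exists g, t.2 = ddot g (dcross c d), t.2 = dcross c d |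
                       left_sub (height c :: expr d) t.2] >]) Z.
Proof.
move=> hd; have [e1|/eqP f1] := eqVneq f 1.
  subst f; exists [:: (1, dcross c d)]; first exact: (@step_unit _ _ v w u (cdiag c) d).
  by rewrite /= andbT; apply/asboolP/Or32.
have [Z hZ sZ] := dotrule_exists c f.
exists (lcomp (dnil w) Z d); first exact: (@step_dot _ _ v w u w (dnil w) (cdiag c) f Z d).
rewrite /lcomp all_map; apply: sub_all sZ => t /asboolP[[g e]|e]; apply/asboolP.
  by apply: Or31; exists g; rewrite /= e.
apply: Or33; rewrite /left_sub /= left_dots // expr_comp e /=; exact: (subseq_cons (expr d)).
Qed.

End Reduction.

(** * Reduction to normal forms *)

Section Reduction.
Variables (kk : comPzRingType) (H : heckeData kk).
Local Notation crossing := (@crossing kk H).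
Local Notation diag := (@diag kk H).
Local Notation lincomb := (@lincomb kk H).
Local Notation "x ** y" := (dcomp x y)
  (at level 40, y at level 40, right associativity).

Lemma iso_comp v v' w w' (T : diag w w') (B : diag v' v) (d d' : diag v w) :
  isotopic d d' -> isotopic (T ** d ** B) (T ** d' ** B).
Proof.
elim=> {d d'} [d d' h|d|d d' _ h|d d' d'' _ h _ h'].
- by apply: rst_step; apply: far_comp.
- exact: rst_refl.
- exact: rst_sym.
exact: rst_trans h h'.
Qed.

Lemma undec_two v w (M : diag v w) i j : undecorated M -> expr M = [:: i; j] ->
  exists u (c1 : crossing u w) (c2 : crossing v u),
  [/\ M = dcross c1 (cdiag c2), height c1 = i & height c2 = j].
Proof.
case: M => //= u u' c1 M; case: M c1 => //= u2 u3 c2 M c1.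
case: M c2 => //= c2 _ [<- <-].
by exists u3, c1, c2.
Qed.
Lemma undec_three v w (M : diag v w) i j k : undecorated M -> expr M = [:: i; j; k] ->
  exists u u' (c1 : crossing u w) (c2 : crossing u' u) (c3 : crossing v u'),
  [/\ M = dcross c1 (dcross c2 (cdiag c3)), height c1 = i, height c2 = j & height c3 = k].
Proof.
case: M => //= u1 w1 c1 M hM [<- eM].
have [u [c2 [c3 [-> <- <-]]]] := undec_two hM eM.
by exists u1, u, c1, c2, c3.
Qed.

(** Each far move of the word is realized by [far_square]. *)
Lemma undec_far v w (d : diag v w) e : undecorated d -> fareq (expr d) e ->
  exists d', [/\ isotopic d d', undecorated d' & expr d' = e].
Proof.
move ee: (expr d) => e0 hd hf; elim: hf d ee hd => {e e0} [e|e1 e2 i j e h _ ih] d ee hd.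
  by exists d; split=> //; apply: rst_refl.
have [u [T [B1 [ed hT hB eT eB1]]]] := undec_split hd ee.
have [u' [M [B [eB' hM hB' eM eB]]]] := undec_split hB eB1.
have [u1 [c1 [c2 [eM' h1 h2]]]] := undec_two hM eM.
have [|u2 [c2' [c1' [h2' h1' hs _]]]] := @far_square _ _ _ _ _ c1 c2; first by rewrite h1 h2.
have [|//|d' [i' hd' e']] := ih (T ** dcross c2' (cdiag c1') ** B).
- by rewrite !expr_comp /= eT eB h1' h2' h1 h2.
- by rewrite !undec_comp /= hT.
exists d'; split=> //; apply: iso_trans i'; rewrite ed eB' eM'.
apply: iso_comp; case: hs => hs; first exact: rst_step.
by apply: rst_sym; apply: rst_step.
Qed.

Lemma rhsK_words (k : bool) e : e \in [seq r.2 | r <- rhsK H k] ->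
  [/\ (size e <= size (lhs k))%N, ~~ k -> (size e < size (lhs k))%N &
   forall n q, (q + k.+1 < n)%N ->
     (wt n (shw q e) < wt n (shw q (lhs k)))%N].
Proof.
case: k; rewrite /= !inE.
  case/or4P => [| | |/or3P[]] /eqP ->; split=> // n q; rewrite /wt /=; lia.
by case/orP => /eqP ->; split=> // n q; rewrite /wt /=; lia.
Qed.

Lemma redex_ss v w (d : diag v w) e1 j e2 : undecorated d ->
  expr d = e1 ++ shw j (lhs false) ++ e2 -> exists2 Z, step d Z &
    all (fun t => (size (expr t.2) < size (expr d))%N &&
                  (wt (size v) (expr t.2) < wt (size v) (expr d))%N) Z.
Proof.
move=> hd ee.
have [u [T [B1 [ed hT hB eT eB1]]]] := undec_split hd ee.
have [u' [M [B [eB' hM hB' eM eB]]]] := undec_split hB eB1.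
have [u1 [c1 [c2 [eM' h1 h2]]]] := undec_two hM eM.
have := expr_inword d; rewrite ee !inword_cat => /and3P[_ i2 _].
pose P u' u (M : diag u' u) := forall (T : diag u w) (B : diag v u'),
  expr M = shw j (lhs false) -> exists2 Z, step (T ** M ** B) Z &
    all (fun t => has (fun r => expr t.2 == expr T ++ shw j r ++ expr B)
           [seq r.2 | r <- rhsK H false]) Z.
have hP : P u' u M.
  rewrite eM'; apply: (ss_redex (P := P)); last by rewrite h1 h2.
  move=> a x y b pxy pyx T0 B0 e.
  have ea : size a = j by move: e; rewrite expr_dshift /= /shw /= !addn0 => -[].
  have [Z hZ] := ss_rule b pxy pyx.
  exists (lcomp T0 (Defs.lshift a Z) B0); first by apply: step_cross; apply: CrossStep.
  have [k [ek hw]] := crossrule_words hZ.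
  have ek' : k = false by case: (k) ek.
  subst k; rewrite /lcomp /Defs.lshift !all_map; apply: sub_all hw => t /= ht.
  apply: (introT (@hasP _ (fun r => expr (T0 ** dshift a t.2 ** B0) ==
    expr T0 ++ shw j r ++ expr B0) [seq r.2 | r <- rhsK H false])).
  by exists (expr t.2) => //; rewrite !expr_comp expr_dshift ea.
have [Z hs hZ] := hP T B eM; exists Z; first by rewrite ed eB'.
apply: sub_all hZ => t /hasP[r /rhsK_words[_ /(_ isT) s1 /(_ (size v) j) s2] /eqP ->].
rewrite !size_cat !wt_cat eT eB !size_map; move: i2 s1 s2.
by rewrite inword_shw_lhs => h /= s1 /(_ h); rewrite /shw /=; lia.
Qed.

Lemma redex_sts v w (d : diag v w) e1 j e2 : undecorated d ->
  expr d = e1 ++ shw j (lhs true) ++ e2 -> exists c d' Y,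
  [/\ unit_scalar c, step d ((c, d') :: Y), undecorated d',
      expr d' = e1 ++ [:: j.+1; j; j.+1] ++ e2 &
      all (fun t => (size (expr t.2) < size (expr d))%N &&
                    (wt (size v) (expr t.2) < wt (size v) (expr d))%N) Y].
Proof.
move=> hd ee.
have [u [T [B1 [ed hT hB eT eB1]]]] := undec_split hd ee.
have [u' [M [B [eB' hM hB' eM eB]]]] := undec_split hB eB1.
have [u1 [u2 [c1 [c2 [c3 [eM' h1 h2 h3]]]]]] := undec_three hM eM.
have := expr_inword d; rewrite ee !inword_cat => /and3P[_ i2 _].
pose P u' u (M : diag u' u) := forall (T : diag u w) (B : diag v u'),
  expr M = shw j (lhs true) -> exists c d' Y,
  [/\ unit_scalar c, step (T ** M ** B) ((c, T ** d' ** B) :: Y), undecorated d',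
      expr d' = [:: j.+1; j; j.+1] &
    all (fun t => has (fun r => (size r < 3)%N && (expr t.2 == expr T ++ shw j r ++ expr B))
           [seq r.2 | r <- rhsK H true]) Y].
have hP : P u' u M.
  rewrite eM'; apply: (sts_redex (P := P)); [|by rewrite h1 h2 addn0 addn1|by rewrite h1 h3].
  move=> a x y z b pxy pxz pyz T0 B0 e.
  have ea : size a = j by move: e; rewrite expr_dshift /= /shw /= !addn0 addn1 => -[].
  have [c [Y [uc hZ hY]]] := sts_rule b pxy pxz pyz.
  exists c, (dshift a (tst b pxy pxz pyz)), (lcomp T0 (Defs.lshift a Y) B0); split=> //.
  - exact: (step_cross (@CrossStep _ _ v w a _ _ T0 _ _ B0 hZ)).
  - by rewrite undec_dshift.
  - by rewrite expr_dshift /= /shw /= addn0 addn1 ea.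
  have [k [ek]] := crossrule_words hZ; have ek' : k = true by case: (k) ek.
  subst k => /andP[_ hw]; rewrite /lcomp /Defs.lshift !all_map.
  have : all (predI (fun t => size (expr t.2) < 3)%N
      (fun t => expr t.2 \in [seq r.2 | r <- rhsK H true])) Y by rewrite all_predI hY.
  apply: sub_all => t /andP[/= h3' ht].
  apply: (introT (@hasP _ (fun r => (size r < 3)%N &&
    (expr (T0 ** dshift a t.2 ** B0) == expr T0 ++ shw j r ++ expr B0))
    [seq r.2 | r <- rhsK H true])).
  by exists (expr t.2) => //; rewrite !expr_comp expr_dshift ea h3' eqxx.
have [c [d' [Y [uc hs ud' ed' hY]]]] := hP T B eM; exists c, (T ** d' ** B), Y; split=> //.
- by rewrite ed eB'.
- by rewrite !undec_comp hT ud'.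
- by rewrite !expr_comp eT eB ed'.
apply: sub_all hY => t /hasP[r /rhsK_words[_ _ /(_ (size v) j) s2] /andP[h3' /eqP ->]].
rewrite !size_cat !wt_cat eT eB !size_map; move: i2 s2.
by rewrite inword_shw_lhs => h /(_ h); rewrite /shw /=; lia.
Qed.

Lemma subseq_wt n e1 e2 : subseq e1 e2 -> (wt n e1 <= wt n e2)%N.
Proof.
elim: e2 e1 => [|j e2 ih] [|i e1] //=; case: eqP => [->|_] /ih; rewrite !wt_cons; lia.
Qed.

Definition normal v w (N : nat) (d : diag v w) : bool :=
  [&& left_diag d, isnf (size v) (expr d) & size (expr d) <= N]%N.

Lemma normal_left v w N M :
  (forall d : diag v w, undecorated d -> (wt (size v) (expr d) <= M)%N ->
     (size (expr d) <= N)%N -> reducible_to (@step _ _) (normal N) [:: (1, d)]) ->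
  forall d : diag v w, left_diag d -> (wt (size v) (expr d) <= M)%N ->
     (size (expr d) <= N)%N -> reducible_to (@step _ _) (normal N) [:: (1, d)].
Proof.
move=> h d; elim: d h => [|u f d ih|u u' c d _] h hd hw hN; try exact: h.
by apply: (red_dot (@step_comp _ _) (Q := normal N)) (ih h hd hw hN) => d'.
Qed.

(** By induction on the weight: dots go to the top, far moves bring the word into
    a normal form or uncover a relation. *)
Theorem reduce_normal v w (d : diag v w) :
  reducible_to (@step _ _) (normal (size (expr d))) [:: (1, d)].
Proof.
suff main M N w' (t : diag v w') : (wt (size v) (expr t) <= M)%N ->
    (size (expr t) <= N)%N -> reducible_to (@step _ _) (normal N) [:: (1, t)].
  exact: (main (wt (size v) (expr d)) (size (expr d))).
elim/ltn_ind: M {w d} w' t => M ih w d hM hN.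
apply: (red_each (left_red (@step_comp _ _) (@step_push _ _) d)) => d1 /andP[hl hs].
have {hM}hM := leq_trans (subseq_wt (size v) hs) hM.
have {hN}hN := leq_trans (size_subseq hs) hN.
apply: (@normal_left v w N M) hl hM hN => {d d1 hs} d hd hM hN.
have [e' hf hsh] := word_shaped (expr_inword d).
have [d' [hi hd' ed']] := undec_far hd hf.
suff [Y r q] : reducible_to (@step _ _) (normal N) [:: (1, d')].
  by exists Y => //; apply: red_trans r; apply: isotopic_red.
rewrite (fareq_wt _ hf) -ed' in hM; rewrite (fareq_size hf) -ed' in hN.
have low_all (Z : lincomb v w) : step d' Z -> all (fun t => (size (expr t.2) <= size (expr d'))%N &&
    (wt (size v) (expr t.2) < wt (size v) (expr d'))%N) Z -> reducible_to (@step _ _) (normal N) [:: (1, d')].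
  move=> hs hZ; suff [Y r q] : reducible_to (@step _ _) (normal N) Z.
    by exists Y => //; apply: red_trans r; apply: red_step.
  apply: (@red_all _ _ (@step _ _) v w _ Z (fun t => (size (expr t) <= size (expr d'))%N &&
    (wt (size v) (expr t) < wt (size v) (expr d'))%N)).
    by apply: sub_all hZ => t ht; apply/asboolP.
  move=> t /andP[s1 w1]; apply: (ih _ (leq_trans w1 hM) _ t) => //.
  exact: leq_trans hN.
case: hsh => [hn|[k [e1 [j [e2 ee]]]]].
  exists [:: (1, d')]; first exact: red_refl.
  by rewrite /= /normal ed' hn -ed' hN /left_diag; case: (d') hd' => //= u u' c d1 ->.
rewrite {}ee in ed'; case: k ed' => ed'.
  have [c [t [Y [_ hs ut et hY]]]] := redex_sts hd' ed'.
  apply: (low_all _ hs); rewrite /= et ed' !size_cat !wt_cat; apply/andP; split.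
    have := expr_inword d'; rewrite ed' !inword_cat inword_shw_lhs => /and3P[_ h _].
    by rewrite /shw /= /wt /=; lia.
  by rewrite -!wt_cat -!size_cat -ed'; apply: sub_all hY => t' /andP[/ltnW -> ->].
have [Z hs hZ] := redex_ss hd' ed'.
by apply: (low_all _ hs); apply: sub_all hZ => t /andP[/ltnW -> ->].
Qed.

Definition short (n : nat) (e : word) : Prop := forall e', inword n e' ->
  (forall i, (i < n)%N -> pfun e' i = pfun e i) -> (size e <= size e')%N.

(** Only braid relations apply to a reduced word, and their leading coefficients
    are invertible. *)
Lemma reduce_lead v w (d : diag v w) : undecorated d ->
  short (size v) (expr d) -> exists c d' Y,
  [/\ unit_scalar c, reduces (@step _ _ v w) [:: (1, d)] ((c, d') :: Y),
      undecorated d' /\ isnf (size v) (expr d'),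
      pfun (expr d') =1 pfun (expr d) &
      all (fun t => size (expr t.2) < size (expr d))%N Y].
Proof.
have [M] := ubnPleq (wt (size v) (expr d)).
elim/ltn_ind: M d => M ih d hM hd hm.
have [e' hf hsh] := word_shaped (expr_inword d).
have [d' [hi hd' ed']] := undec_far hd hf.
have hp : pfun (expr d') =1 pfun (expr d) by move=> i; rewrite ed' (pfun_far hf).
have hz : size (expr d') = size (expr d) by rewrite ed' (fareq_size hf).
have hw : wt (size v) (expr d') = wt (size v) (expr d) by rewrite ed' (fareq_wt _ hf).
have r0 := isotopic_red hi.
case: hsh => [hn|[k [e1 [j [e2 ee]]]]].
  exists 1, d', [::]; split=> //; first by exists 1; rewrite mul1r.
  by rewrite ed'.
rewrite {}ee in ed'; case: k ed' => ed'; last first.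
  have := expr_inword d'; rewrite ed' !inword_cat => /and3P[i1 i2 i3].
  have := hm (e1 ++ e2); rewrite inword_cat i1 i3 -hz ed' !size_cat /= => /(_ isT).
  have hpp i : (i < size v)%N -> pfun (e1 ++ e2) i = pfun (expr d) i.
    by move=> _; rewrite -hp ed' !pfun_cat /= swpK.
  by move=> /(_ hpp); lia.
have [c [t [Y [uc hs ut et hY]]]] := redex_sts hd' ed'.
have hw' : (wt (size v) (expr t) < wt (size v) (expr d'))%N.
  have := expr_inword d'; rewrite et ed' !inword_cat inword_shw_lhs => /and3P[_ h _].
  by rewrite !wt_cat /shw /= /wt /=; lia.
have hzt : size (expr t) = size (expr d) by rewrite -hz et ed' !size_cat.
have hpt : pfun (expr t) =1 pfun (expr d).
  move=> i; rewrite -hp et ed' !pfun_cat; congr pfun.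
  by rewrite /shw [map _ _]/= !addn0 addn1 pfun_braid.
have [||c' [d1 [Y' [uc' r1 hd1 hp1 hY']]]] := ih (wt (size v) (expr t)) _ t (leqnn _) ut.
- by apply: leq_trans hM; rewrite -hw.
- by rewrite /short hzt => e'' he'' h; apply: hm => // i hi'; rewrite h ?hpt.
exists (c * c'), d1, (lscale c Y' ++ Y); split=> //.
- case: uc uc' => x xc [y yc]; exists (y * x).
  by rewrite mulrA -(mulrA y) xc mulr1.
- apply: red_trans r0 _; apply: red_trans (red_step hs) _.
  have := red_ctx [::] Y (red_scale c r1); rewrite /lscale /= mulr1.
  exact.
- by move=> i; rewrite hp1 hpt.
rewrite all_cat /lscale all_map; apply/andP; split.
  by apply: sub_all hY' => t'; rewrite /= hzt.
by apply: sub_all hY => t' /andP[+ _]; rewrite hz.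
Qed.

End Reduction.

(** * Permutations and morphisms *)

Lemma simple_trE n k (p : 'I_n) : (k.+1 < n)%N -> simple_tr n k p = swp k p :> nat.
Proof.
move=> hk; have hk' : (k < n)%N by lia.
rewrite /simple_tr (insubT (fun i => i < n)%N hk') (insubT (fun i => i < n)%N hk) /= /swp.
case: tpermP => [->|->|/eqP h1 /eqP h2] /=; rewrite ?eqxx //.
  by case: eqP => //; lia.
by move: h1 h2; rewrite -!val_eqE /= => /negbTE-> /negbTE->.
Qed.
Lemma perm_pfun n e (p : 'I_n) : inword n e -> perm_of_expr n e p = pfun e p :> nat.
Proof.
elim: e => [|j e ih] /=; first by rewrite perm1.
by move=> /andP[hj he]; rewrite permM simple_trE // ih.
Qed.
Lemma eq_perm_pfun n e e' : inword n e -> inword n e' ->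
  perm_of_expr n e = perm_of_expr n e' <-> forall i, (i < n)%N -> pfun e i = pfun e' i.
Proof.
move=> he he'; split=> [h i hi|h].
  by rewrite -(perm_pfun (Ordinal hi) he) h (perm_pfun _ he').
by apply/permP => p; apply: val_inj; rewrite /= !perm_pfun // h.
Qed.
Lemma reduced_short n (g : 'S_n) e : reduced_expr g e -> short n e.
Proof.
by case=> he eg hm e' he' h; apply: hm => //; rewrite -eg; apply/eq_perm_pfun.
Qed.
Lemma isnf_inword n e : isnf n e -> inword n e.
Proof. by case/existsP => c /eqP <-; apply: nf_inword. Qed.
Lemma isnf_reduced n e : isnf n e -> reduced_expr (perm_of_expr n e) e.
Proof.
move=> hn; have he := isnf_inword hn; split=> // e' he' /eq_perm_pfun h.
by case/existsP: hn he h => c /eqP <- he h; apply: nf_shortest => // i hi; apply: h.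
Qed.
Lemma isnf_inj n e e' : isnf n e -> isnf n e' ->
  (forall i, (i < n)%N -> pfun e i = pfun e' i) -> e = e'.
Proof.
by move=> /existsP[c /eqP <-] /existsP[c' /eqP <-] h; rewrite (nf_inj h).
Qed.

Section Hom.
Variables (kk : comPzRingType) (H : heckeData kk).
Local Notation Rw := (dots (@dotalg kk H)).
Local Notation crossing := (@crossing kk H).
Local Notation diag := (@diag kk H).
Local Notation lincomb := (@lincomb kk H).
Local Notation hom := (@Defs.hom kk H).

Lemma diag_colors v w (d : diag v w) x0 i : (i < size v)%N ->
  nth x0 w (pfun (expr d) i) = nth x0 v i.
Proof.
move=> hi; elim: d => // u u' c d <-.
have : (pfun (expr d) i < size u)%N.
  by rewrite (size_diag d); apply: pfun_lt hi; apply: expr_inword.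
have -> : pfun (expr (dcross c d)) i = swp (height c) (pfun (expr d) i) by [].
move: (pfun _ i) => {hi}; elim: c => {u u' d v w} [x y b p|k u u' c ih] [|j] //=.
- by case: j => [|j]; rewrite /swp /=.
- by move=> /ih <-; rewrite /swp !eqSS; do ?case: ifP.
Qed.

(** A crossing is determined by its height and its top word. *)
Lemma undec_eq v w (d d' : diag v w) : undecorated d -> undecorated d' ->
  expr d = expr d' -> d = d'.
Proof.
elim: d d' => [|//|u u' c d ih] d' /=.
  have nil w' (t : diag v w') : undecorated t -> expr t = [::] ->
      forall e : v = w', ecast z (diag v z) e (dnil v) = t.
    by case: t => // _ _ e; rewrite eq_axiomK.
  by move=> _ ud /esym ed; have := nil _ _ ud ed erefl.
case: d' c ih => [|//|u1 w1 c1 d1] //= c ih hd hd1 [hc he].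
have E : existT (fun v => crossing v w1) u c = existT _ u1 c1.
  by have := pos_height c1; rewrite -hc pos_height => -[].
pose F (x : {u & crossing u w1}) := forall d1 : diag v (projT1 x), undecorated d1 ->
  expr d = expr d1 -> dcross c d = dcross (projT2 x) d1.
suff : F (existT _ u1 c1) by apply.
by rewrite -E => d2 hd2 he2; rewrite /= (ih d2).
Qed.

Lemma isotopic_pfun v w (d d' : diag v w) : isotopic d d' ->
  pfun (expr d) =1 pfun (expr d').
Proof.
elim=> {d d'} [d d' h|d|d d' _ h|d d' d'' _ h _ h'] i.
- have [e1 [e2 [a [b [hab -> ->]]]]] := far_expr h.
  apply: pfun_far; apply: (@fareq_swap e1 e2 a b); first by rewrite /farl hab.
  exact: fareq_refl.
- by [].
- by rewrite h.
by rewrite h h'.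
Qed.

Lemma step_hom v w (d : diag v w) Z : step d Z -> hom_eq [:: (1, d)] Z.
Proof.
case=> {d Z}.
- exact: hom_cross.
- by move=> u u' T s f Z B _ h; apply: hom_dot; apply: DotStep.
- exact: hom_dotM.
- move=> u T B; have := hom_dot_scal T 1 B; rewrite rmorph1; exact.
- exact: hom_far.
by move=> d d' h; apply: hom_sym; apply: hom_far.
Qed.
Lemma reduces_hom v w (S : diag v w -> lincomb v w -> Prop) (X Y : lincomb v w) :
  (forall d Z, S d Z -> hom_eq [:: (1, d)] Z) -> reduces S X Y -> hom_eq X Y.
Proof.
move=> hS; elim=> {X Y} [X Y [{}X c d Y' Z hd]|X|X Y Z _ h _ h'].
- apply: hom_cat; first exact: hom_refl.
  apply: (@hom_cat _ _ _ _ [:: (c, d)]); last exact: hom_refl.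
  by have := hom_scale c (hS _ _ hd); rewrite /lscale /= mulr1.
- exact: hom_refl.
exact: hom_trans h h'.
Qed.

Lemma hclass_sum v w (X : lincomb v w) :
  hclass X = \sum_(t <- X) hclass [:: t] :> hom v w.
Proof.
elim: X => [|[c d] X ih]; first by rewrite big_nil.
by rewrite big_cons hclass_cons ih.
Qed.

Lemma hclass_left v w c (d : diag v w) :
  hclass [:: (c, d)] = (scal (Rw w) c * topdots d) *: hclass [:: (1, undot d)] :> hom v w.
Proof.
have top (t : diag v w) : hclass [:: (1, t)] = topdots t *: hclass [:: (1, undot t)] :> hom v w.
  elim: t => [|u f t ih|u u' s t _] /=; rewrite ?scale1r //.
  rewrite -scalerA -ih [RHS]hdotE //.
have -> : hclass [:: (c, d)] = scal (Rw w) c *: hclass [:: (1, d)] :> hom v w.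
  rewrite [RHS]hdotE; apply/hclassP; apply: hom_sym; exact: (hom_dot_scal (dnil w) c d).
by rewrite top scalerA.
Qed.

End Hom.

(** * Triangular change of basis *)

Section Triangular.
Variables (R : comPzRingType) (M : lmodType R) (T : finType).
Implicit Types a b : T -> M.

Definition spanning a := forall x, exists c : {ffun T -> R}, x = \sum_t c t *: a t.
Definition independent a := forall c : {ffun T -> R},
  \sum_t c t *: a t = 0 -> forall t, c t = 0.

Lemma basisP a : spanning a -> independent a -> is_basis a.
Proof.
move=> sa ia x; have [c xc] := sa x; exists c; split=> // c' xc'.
apply/ffunP => t; apply/eqP; rewrite -subr_eq0; apply/eqP.
have := ia [ffun t => c t - c' t]; rewrite (eq_bigr (fun t => c t *: a t - c' t *: a t)).
  by rewrite sumrB -xc -xc' subrr => /(_ erefl t); rewrite ffunE.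
by move=> u _; rewrite ffunE scalerBl.
Qed.

Lemma triangular_basis a b (len : T -> nat) (l : T -> R) (m : T -> T -> R) :
  spanning a -> independent a -> (forall t, exists l', l' * l t = 1) ->
  (forall t u, (len t <= len u)%N -> m t u = 0) ->
  (forall t, b t = l t *: a t + \sum_u m t u *: a u) -> is_basis b.
Proof.
move=> sa ia lu m0 eb; apply: basisP.
  have sb t : exists c : {ffun T -> R}, a t = \sum_u c u *: b u.
    have [k] := ubnP (len t); elim: k t => // k ih t; rewrite ltnS => hk.
    have hc u : exists c : {ffun T -> R}, m t u *: a u = \sum_u' c u' *: b u'.
      have [h|h] := leqP (len t) (len u).
        by exists [ffun=> 0]; rewrite m0 // scale0r big1 // => u' _; rewrite ffunE scale0r.
      have [c ->] := ih u (leq_trans h hk); exists [ffun u' => m t u * c u'].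
      by rewrite scaler_sumr; apply: eq_bigr => u' _; rewrite ffunE scalerA.
    have [c hc'] := choice hc; have [l' hl] := lu t.
    exists [ffun u' => l' * ((u' == t)%:R - \sum_u c u u')].
    have -> : a t = l' *: (b t - \sum_u m t u *: a u).
      by rewrite eb addrK scalerA hl scale1r.
    transitivity (l' *: \sum_u' ((u' == t)%:R - \sum_u c u u') *: b u'); last first.
      by rewrite scaler_sumr; apply: eq_bigr => u' _; rewrite ffunE scalerA.
    congr (_ *: _); rewrite [RHS](eq_bigr (fun u' => (u' == t)%:R *: b u' -
      \sum_u c u u' *: b u')); last by move=> u' _; rewrite scalerBl -scaler_suml.
    rewrite sumrB exchange_big /=; congr (_ - _); last exact: eq_bigr.
    rewrite (bigD1 t) //= eqxx scale1r big1 ?addr0 // => u /negbTE->.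
    by rewrite scale0r.
  move=> x; have [c ->] := sa x; have [d hd] := choice sb.
  exists [ffun u => \sum_t c t * d t u].
  rewrite (eq_bigr (fun t => \sum_u (c t * d t u) *: b u)); last first.
    by move=> t _; rewrite {1}hd scaler_sumr; apply: eq_bigr => u _; rewrite scalerA.
  by rewrite exchange_big; apply: eq_bigr => u _; rewrite ffunE scaler_suml.
move=> c hc; pose L := \max_t len t.
suff H k t : (L - len t < k)%N -> c t = 0 by move=> t; apply: (H (L - len t).+1%N).
elim: k t => // k ih t hk.
have hs : \sum_t [ffun u => c u * l u + \sum_s c s * m s u] t *: a t = 0.
  rewrite -[RHS]hc (eq_bigr (fun u => (c u * l u) *: a u + \sum_s (c s * m s u) *: a u)).
    rewrite big_split exchange_big -big_split; apply: eq_bigr => u _ /=.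
    by rewrite eb scalerDr scalerA scaler_sumr; congr (_ + _); apply: eq_bigr => s _; rewrite scalerA.
  by move=> u _; rewrite ffunE scalerDl scaler_suml.
have := ia _ hs t; rewrite ffunE big1 ?addr0.
  by move=> h; have [l' hl] := lu t; rewrite -[c t]mulr1 -hl mulrCA h mulr0.
move=> s _; have [h|h] := leqP (len s) (len t); first by rewrite m0 ?mulr0.
rewrite ih ?mul0r //; have := @leq_bigmax _ len s; rewrite -/L; lia.
Qed.
End Triangular.

Section Main.
Variables (kk : comPzRingType) (H : heckeData kk).
Local Notation I := (color H).
Local Notation Rw := (dots (@dotalg kk H)).
Local Notation diag := (@diag kk H).
Local Notation lincomb := (@lincomb kk H).
Local Notation hom := (@Defs.hom kk H).
Local Notation "x ** y" := (dcomp x y)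
  (at level 40, y at level 40, right associativity).

Section Fixed.
Variables (n : nat) (v w : n.-tuple I).
Local Notation P := (permissible_perm v w).

Definition nfdiag (d : diag v w) : bool := left_diag d && isnf n (expr d).

Lemma perm_nf (g : P) : exists d : diag v w,
  [/\ undecorated d, isnf n (expr d) & perm_of_expr n (expr d) = val g].
Proof.
have /asboolP[_ [d [hd hr]]] := valP g.
have hs := reduced_short hr.
have [|c [d' [Y [_ _ [ud hn] hp _]]]] := reduce_lead hd; first by rewrite size_tuple.
rewrite size_tuple in hn; exists d'; split=> //.
case: hr => he <- _; apply/eq_perm_pfun => //; exact: isnf_inword.
Qed.
(** The normal form of a permissible permutation; it exists because a reduced
    diagram has one as leading term. *)
Definition nfd (g : P) : diag v w := projT1 (cid (perm_nf g)).
Lemma nfdP g : [/\ undecorated (nfd g), isnf n (expr (nfd g)) &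
  perm_of_expr n (expr (nfd g)) = val g].
Proof. exact: projT2 (cid (perm_nf g)). Qed.
Lemma nfd_eq d g : undecorated d -> isnf n (expr d) ->
  (forall i, (i < n)%N -> pfun (expr d) i = pfun (expr (nfd g)) i) -> d = nfd g.
Proof.
move=> ud hd h; have [ug hg _] := nfdP g.
by apply: undec_eq => //; apply: isnf_inj h.
Qed.
Lemma nfd_inj : injective nfd.
Proof.
move=> g g' e; apply: val_inj; have [_ _ <-] := nfdP g; have [_ _ <-] := nfdP g'.
by rewrite e.
Qed.
Lemma nfd_surj d : undecorated d -> isnf n (expr d) -> exists g, d = nfd g.
Proof.
move=> ud hd; have hi := isnf_inword hd.
have hp : `[< permissible v w (perm_of_expr n (expr d)) >].
  apply/asboolP; split; last by exists d; split=> //; apply: isnf_reduced.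
  move=> p; have x0 : I := tnth v p.
  rewrite !(tnth_nth x0) perm_pfun //.
  by rewrite diag_colors // size_tuple.
pose g : P := exist (fun g : 'S_n => is_true `[< permissible v w g >]) _ hp.
exists g; apply: nfd_eq => //; have [_ hn eg] := nfdP g.
by apply/eq_perm_pfun; rewrite ?eg //; apply: isnf_inword.
Qed.
Lemma nfd_reduced g : reduced_diagram (val g) (nfd g).
Proof. by have [u h <-] := nfdP g; split=> //; apply: isnf_reduced. Qed.

Lemma undec_top (d : diag v w) : undecorated d -> topdots d = 1 /\ undot d = d.
Proof. by case: d. Qed.
Definition coef (X : lincomb v w) (g : P) : Rw w :=
  \sum_(t <- X | `[< undot t.2 = nfd g >]) scal (Rw w) t.1 * topdots t.2.
Definition nfclass (g : P) : hom v w := hclass [:: (1, nfd g)].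

Lemma nfdiag_undot d : nfdiag d -> exists g, undot d = nfd g.
Proof.
by move=> /andP[hl hn]; apply: nfd_surj; rewrite ?expr_undot.
Qed.

Lemma hclass_coef X : all (fun t => nfdiag t.2) X ->
  hclass X = \sum_g coef X g *: nfclass g.
Proof.
move=> hX; rewrite hclass_sum.
rewrite [RHS](eq_bigr (fun g => \sum_(t <- X | `[< undot t.2 = nfd g >])
  (scal (Rw w) t.1 * topdots t.2) *: nfclass g)); last by move=> g _; rewrite scaler_suml.
rewrite (exchange_big_dep predT) //=.
elim: X hX => [|[c d] X ih] /=; first by rewrite !big_nil.
move=> /andP[/nfdiag_undot[g /= eg] /ih {}ih]; rewrite !big_cons -ih; congr (_ + _).
rewrite hclass_left (big_pred1 g) /=; first by rewrite eg.
move=> g'; apply/asboolP/eqP => [|->] //.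
by rewrite eg => /nfd_inj.
Qed.

(** Isotopic normal forms have the same permutation and hence coincide, so that
    [left_coef] computes the coordinates in the normal forms. *)
Lemma left_coef_iso X g d : all (fun t => nfdiag t.2) X -> isotopic (nfd g) d ->
  left_coef X d = coef X g.
Proof.
rewrite /left_coef /coef => hX hg.
elim: X hX => [|t X ih] /=; first by rewrite !big_nil.
move=> /andP[ht /ih e]; rewrite !big_cons e.
have -> // : `[< isotopic (undot t.2) d >] = `[< undot t.2 = nfd g >].
case/andP: ht => hl hn; apply/asboolP/asboolP => [h|-> //].
apply: nfd_eq; rewrite ?expr_undot // => i _.
by rewrite -(expr_undot t.2) (isotopic_pfun h) (isotopic_pfun hg).
Qed.
Lemma left_coef_none X d : all (fun t => nfdiag t.2) X ->
  (forall g, ~ isotopic (nfd g) d) -> left_coef X d = 0.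
Proof.
rewrite /left_coef => hX hd; elim: X hX => [|t X ih] /=; first by rewrite !big_nil.
move=> /andP[/nfdiag_undot[g eg] /ih e]; rewrite big_cons e.
by case: asboolP => //; rewrite eg => /hd.
Qed.

Lemma reduce_lin (X : lincomb v w) : reducible_to (@step _ _) nfdiag X.
Proof.
apply: (@red_all _ _ (@step _ _) v w _ X (fun=> True)).
  by elim: X => //= t X ->; rewrite andbT; apply/asboolP.
move=> d _; apply: red_sub (reduce_normal d) => t /and3P[h1 h2 _].
by rewrite /nfdiag h1 -{1}(size_tuple v).
Qed.

(** Reductions of equal morphisms to normal forms have the same coordinates. *)
Lemma bases_joinable (X Y : lincomb v w) : has_reduced_bases H -> hom_eq X Y -> joinable X Y.
Proof.
move=> hB hXY; have [X' rX nX] := reduce_lin X; have [Y' rY nY] := reduce_lin Y.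
have e : hclass X' = hclass Y' :> hom v w.
  apply/hclassP; apply: hom_trans (hom_sym (reduces_hom (@step_hom _ _ v w) rX)) _.
  exact: hom_trans hXY (reduces_hom (@step_hom _ _ v w) rY).
have ec g : coef X' g = coef Y' g.
  have [c [_ cu]] := hB n v w nfd nfd_reduced (hclass X').
  have e1 : c = [ffun g => coef X' g].
    apply: cu; rewrite {1}hclass_coef //; apply: eq_bigr => g' _; by rewrite ffunE.
  have e2 : c = [ffun g => coef Y' g].
    apply: cu; rewrite e {1}hclass_coef //; apply: eq_bigr => g' _; by rewrite ffunE.
  by have := congr1 (fun f : {ffun P -> Rw w} => f g) (etrans (esym e1) e2); rewrite !ffunE.
have left_all (Z : lincomb v w) : all (fun t => nfdiag t.2) Z -> left_form Z.
  by apply: sub_all => t /andP[].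
exists X', Y'; split=> //; try exact: left_all.
move=> d; have [[g hg]|hn] := pselect (exists g, isotopic (nfd g) d).
  by rewrite !(left_coef_iso _ hg).
by rewrite !left_coef_none // => g hg; apply: hn; exists g.
Qed.

Lemma nf_spanning : spanning nfclass.
Proof.
move=> x; have [X' rX nX] := reduce_lin (hrepr x).
exists [ffun g => coef X' g].
rewrite -[LHS]hreprK (_ : hclass (hrepr x) = hclass X'); last first.
  by apply/hclassP; apply: reduces_hom rX; apply: step_hom.
by rewrite hclass_coef //; apply: eq_bigr => g _; rewrite ffunE.
Qed.

Lemma reduced_basis (D : P -> diag v w) : independent nfclass ->
  (forall g, reduced_diagram (val g) (D g)) ->
  is_basis (fun g => hclass [:: (1, D g)] : hom v w).
Proof.
move=> hi hD.
have hex g : exists cm : kk * {ffun P -> Rw w},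
  [/\ unit_scalar cm.1,
   (forall u, (size (expr (nfd g)) <= size (expr (nfd u)))%N -> cm.2 u = 0) &
   hclass [:: (1, D g)] = scal (Rw w) cm.1 *: nfclass g + \sum_u cm.2 u *: nfclass u :> hom v w].
  have [ud hr] := hD g; have hs := reduced_short hr.
  have [|c [d' [Y [uc r [ud' hn] hp hY]]]] := reduce_lead ud; first by rewrite size_tuple.
  rewrite size_tuple in hn.
  have [_ hng eg] := nfdP g; case: hr => hin er _.
  have hpg i : (i < n)%N -> pfun (expr (nfd g)) i = pfun (expr (D g)) i.
    by move: i; apply/(eq_perm_pfun (isnf_inword hng) hin); rewrite eg er.
  have ed' : d' = nfd g by apply: nfd_eq => // i hi'; rewrite hp hpg.
  have hsz : (size (expr (D g)) <= size (expr (nfd g)))%N.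
    by apply: hs => //; apply: isnf_inword.
  have [Y' rY nY] : reducible_to (@step _ _)
      (fun d => nfdiag d && (size (expr d) < size (expr (D g)))%N) Y.
    apply: (@red_all _ _ (@step _ _) v w _ Y (fun d => (size (expr d) < size (expr (D g)))%N)).
      by apply: sub_all hY => t ht; apply/asboolP.
    move=> d hd; apply: red_sub (reduce_normal d) => t /and3P[h1 h2 h3].
    by rewrite /nfdiag h1 -{1}(size_tuple v) h2 /=; apply: leq_ltn_trans h3 hd.
  have nY' : all (fun t => nfdiag t.2) Y' by apply: sub_all nY => t /andP[].
  exists (c, [ffun u => coef Y' u]); split=> //= [u hu|].
    rewrite ffunE /coef; elim: Y' nY {rY nY'} => [|t Y' ih] /=; first by rewrite big_nil.
    move=> /andP[/andP[_ ht] /ih e]; rewrite big_cons e; case: asboolP => // eu.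
    by move: ht; rewrite -(expr_undot t.2) eu; lia.
  have -> : hclass [:: (1, D g)] = hclass ((c, d') :: Y) :> hom v w.
    by apply/hclassP; apply: reduces_hom r; apply: step_hom.
  rewrite [LHS]hclass_cons; congr (_ + _).
    by have [et eu] := undec_top ud'; rewrite hclass_left et eu mulr1 ed'.
  rewrite (_ : hclass Y = hclass Y'); last first.
    by apply/hclassP; apply: reduces_hom rY; apply: step_hom.
  by rewrite hclass_coef //; apply: eq_bigr => u _; rewrite ffunE.
have [cm hcm] := choice hex.
apply: (@triangular_basis _ _ _ nfclass _ (fun g => size (expr (nfd g)))
  (fun g => scal (Rw w) (cm g).1) (fun g u => (cm g).2 u)) => //.
- exact: nf_spanning.
- move=> g; have [[x hx] _ _] := hcm g; exists (scal (Rw w) x).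
  by rewrite -rmorphM hx rmorph1.
- by move=> g u h; have [_ h' _] := hcm g; apply: h'.
by move=> g; have [_ _ ->] := hcm g.
Qed.

End Fixed.

Section Ambiguities.
Hypothesis hB : has_reduced_bases H.

Lemma rule_hom v w u u' (T : diag u' w) (L : diag u u') Z (B : diag v u) :
  crossrule L Z -> hom_eq [:: (1, T ** L ** B)] (lcomp T Z B).
Proof.
move=> hL; have := hom_cross (@CrossStep _ _ v w [::] u u' T L Z B hL).
by rewrite (_ : Defs.lshift [::] Z = Z) // /Defs.lshift -[RHS]map_id; apply: eq_map => -[].
Qed.

Lemma bases_resolvable n (v w : n.-tuple I) u1 u1' u2 u2'
    (T1 : diag u1' w) (L1 : diag u1 u1') (B1 : diag v u1)
    (T2 : diag u2' w) (L2 : diag u2 u2') (B2 : diag v u2) :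
  (exists Z, crossrule L1 Z) -> (exists Z, crossrule L2 Z) ->
  hom_eq [:: (1, T1 ** L1 ** B1)] [:: (1, T2 ** L2 ** B2)] ->
  resolvable T1 L1 B1 T2 L2 B2.
Proof.
move=> [Z1 h1] [Z2 h2] he; exists Z1, Z2; split=> //; apply: bases_joinable => //.
apply: hom_trans (hom_sym (rule_hom T1 B1 h1)) _.
exact: hom_trans he (rule_hom T2 B2 h2).
Qed.

Lemma sts_rule_ex (x y z : I) b (pxy : permitted x y) (pxz : permitted x z)
    (pyz : permitted y z) : exists Z, crossrule (sts b pxy pxz pyz) Z.
Proof. by have [c [Y [_ h _]]] := sts_rule b pxy pxz pyz; eexists; apply: h. Qed.

Lemma bases_dots n (v w : n.-tuple I) (L : diag v w) f :
  (exists Z, crossrule L Z) -> dot_resolvable L f.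
Proof.
move=> [Z hL]; have [Z' r q] := left_red (@dotstep_comp _ _) (@dotstep_push _ _) (L ** dot f).
exists Z, Z'; split=> //; first by apply: sub_all q => t /andP[].
apply: bases_joinable => //.
apply: hom_trans (hom_sym (rule_hom (dnil w) (dot f) hL)) _.
by apply: reduces_hom r => d Y; apply: hom_dot.
Qed.

Lemma bases_ambiguities :
  [/\ [/\ overlap_sss H, overlap_ssts H, overlap_stss H, overlap_ststs H
        & overlap_stsuts H],
      ambiguity_ssf H, ambiguity_stsf H & ambiguity_sfg H].
Proof.
split; first split.
- move=> x y p q; apply: (@bases_resolvable 2 [tuple x; y] [tuple y; x]);
    try exact: ss_rule; exact: hom_refl.
- move=> x y z p q r t; apply: (@bases_resolvable 3 [tuple x; y; z] [tuple y; z; x]);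
    [exact: ss_rule|exact: sts_rule_ex|exact: hom_refl].
- move=> x y z p q r t; apply: (@bases_resolvable 3 [tuple x; y; z] [tuple z; x; y]);
    [exact: sts_rule_ex|exact: ss_rule|exact: hom_refl].
- move=> x y z p q r t r'; apply: (@bases_resolvable 3 [tuple x; y; z] [tuple x; z; y]);
    [exact: sts_rule_ex|exact: sts_rule_ex|exact: hom_refl].
- move=> x y z k pxy pxz pxk pyz pyk pzk.
  apply: (@bases_resolvable 4 [tuple x; y; z; k] [tuple k; z; y; x]);
    [exact: sts_rule_ex|exact: sts_rule_ex|].
  have hf := @Far kk H [:: x; y; z; k] [:: k; z; y; x] [::] y z [::] x k [::] pyz pxk.
  apply: hom_far.
  exact: (hf (cross [:: y; x] pzk ** dshift [:: z] (cross [:: x] pyk)) (ts [:: k] pxy pxz)).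
- move=> x y p q f; apply: (@bases_dots 2 [tuple x; y] [tuple x; y]); exact: ss_rule.
- move=> x y z p q r f; apply: (@bases_dots 3 [tuple x; y; z] [tuple z; y; x]).
  exact: sts_rule_ex.
move=> x y p f g; have [Z hZ _] := dotrule_exists (crossing0 [::] p) f; exists Z => //.
apply: (@bases_joinable 2 [tuple x; y] [tuple y; x]) => //.
apply: (@hom_trans _ _ _ _ _ [:: (1, cross [::] p ** dot f ** dot g)]).
  apply: hom_sym; exact: (hom_dotM (cross [::] p) f g (dnil _)).
apply: hom_dot; exact: (DotStep (dnil _) (dot g) hZ).
Qed.
End Ambiguities.

End Main.

(** * Linear independence of the normal forms *)

Section Independent.
Variables (kk : comPzRingType) (H : heckeData kk).
Local Notation I := (color H).
Local Notation Rw := (dots (@dotalg kk H)).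
Local Notation lincomb := (@lincomb kk H).
Local Notation hom := (@Defs.hom kk H).
Local Notation K := (dotfam H).

Lemma castw_tcat1 w (f : Rw w) : castw w (tcat f (1 : Rw [::])) = f.
Proof.
elim: w f => [|k w ih] f; first by rewrite (castw_id (v := [::])) /= mulr1.
elim/tens_ind: f => [|x y ex ey|r f].
- by rewrite tcat0l (klinear0 (castw_klin _ _ _)).
- by rewrite tcatDl (castw_klin _ _ _).1 ex ey.
by rewrite tcat_pure castw_cons ih.
Qed.
Lemma pad_self w (f : Rw w) : pad f w = f.
Proof.
rewrite -[RHS]castw_tcat1 -pad_cat; symmetry; apply: (castw_fam (pad f)).
by rewrite cats0.
Qed.

Lemma mvPw_predT e (P : pred (seq I)) w : mvPw e P w -> mvPw e predT w.
Proof.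
elim: e w => //= j e ih w; rewrite /mvP.
by case: (swapw j w) => // u; apply: ih.
Qed.

Hypothesis hH : dot_axioms H.
Local Notation D := (dotsys hH).
Hypothesis hR : resolves D.

(** A relation between normal forms, applied to the first basis vector, is the
    same relation between distinct basis vectors; its coefficient at the coloring
    w recovers each c g. *)
Lemma nf_independent n (v w : n.-tuple I) : independent (@nfclass kk H n v w).
Proof.
move=> c hc g0.
pose s := lin (@strand_act D n); pose x0 := bas D (code1 n).
have hP M : pact n s (@Fil D n) M := pact_act hR n M.
have hx : Fil (wt n (nf (code1 n))) x0 := @Fil_bas D n (code1 n).
have hs : twisted s := pact_semi (hP 0%N).
pose X : lincomb v w := [seq (1, ddot (c g) (nfd g)) | g <- index_enum (permissible_perm v w)].
have hX : hom_eq X [::].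
  apply/hclassP; rewrite [RHS](_ : _ = 0) // -[RHS]hc hclass_sum big_map.
  by apply: eq_bigr => g _; rewrite [RHS]hdotE.
have [_ hn0 _] := nfdP g0.
have /existsP[k0 /eqP ek0] := hn0.
have term g : ((sem s 0 (nfd g) x0 : freem D n) k0 : K) w = (g == g0)%:R.
  have [ug hn eg] := nfdP g; have /existsP[k /eqP ek] := hn.
  rewrite (run_undec 0 (hP 0%N)) // /shw map_id -ek run_nf //.
  rewrite freemZ basE -[LHS]/((padp 0 (1 : Rw w) * (if k0 == k then pidem D k else 0 : D) : K) w).
  have e1 : padp 0 (1 : Rw w) w = 1 by exact: pad_self.
  rewrite famM e1 mul1r.
  have -> : (k0 == k) = (g == g0).
    apply/eqP/eqP => [e|e].
      apply: nfd_inj; apply: undec_eq => //; first by have [] := nfdP g0.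
      by rewrite -ek -ek0 e.
    by apply: nf_inj => i _; rewrite ek ek0 e.
  case: ifP => // _; rewrite /pidem (mvw1 hH) /ind.
  have := @mvPw_diag _ _ _ _ (nfd g) [::] [::] ug; rewrite !cats0 /shw map_id -ek.
  by move=> /mvPw_predT ->.
have := hom_sound hP hx (size_tuple v) hX.
rewrite /semL big_map big_nil => /(congr1 (fun y : freem D n => (y k0 : K) w)).
rewrite (big_morph (fun y : freem D n => (y k0 : K) w) (id1 := 0) (op1 := +%R)); first last.
- by rewrite ffunE.
- by move=> y z; rewrite ffunE famD.
have top g : ((sem s 0 (ddot (c g) (nfd g)) x0 : freem D n) k0 : K) w = c g * (g == g0)%:R.
  rewrite -term; have e1 : padp 0 (c g) w = c g by exact: pad_self.
  rewrite -[in RHS]e1.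
  exact: (congr1 (fun F : K => F w) (freemZ (padp 0 (c g) : D) (sem s 0 (nfd g) x0) k0)).
rewrite (bigD1 g0) //= big1 ?addr0 => [|g ne]; rewrite scalK1.
  move=> h; apply: etrans (etrans h _); last by rewrite ffunE.
  by apply: esym; apply: etrans (top g0) _; rewrite eqxx mulr1.
by apply: etrans (top g) _; rewrite (negbTE ne) mulr0.
Qed.
End Independent.

Theorem theorem1p3 (kk : comPzRingType) (H : heckeData kk) :
  has_reduced_bases H <->
  [/\ [/\ overlap_sss H, overlap_ssts H, overlap_stss H, overlap_ststs H
        & overlap_stsuts H],
      ambiguity_ssf H, ambiguity_stsf H & ambiguity_sfg H].
Proof.
split=> [hB|[h1 h2 h3 h4]]; first exact: bases_ambiguities.
have hH := sfg_axioms h4; have hR := resolves_dotsys hH h1 h2 h3.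
move=> n v w D hD; apply: reduced_basis hD; exact: nf_independent.
Qed.
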